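(* Let $M\subset \mathbb{C}P^n$ be an arbitrary (immersed) submanifold, with normal bundle $NM\subset T\mathbb{C}P^n$. Then $\Phi(NM)$ is a Lagrangian submanifold of $\mathcal{M}$ with respect to the Stenzel Kähler form $\Omega$; that is, $\Omega|_{\Phi(NM)}\equiv 0$ (and $\dim_{\mathbb{R}}\Phi(NM)=2n=\tfrac12\dim_{\mathbb{R}}\mathcal{M}$).
   Context: $\mathbb{C}P^n$ carries the Fubini–Study metric for which the Hopf fibration $\pi:S^{2n+1}\to\mathbb{C}P^n$ from the unit sphere in $\mathbb{C}^{n+1}$ is a Riemannian submersion. $NM$ denotes the normal bundle of $M$ with respect to this metric. Submanifolds are smooth and may be immersed; statements about $\Phi(NM)$ are then read via the immersion $NM\to\mathcal{M}$ obtained by composing $NM\to T\mathbb{C}P^n$ with $\Phi$. For vectors in $\mathbb{C}^{n+1}$ the dot product is $\mathbb{C}$-bilinear. Let $B=\{(\zeta,\xi)\in\mathbb{C}^{n+1}\times\mathbb{C}^{n+1} : \zeta\neq 0,\ \xi\cdot\overline{\zeta}=0\}$. Then $T\mathbb{C}P^n\cong B/\mathbb{C}^*$, where $\lambda\in\mathbb{C}^*$ acts by $(\zeta,\xi)\mapsto(\lambda\zeta,\lambda\xi)$, the class of $(\zeta,\xi)$ being the tangent vector $\frac{d}{ds}\big|_{s=0}[\zeta+s\xi]$ at $[\zeta]$. $\mathcal{M}\subset\mathbb{C}P^n\times\mathbb{C}P^n$ is the open set of pairs $([z],[w])$ with $\sum_{i=0}^n z_iw_i\neq 0$. The map $\Phi:T\mathbb{C}P^n\to\mathcal{M}$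 is the bijective identification (diffeomorphism) induced by $$(\zeta,\xi)\mapsto\Big((\cosh\mu)\zeta+\mathrm{i}\tfrac{\sinh\mu}{\mu}\xi\,;\ (\cosh\mu)\overline{\zeta}+\mathrm{i}\tfrac{\sinh\mu}{\mu}\overline{\xi}\Big),\qquad \mu=\frac{|\xi|}{|\zeta|}$$ (with $\sinh\mu/\mu=1$ at $\mu=0$). The Stenzel Kähler form on $\mathcal{M}$ is $\Omega=\mathrm{i}\,\partial\bar\partial f(\mathcal{N})$, where $\mathcal{N}=\mathcal{A}/|\mathcal{B}|^2$, $\mathcal{A}=\sum_{j,k=0}^n|z_jw_k|^2$, $\mathcal{B}=\sum_{j=0}^n z_jw_j$, and $f$ satisfies $f'(\mathcal{N})=\mathcal{N}^{-1/2}$ (so $f(\mathcal{N})=2\sqrt{\mathcal{N}}$ up to an additive constant). *)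

(* Defs.v *)
From HB Require Import structures.
From mathcomp Require Import all_boot all_order all_algebra.
From mathcomp Require Import all_classical all_reals all_analysis.
From mathcomp Require Import complex ring.
Set Implicit Arguments.
Unset Strict Implicit.
Unset Printing Implicit Defensive.
Import Order.TTheory GRing.Theory Num.Theory.
Import numFieldNormedType.Exports.
Local Open Scope classical_set_scope.
Local Open Scope ring_scope.
Local Open Scope quotient_scope.
Local Open Scope complex_scope.

(** * Smooth manifolds, maps, immersions and embedded submanifolds *)

(* For E and F finite-dimensional and U open, [smooth_on U f] is the usual
   C^infinity condition on U; 'D_v f x only depends on the germ of f at x. *)
Fixpoint Ck (R : realType) (E F : normedModType R) (r : nat) (U : set E)
    (f : E -> F) : Prop :=
  match r with
  | 0 => forall x, U x -> {for x, continuous f}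
  | r'.+1 => (forall x, U x -> differentiable f x) /\
             (forall v, Ck r' U (fun x => 'D_v f x))
  end.

Definition smooth_on (R : realType) (E F : normedModType R) (U : set E)
    (f : E -> F) : Prop := forall r, Ck r U f.

(* [cinv] is only meaningful on the image of [cdom] under [coord]. *)
Record chart (R : realType) (X : Type) (E : normedModType R) := Chart {
  cdom : set X;
  coord : X -> E;
  cinv : E -> X }.

Record smooth_manifold (R : realType) (m : nat) := SmoothManifold {
  mpoint :> topologicalType;
  atlas : set (chart mpoint 'rV[R]_m);
  manifold_hausdorff : hausdorff_space mpoint;
  manifold_second_countable : @second_countable mpoint;
  atlas_cover : forall x, exists2 a, atlas a & cdom a x;
  atlas_open : forall a, atlas a ->
    open (cdom a) /\ open (coord a @` cdom a);
  atlas_cancel : forall a, atlas a ->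
    forall x, cdom a x -> cinv a (coord a x) = x;
  atlas_homeo : forall a, atlas a ->
    (forall x, cdom a x -> {for x, continuous (coord a)}) /\
    (forall u, (coord a @` cdom a) u -> {for u, continuous (cinv a)});
  atlas_compatible : forall a b, atlas a -> atlas b ->
    smooth_on (coord a @` (cdom a `&` cdom b)) (coord b \o cinv a) }.

Definition open_atlas (R : realType) (E : normedModType R) (U : set E) :
  set (chart E E) := [set Chart U id id].

Definition prod_atlas (R : realType) (X Y : Type) (E F : normedModType R)
    (A : set (chart X E)) (B : set (chart Y F)) :
    set (chart (X * Y) (E * F)%type) :=
  [set c | exists a b, [/\ A a, B b & c =
    Chart (cdom a `*` cdom b) (fun p => (coord a p.1, coord b p.2))
          (fun e => (cinv a e.1, cinv b e.2))]].

(* The atlases carry the topology: [V] gives continuity of f.  The first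
   conjunct says that f takes values in the points covered by B. *)
Definition smooth_map (R : realType) (X Y : Type) (E F : normedModType R)
    (A : set (chart X E)) (B : set (chart Y F)) (f : X -> Y) : Prop :=
  forall a x, A a -> cdom a x ->
    (exists2 b, B b & cdom b (f x)) /\
    forall b, B b -> cdom b (f x) ->
      exists V : set E,
        [/\ open V, V (coord a x), V `<=` coord a @` cdom a,
            (forall u, V u -> cdom b (f (cinv a u))) &
            smooth_on V (coord b \o f \o cinv a)].

Definition immersion (R : realType) (X Y : Type) (E F : normedModType R)
    (A : set (chart X E)) (B : set (chart Y F)) (f : X -> Y) : Prop :=
  smooth_map A B f /\
  forall a b x, A a -> B b -> cdom a x -> cdom b (f x) ->
    injective ('d (coord b \o f \o cinv a) (coord a x)).

Definition atlas_nbhs (R : realType) (X : Type) (E : normedModType R)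
    (A : set (chart X E)) (x : X) (W : set X) : Prop :=
  exists a, [/\ A a, cdom a x &
    nbhs (coord a x) (coord a @` (cdom a `&` W))].

(* An immersion of an open U in R^k that is a homeomorphism onto a relatively
   open subset of S. *)
Definition local_parametrization (R : realType) (X : Type)
    (E : normedModType R) (A : set (chart X E)) (S : set X)
    (k : nat) (U : set 'rV[R]_k) (g : 'rV[R]_k -> X) : Prop :=
  [/\ open U, immersion (open_atlas U) A g, {in U &, injective g},
      (forall u, U u -> S (g u)) &
      forall u V, U u -> nbhs u V ->
        exists2 W, atlas_nbhs A (g u) W & W `&` S `<=` g @` (V `&` U)].

Definition embedded_submanifold (R : realType) (X : Type)
    (E : normedModType R) (A : set (chart X E)) (S : set X) (k : nat) : Prop :=
  forall p, S p -> exists (U : set 'rV[R]_k) (g : 'rV[R]_k -> X),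
    local_parametrization A S U g /\ exists2 u, U u & g u = p.

(** * Complex vectors *)

Section ComplexVectors.
Variable R : realType.
Local Notation C := R[i].

Definition realify n (z : 'rV[C]_n) : 'rV[R]_n * 'rV[R]_n :=
  (map_mx (@complex.Re R) z, map_mx (@complex.Im R) z).

Definition complexify n (e : 'rV[R]_n * 'rV[R]_n) : 'rV[C]_n :=
  \row_k (e.1 0 k +i* e.2 0 k).

Definition conjv n (z : 'rV[C]_n) : 'rV[C]_n := map_mx (@conjc R) z.

Definition dot n (z w : 'rV[C]_n) : C := \sum_k z 0 k * w 0 k.

Definition normv n (z : 'rV[C]_n) : R :=
  Num.sqrt (complex.Re (dot z (conjv z))).

Definition insert n (i : 'I_n.+1) (c : C) (a : 'rV[C]_n) : 'rV[C]_n.+1 :=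
  \row_k (if unlift i k is Some l then a 0 l else c).

Definition affine n (i : 'I_n.+1) (z : 'rV[C]_n.+1) : 'rV[C]_n :=
  \row_k (z 0 (lift i k) / z 0 i).

Definition cderiv (c : R -> C) : C :=
  derive1 (fun s => complex.Re (c s)) 0 +i* derive1 (fun s => complex.Im (c s)) 0.

Definition taffine n (i : 'I_n.+1) (z x : 'rV[C]_n.+1) : 'rV[C]_n :=
  \row_k cderiv (fun s => affine i (z + s%:C *: x) 0 k).

Definition cosh (x : R) : R := (expR x + expR (- x)) / 2.
Definition sinh (x : R) : R := (expR x - expR (- x)) / 2.
Definition sinhc (x : R) : R := if x == 0 then 1 else sinh x / x.

Lemma dotZl n a (z w : 'rV[C]_n) : dot (a *: z) w = a * dot z w.
Proof. by rewrite /dot mulr_sumr; apply: eq_bigr => k _; rewrite mxE mulrA. Qed.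

Lemma dot0l n (w : 'rV[C]_n) : dot 0 w = 0.
Proof. by rewrite /dot big1 // => k _; rewrite mxE mul0r. Qed.

Lemma dotC n (z w : 'rV[C]_n) : dot z w = dot w z.
Proof. by apply: eq_bigr => k _; rewrite mulrC. Qed.

Lemma dotZr n a (z w : 'rV[C]_n) : dot z (a *: w) = a * dot z w.
Proof. by rewrite dotC dotZl dotC. Qed.

Lemma dotDl n (x y w : 'rV[C]_n) : dot (x + y) w = dot x w + dot y w.
Proof.
by rewrite /dot -big_split; apply: eq_bigr => k _; rewrite mxE mulrDl.
Qed.

Lemma conjvZ n a (z : 'rV[C]_n) : conjv (a *: z) = a^* *: conjv z.
Proof. by apply/rowP => k; rewrite !mxE rmorphM. Qed.

Lemma conjvK n : involutive (@conjv n).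
Proof. by move=> z; apply/rowP => k; rewrite !mxE conjcK. Qed.

Lemma conj_dot n (z w : 'rV[C]_n) : (dot z w)^* = dot (conjv z) (conjv w).
Proof.
by rewrite /dot rmorph_sum; apply: eq_bigr => k _; rewrite !mxE rmorphM.
Qed.

Lemma dot_conjvE n (z : 'rV[C]_n) :
  dot z (conjv z) = (\sum_k (complex.Re (z 0 k) ^+ 2 + complex.Im (z 0 k) ^+ 2))%:C.
Proof.
rewrite /dot rmorph_sum; apply: eq_bigr => k _; rewrite mxE.
case: (z 0 k) => a b /=; rewrite /real_complex_def /=; congr (_ +i* _); ring.
Qed.

Lemma dot_conjv_eq0 n (z : 'rV[C]_n) : (dot z (conjv z) == 0) = (z == 0).
Proof.
have H k : 0 <= complex.Re (z 0 k) ^+ 2 + complex.Im (z 0 k) ^+ 2.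
  by rewrite addr_ge0 ?sqr_ge0.
apply/eqP/eqP => [|->]; last by rewrite /dot big1 // => k _; rewrite mxE mul0r.
rewrite dot_conjvE => -[] /eqP; rewrite psumr_eq0 => [/allP h|k _]; last exact: H.
apply/rowP => k; have := h k (mem_index_enum k); rewrite mxE /=.
rewrite paddr_eq0 ?sqr_ge0// !sqrf_eq0.
by case: (z 0 k) => a b /= /andP[/eqP -> /eqP ->].
Qed.

Lemma cosh_neq0 (x : R) : (cosh x)%:C != 0 :> C.
Proof.
rewrite -[0]/(0%:C) (inj_eq (@complexI R)) gt_eqF// /cosh.
by rewrite divr_gt0 ?addr_gt0 ?expR_gt0.
Qed.

Lemma normvZ n a (z : 'rV[C]_n) : normv (a *: z) = Normc.normc a * normv z.
Proof.
rewrite /normv dotZl conjvZ dotZr mulrA.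
have -> : a * a^* = (Normc.normc a ^+ 2)%:C.
  case: a => x y /=; rewrite sqr_sqrtr ?addr_ge0 ?sqr_ge0//.
  by rewrite /real_complex_def; congr (_ +i* _); ring.
rewrite dot_conjvE /= mul0r subr0 sqrtrM ?sqr_ge0// sqrtr_sqr ger0_norm//.
by case: a => x y; exact: sqrtr_ge0.
Qed.

End ComplexVectors.

(** * Complex projective space and its tangent bundle *)

Section Projective.
Variables (R : realType) (n : nat).
Local Notation C := R[i].
Local Notation Cn1 := 'rV[C]_n.+1.
Local Notation ECn := ('rV[R]_n * 'rV[R]_n)%type.

Definition nzvec := {z : Cn1 | z != 0}.

Definition proj_rel (z w : nzvec) : bool :=
  `[< exists2 l : C, l != 0 & val w = l *: val z >].

Lemma proj_rel_refl : reflexive proj_rel.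
Proof. by move=> z; apply/asboolP; exists 1; rewrite ?oner_neq0 ?scale1r. Qed.

Lemma proj_rel_sym : symmetric proj_rel.
Proof.
move=> z w; apply/asboolP/asboolP => -[l l0 E]; exists l^-1;
  by rewrite ?invr_eq0// E scalerA mulVf// scale1r.
Qed.

Lemma proj_rel_trans : transitive proj_rel.
Proof.
move=> w z x /asboolP[l l0 E] /asboolP[k k0 F]; apply/asboolP.
by exists (k * l); rewrite ?mulf_neq0// F E scalerA.
Qed.

Canonical proj_equiv := EquivRel proj_rel
  proj_rel_refl proj_rel_sym proj_rel_trans.

Definition CP := {eq_quot proj_equiv}.

Definition pclass (z : Cn1) (hz : z != 0) : CP := \pi_CP (exist _ z hz : nzvec).

Definition hcoord (p : CP) : Cn1 := val (repr p).

Definition Bset := {p : Cn1 * Cn1 | (p.1 != 0) && (dot p.2 (conjv p.1) == 0)}.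

Definition B_rel (p q : Bset) : bool :=
  `[< exists2 l : C, l != 0 & val q = (l *: (val p).1, l *: (val p).2) >].

Lemma B_rel_refl : reflexive B_rel.
Proof.
move=> p; apply/asboolP; exists 1; rewrite ?oner_neq0 ?scale1r//.
by case: (val p).
Qed.

Lemma B_rel_sym : symmetric B_rel.
Proof.
move=> p q; apply/asboolP/asboolP => -[l l0 E]; exists l^-1;
  rewrite ?invr_eq0// E /= !scalerA mulVf// !scale1r; by case: (val _).
Qed.

Lemma B_rel_trans : transitive B_rel.
Proof.
move=> q p r /asboolP[l l0 E] /asboolP[k k0 F]; apply/asboolP.
by exists (k * l); rewrite ?mulf_neq0// F E /= !scalerA.
Qed.

Canonical B_equiv := EquivRel B_rel B_rel_refl B_rel_sym B_rel_trans.

Definition TCP := {eq_quot B_equiv}.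

Lemma B_neq0 (p : Bset) : (val p).1 != 0.
Proof. by have /andP[] := valP p. Qed.

Lemma B_dot (p : Bset) : dot (val p).2 (conjv (val p).1) = 0.
Proof. by have /andP[_ /eqP] := valP p. Qed.

Definition trep (v : TCP) : Cn1 * Cn1 := val (repr v).

Definition base (v : TCP) : CP := pclass (B_neq0 (repr v)).

(** ** Charts *)

Lemma insert_neq0 i (a : 'rV[C]_n) : insert i 1 a != 0.
Proof.
apply/eqP => /rowP/(_ i); rewrite !mxE unlift_none => /eqP.
by rewrite oner_eq0.
Qed.

Definition CP_chart (i : 'I_n.+1) : chart CP ECn :=
  Chart [set p | hcoord p 0 i != 0]
        (fun p => realify (affine i (hcoord p)))
        (fun e => pclass (insert_neq0 i (complexify e))).

Definition CP_atlas : set (chart CP ECn) := range CP_chart.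

(* The orthogonal projection of y off z: [z + s y] and [z + s (hproj z y)]
   have the same velocity at s = 0. *)
Definition hproj (z y : Cn1) : Cn1 :=
  y - (dot y (conjv z) / dot z (conjv z)) *: z.

Lemma hprojP i (a b : 'rV[C]_n) (z := insert i 1 a) :
  ((z, hproj z (insert i 0 b)).1 != 0) &&
  (dot (z, hproj z (insert i 0 b)).2 (conjv z) == 0).
Proof.
rewrite insert_neq0 /= /hproj -scaleNr dotDl dotZl mulNr divfK ?subrr ?eqxx//.
by rewrite dot_conjv_eq0 insert_neq0.
Qed.

(* The chart of the tangent bundle induced by [CP_chart i]: the class of
   (z, x) goes to the coordinates of [z] and to their derivative along
   s |-> [z + s x] at s = 0. *)
Definition TCP_chart (i : 'I_n.+1) : chart TCP (ECn * ECn)%type :=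
  Chart [set v | (trep v).1 0 i != 0]
        (fun v => (realify (affine i (trep v).1),
                   realify (taffine i (trep v).1 (trep v).2)))
        (fun e => \pi_TCP (exist _ (_, _)
           (hprojP i (complexify e.1) (complexify e.2)) : Bset)).

Definition TCP_atlas : set (chart TCP (ECn * ECn)%type) := range TCP_chart.

Definition calM : set (CP * CP) :=
  [set p | dot (hcoord p.1) (hcoord p.2) != 0].

Definition calM_chart (ij : 'I_n.+1 * 'I_n.+1) :
    chart (CP * CP) (ECn * ECn)%type :=
  Chart (calM `&` (cdom (CP_chart ij.1) `*` cdom (CP_chart ij.2)))
        (fun p => (coord (CP_chart ij.1) p.1, coord (CP_chart ij.2) p.2))
        (fun e => (cinv (CP_chart ij.1) e.1, cinv (CP_chart ij.2) e.2)).

Definition calM_atlas : set (chart (CP * CP) (ECn * ECn)%type) :=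
  range calM_chart.

(** ** The normal bundle *)

(* Fubini-Study inner product of the classes of (z, x) and (z, y).  When
   |z| = 1, x and y are the horizontal lifts to z in the unit sphere. *)
Definition fubini_study (z x y : Cn1) : R :=
  complex.Re (dot x (conjv y)) / normv z ^+ 2.

(* w is the image, under the differential of iota at x, of a tangent vector
   with coordinates t in some chart. *)
Definition tangent_image (m : nat) (M : smooth_manifold R m) (iota : M -> CP)
    (x : M) (w : TCP) : Prop :=
  base w = iota x /\
  exists (a : chart M 'rV[R]_m) (t : 'rV[R]_m), [/\ atlas a, cdom a x &
    forall i, cdom (CP_chart i) (iota x) ->
      (coord (TCP_chart i) w).2 =
        'd (coord (CP_chart i) \o iota \o cinv a) (coord a x) t].

(* The total space sits in M * TCP because iota need not be injective; its
   manifold structure is that of an embedded submanifold of the product. *)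
Definition normal_bundle (m : nat) (M : smooth_manifold R m)
    (iota : M -> CP) : set (M * TCP) :=
  [set xv | base xv.2 = iota xv.1 /\
    forall w p q, tangent_image iota xv.1 w ->
      xv.2 = \pi_TCP p -> w = \pi_TCP q -> (val p).1 = (val q).1 ->
      fubini_study (val p).1 (val p).2 (val q).2 = 0].

(** ** The map Phi *)

Definition mu (p : Bset) : R := normv (val p).2 / normv (val p).1.

Definition Phi_fst (p : Bset) : Cn1 :=
  (cosh (mu p))%:C *: (val p).1 + ('i * (sinhc (mu p))%:C) *: (val p).2.

Definition Phi_snd (p : Bset) : Cn1 :=
  (cosh (mu p))%:C *: conjv (val p).1
  + ('i * (sinhc (mu p))%:C) *: conjv (val p).2.

Lemma Phi_fst_neq0 p : Phi_fst p != 0.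
Proof.
apply/eqP => /(congr1 (fun z => dot z (conjv (val p).1))).
rewrite /Phi_fst dotDl !dotZl B_dot mulr0 addr0 dot0l.
by move/eqP; rewrite mulf_eq0 (negPf (cosh_neq0 _)) dot_conjv_eq0 (negPf (B_neq0 p)).
Qed.

Lemma Phi_snd_neq0 p : Phi_snd p != 0.
Proof.
apply/eqP => /(congr1 (fun z => dot z (val p).1)).
have B0 : dot (conjv (val p).2) (val p).1 = 0.
  by rewrite -[(val p).1 in LHS]conjvK -conj_dot B_dot conjc0.
rewrite /Phi_snd dotDl !dotZl B0 mulr0 addr0 dot0l.
move/eqP; rewrite mulf_eq0 (negPf (cosh_neq0 _)) dotC dot_conjv_eq0.
by rewrite (negPf (B_neq0 p)).
Qed.

Definition Phi_B (p : Bset) : CP * CP :=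
  (pclass (Phi_fst_neq0 p), pclass (Phi_snd_neq0 p)).

Definition Phi (v : TCP) : CP * CP := Phi_B (repr v).

Lemma Phi_pi (p : Bset) : Phi (\pi_TCP p) = Phi_B p.
Proof.
rewrite /Phi; case: piP => q /eqmodP /asboolP[l l0 E].
have nl0 : Normc.normc l != 0.
  by apply: contra l0 => /eqP /Normc.eq0_normc ->.
have Emu : mu q = mu p.
  by rewrite /mu E /= !normvZ invfM mulrACA divff// mul1r.
congr pair; apply/esym/eqmodP/asboolP.
  exists l => //=; rewrite /Phi_fst Emu E /= scalerDr !scalerA.
  by rewrite ![l * _]mulrC.
exists l^* => /=; first by rewrite conjc_eq0.
rewrite /Phi_snd Emu E /= !conjvZ scalerDr !scalerA.
by rewrite ![l^* * _]mulrC.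
Qed.

(** ** The Stenzel form *)

Definition calN (z w : Cn1) : R :=
  (\sum_j \sum_k Normc.normc (z 0 j * w 0 k) ^+ 2) / Normc.normc (dot z w) ^+ 2.

End Projective.

Section Wirtinger.
Variables (R : realType) (N : nat).
Local Notation C := R[i].

Definition dirderiv (v : 'rV[C]_N) (F : 'rV[C]_N -> C) : 'rV[C]_N -> C :=
  fun u => cderiv (fun s => F (u + s%:C *: v)).

Definition dz (p : 'I_N) (F : 'rV[C]_N -> C) : 'rV[C]_N -> C := fun u =>
  (dirderiv (delta_mx 0 p) F u - 'i * dirderiv ('i *: delta_mx 0 p) F u) / 2.

Definition dzbar (p : 'I_N) (F : 'rV[C]_N -> C) : 'rV[C]_N -> C := fun u =>
  (dirderiv (delta_mx 0 p) F u + 'i * dirderiv ('i *: delta_mx 0 p) F u) / 2.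

(* The value at u on (X, Y) of the 2-form
   i * \sum_(p, q) (d^2 F / dz_p dzbar_q) dz_p /\ dzbar_q. *)
Definition i_ddbar (F : 'rV[C]_N -> C) (u X Y : 'rV[C]_N) : C :=
  'i * \sum_p \sum_q dz p (dzbar q F) u *
    (X 0 p * (Y 0 q)^* - Y 0 p * (X 0 q)^*).

End Wirtinger.

Section Stenzel.
Variables (R : realType) (n : nat).
Local Notation C := R[i].
Local Notation ECn := ('rV[R]_n * 'rV[R]_n)%type.

Definition complexify2 (e : ECn * ECn) : 'rV[C]_(n + n) :=
  row_mx (complexify e.1) (complexify e.2).

(* f(N) in the holomorphic coordinates of [calM_chart ij]. *)
Definition stenzel_potential (f : R -> R) (ij : 'I_n.+1 * 'I_n.+1)
    (u : 'rV[C]_(n + n)) : C :=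
  (f (calN (insert ij.1 1 (lsubmx u)) (insert ij.2 1 (rsubmx u))))%:C.

(* Value at the point with coordinates e on tangent vectors with coordinates
   X and Y, in [calM_chart ij]. *)
Definition Omega (f : R -> R) (ij : 'I_n.+1 * 'I_n.+1) (e X Y : ECn * ECn) : C :=
  i_ddbar (stenzel_potential f ij) (complexify2 e) (complexify2 X)
    (complexify2 Y).

(* An immersion h of U in R^k, 2k = dim calM, into calM with h^* Omega = 0. *)
Definition lagrangian_immersion (f : R -> R) (U : set 'rV[R]_(2 * n))
    (h : 'rV[R]_(2 * n) -> CP R n * CP R n) : Prop :=
  immersion (open_atlas U) (@calM_atlas R n) h /\
  forall u ij, U u -> cdom (calM_chart R ij) (h u) -> forall s t,
    Omega f ij (coord (calM_chart R ij) (h u))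
      ('d (coord (calM_chart R ij) \o h) u s)
      ('d (coord (calM_chart R ij) \o h) u t) = 0.

End Stenzel.

(* Main.v *)
From HB Require Import structures.
From mathcomp Require Import all_boot all_order all_algebra.
From mathcomp Require Import all_classical all_reals all_analysis.
From mathcomp Require Import complex ring.
Require Import Defs.
Set Implicit Arguments.
Unset Strict Implicit.
Unset Printing Implicit Defensive.
Import Order.TTheory GRing.Theory Num.Theory.
Import numFieldNormedType.Exports.
Local Open Scope classical_set_scope.
Local Open Scope quotient_scope.
Local Open Scope complex_scope.
Local Open Scope ring_scope.
(* makes [conjc] win over the generic conjugation of closed fields *)
Local Notation "x ^*" := (conjc x) : ring_scope.

(** Write [F] for the Stenzel potential [f(N)] in affine coordinates
    [(z, w)].  The Stenzel form is the differential of the 1-form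
    [d^c F : X |-> dF(i X)], up to a constant, and the point is that the
    pullback of this 1-form to the normal bundle vanishes already.

    As [f'(N) = N^(-1/2)] and [d log N = eta + conj eta] for the (1,0)-form
    [eta] below, [d^c F] is [-2 sqrt N Im eta].  Let [z = c zeta + i s xi] and
    [w = c conj zeta + i s conj xi] with [c = cosh mu], [s = sinh mu / mu].
    The identity [c^2 |zeta|^2 - s^2 |xi|^2 = |zeta|^2] gives
    [z . w = |zeta|^2] and [|z| = |w|] ([Phi_dot], [Phi_fst_herm],
    [Phi_snd_herm]).  The imaginary part of [eta] is then a multiple of
    [Re (dzeta . conj xi)], the canonical 1-form ([Phi_form],
    [Phi_dlog_real]).  On the normal bundle [dzeta] is tangent to the
    submanifold and [xi] is orthogonal to it, so [d^c F] pulls back to 0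
    ([Phi_dc_zero]).

    That the pullback of the differential vanishes as well is obtained by
    hand: differentiating [dF(i dG(s)) = 0] along [t] and exchanging [s] and
    [t], the second derivatives of the map [G] cancel by their symmetry
    ([derive_comm]), and what remains is the Hessian of [F] in the
    combination that defines [i ddbar F] ([ddbar_dtheta], [ddbar_closed]).

    [Phi] is an immersion because a tangent vector in the kernel satisfies
    [dz = a z] and [dw = b w], and the two identities above force
    [b = conj a], then [a] real, then [a = 0] ([Phi_kernel],
    [Phi_immersive]).  It is smooth across the zero section since [cosh mu]
    and [sinh mu / mu] are entire functions of [mu ^ 2] ([coshS], [sinhS]).

    For the submanifold structure of the normal bundle: in a chart with
    coordinate [y] on the submanifold, being normal is a linear condition
    [b K(y) = 0], where [K(y)] has full rank and depends smoothly on [y].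
    Completing [K(y)] by constant columns [L], Cramer's rule solves
    [b K(y) = 0], [b L = c] smoothly in [(y, c)].  This parametrization has
    the smooth left inverse [(y, b L)], which gives everything else
    ([cramer], [normal_parametrization]).  A parametrization of the normal
    bundle composed with [Phi] is an immersion because [iota] and [Phi] are:
    the tangent vector determines its base point, hence the point of the
    submanifold to first order ([parametrization_local]). *)

(** * Smoothness near a point *)

Section Locality.
Variables (R : realType) (E F : normedModType R).

(** The little-o expansion that characterizes the differential only sees the
    values near [x]. *)
Lemma near_eq_diff (f g : E -> F) x : (\near x, f x = g x) ->
  differentiable f x -> differentiable g x /\ 'd g x = 'd f x :> (E -> F).
Proof.
move=> fg df.
have fgx : f x = g x := nbhs_singleton fg.
have /diff_locallyP [dc /eqaddoP H] := df.
have K : g \o shift x = cst (g x) + 'd f x +o_ 0 id.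
  apply/eqaddoP => e e0; have := H e e0.
  move=> He; near=> h.
  have -> : ((g \o shift x) - (cst (g x) + 'd f x)) h
          = ((f \o shift x) - (cst (f x) + 'd f x)) h.
    rewrite /= !fctE /= -fgx; congr (_ - _); apply/esym.
    near: h; have := fg; rewrite (near_shift 0 x) subr0; exact.
  by near: h.
have E1 : 'd g x = 'd f x :> (E -> F) by apply: diff_unique.
have dgc : continuous ('d g x) by rewrite E1.
by split; [apply/diff_locallyP; split; [exact: dgc|rewrite E1; exact: K]|exact: E1].
Unshelve. all: by end_near. Qed.

Lemma near_eq_differentiable (f g : E -> F) x : (\near x, f x = g x) ->
  differentiable f x -> differentiable g x.
Proof. by move=> fg df; have [] := near_eq_diff fg df. Qed.

Lemma Ck_sub r (A B : set E) (f : E -> F) : A `<=` B -> Ck r B f -> Ck r A f.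
Proof.
move=> AB; elim: r f => [|r IH] f /=; first by move=> H x /AB; apply: H.
by move=> [H1 H2]; split=> [x /AB|v]; [apply: H1|apply: IH].
Qed.

Lemma open_near_set (U : set E) x : open U -> U x -> \forall y \near x, U y.
Proof. by move=> oU Ux; apply: open_nbhs_nbhs. Qed.

Lemma Ck_ext r (U : set E) (f g : E -> F) : open U ->
  (forall x, U x -> f x = g x) -> Ck r U f -> Ck r U g.
Proof.
move=> oU; elim: r f g => [|r IH] f g fg /=.
  move=> H x Ux; have := H x Ux; rewrite /prop_for /continuous_at (fg x Ux) => cf.
  apply: cvg_trans cf; apply: near_eq_cvg.
  by apply: filterS (open_near_set oU Ux) => y /fg.
move=> [H1 H2]; split=> [x Ux|v].
  apply: near_eq_differentiable (H1 x Ux).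
  by apply: filterS (open_near_set oU Ux) => y /fg.
apply: IH (H2 v) => x Ux; apply: near_eq_derive.
by apply: filterS (open_near_set oU Ux) => y /fg.
Qed.

Lemma CkW r (U : set E) (f : E -> F) : Ck r.+1 U f -> Ck r U f.
Proof.
elim: r f => [|r IH] f /= [H1 H2].
  by move=> x Ux; apply: differentiable_continuous; exact: H1.
by split=> // v; apply: IH; exact: H2.
Qed.

(** The germ version of [smooth_on]: rational operations preserve it without
    any tracking of the shrinking domains on which denominators are nonzero. *)
Definition smooth_near x (f : E -> F) :=
  exists V, [/\ open V, V x & smooth_on V f].

Lemma smooth_near_ext x (f g : E -> F) : (\near x, f x = g x) ->
  smooth_near x f -> smooth_near x g.
Proof.
move=> fg [V [oV Vx sf]].
exists (V `&` interior [set y | f y = g y]); split.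
- by apply: openI => //; exact: open_interior.
- by split=> //; exact: fg.
- move=> r; apply: (@Ck_ext _ _ f) => //.
  + by apply: openI => //; exact: open_interior.
  + by move=> y [_ /interior_subset].
  + by apply: Ck_sub (sf r) => y [].
Qed.

Lemma smooth_near_near x (f : E -> F) :
  smooth_near x f -> \forall y \near x, smooth_near y f.
Proof.
move=> [V [oV Vx sf]]; apply: filterS (open_near_set oV Vx) => y Vy.
by exists V.
Qed.

Lemma smooth_near_differentiable x (f : E -> F) :
  smooth_near x f -> differentiable f x.
Proof. by move=> [V [oV Vx /(_ 1%N)]] /= [H _]; exact: H. Qed.

Lemma smooth_near_derive x (f : E -> F) v :
  smooth_near x f -> smooth_near x (fun y => 'D_v f y).
Proof.
by move=> [V [oV Vx sf]]; exists V; split=> // r; have /= [_] := sf r.+1; exact.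
Qed.

Lemma smooth_on_near (U : set E) (f : E -> F) x :
  open U -> U x -> smooth_on U f -> smooth_near x f.
Proof. by exists U. Qed.

Lemma Ck_cst r (U : set E) (c : F) : Ck r U (fun=> c).
Proof.
elim: r c => [|r IH] c /=; first by move=> x _; exact: cst_continuous.
split=> [x _|v]; first exact: differentiable_cst.
have -> : (fun x => 'D_v (fun=> c) x) = (fun=> 0).
  by apply/funext => x; rewrite derive_cst.
exact: IH.
Qed.

Lemma smooth_near_cst x (c : F) : smooth_near x (fun=> c).
Proof. by exists setT; split=> //; [exact: openT|move=> r; exact: Ck_cst]. Qed.

Lemma CkD r (U : set E) (f g : E -> F) : open U -> Ck r U f -> Ck r U g ->
  Ck r U (fun x => f x + g x).
Proof.
move=> oU; elim: r f g => [|r IH] f g.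
  by move=> cf cg x Ux; apply: cvgD; [exact: cf|exact: cg].
move=> /= [f1 f2] [g1 g2]; split=> [x Ux|v].
  by apply: differentiableD; [exact: f1|exact: g1].
apply: Ck_ext (IH _ _ (f2 v) (g2 v)) => // x Ux; apply/esym.
by apply: deriveD; apply: diff_derivable; [exact: f1|exact: g1].
Qed.

Lemma smooth_nearD x (f g : E -> F) : smooth_near x f -> smooth_near x g ->
  smooth_near x (fun y => f y + g y).
Proof.
move=> [V [oV Vx sf]] [W [oW Wx sg]]; exists (V `&` W); split=> //.
- exact: openI.
- move=> r; apply: CkD; first exact: openI.
  + by apply: Ck_sub (sf r) => ? [].
  + by apply: Ck_sub (sg r) => ? [].
Qed.

Lemma smooth_near_sum I (s : seq I) x (f : I -> E -> F) :
  (forall i, smooth_near x (f i)) ->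
  smooth_near x (fun y => \sum_(i <- s) f i y).
Proof.
move=> H; elim: s => [|i s IH].
  apply: smooth_near_ext (smooth_near_cst x 0).
  by near=> y; rewrite big_nil.
apply: smooth_near_ext (smooth_nearD (H i) IH).
by near=> y; rewrite big_cons.
Unshelve. all: by end_near. Qed.

End Locality.

Section RealValued.
Variables (R : realType) (E : normedModType R).
Implicit Types f g : E -> R.

Lemma CkM r (U : set E) f g : open U -> Ck r U f -> Ck r U g ->
  Ck r U (fun x => f x * g x).
Proof.
move=> oU; elim: r f g => [|r IH] f g.
  by move=> cf cg x Ux; apply: cvgM; [exact: cf|exact: cg].
move=> Hf Hg; have /= [f1 f2] := Hf; have /= [g1 g2] := Hg; split=> [x Ux|v].
  by apply: differentiableM; [exact: f1|exact: g1].
apply: (Ck_ext (f := fun x => f x * 'D_v g x + g x * 'D_v f x)) => //.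
  move=> x Ux; apply/esym.
  by apply: deriveM; apply: diff_derivable; [exact: f1|exact: g1].
by apply: CkD => //; apply: IH => //; exact: CkW.
Qed.

Lemma smooth_nearM x f g : smooth_near x f -> smooth_near x g ->
  smooth_near x (fun y => f y * g y).
Proof.
move=> [V [oV Vx sf]] [W [oW Wx sg]]; exists (V `&` W); split=> //.
- exact: openI.
- move=> r; apply: CkM; first exact: openI.
  + by apply: Ck_sub (sf r) => ? [].
  + by apply: Ck_sub (sg r) => ? [].
Qed.

Lemma derive_line (F : normedModType R) (f : E -> F) x v :
  'D_1 (fun s : R => f (s *: v + x)) 0 = 'D_v f x.
Proof.
rewrite /derive /=.
have -> // : (fun h : R => h^-1 *: (f ((h *: 1 + 0) *: v + x) - f (0 *: v + x)))
  = (fun h : R => h^-1 *: (f (h *: v + x) - f x)).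
by apply/funext => h; rewrite addr0 scale0r add0r /GRing.scale/= mulr1.
Qed.

(** Transports rules for functions of one real variable to directional
    derivatives. *)
Lemma is_derive_lineP (F : normedModType R) (f : E -> F) x v df :
  is_derive x v f df <-> is_derive (0 : R) 1 (fun s : R => f (s *: v + x)) df.
Proof.
split=> -[H1 H2]; split.
- by rewrite -derivable1P.
- by rewrite derive_line.
- by rewrite derivable1P.
- by rewrite -derive_line.
Qed.

Lemma is_derive_comp1 (h : R -> R) f x v (dh df : R) :
  is_derive (f x) 1 h dh -> is_derive x v f df ->
  is_derive x v (fun y => h (f y)) (dh * df).
Proof.
move=> Hh /is_derive_lineP Hf; apply/is_derive_lineP.
have Hh' : is_derive (f (0 *: v + x)) 1 h dh by rewrite scale0r add0r.
exact: is_derive1_comp Hh' Hf.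
Qed.

Lemma Ck_comp1 r (U : set E) (V : set R) (h : R -> R) f : open U ->
  (forall x, U x -> V (f x)) -> Ck r V h -> Ck r U f ->
  Ck r U (fun x => h (f x)).
Proof.
move=> oU UV; elim: r h => [|r IH] h.
  move=> ch cf x Ux; apply: (@continuous_comp _ _ _ f h).
    exact: cf.
  by apply: ch; exact: UV.
move=> /= [h1 h2] Hf; have /= [f1 f2] := Hf; split=> [x Ux|v].
  apply: (@differentiable_comp _ _ _ _ f h); first exact: f1.
  by apply: h1; exact: UV.
apply: (Ck_ext (f := fun x => 'D_1 h (f x) * 'D_v f x)) => //.
  move=> x Ux.
  have dh : is_derive (f x) 1 h ('D_1 h (f x)).
    exact/derivableP/diff_derivable/h1/UV.
  have df : is_derive x v f ('D_v f x).
    exact/derivableP/diff_derivable/f1.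
  by have [_ ->] := is_derive_comp1 dh df.
apply: CkM => //.
by apply: (IH (fun y => 'D_1 h y)); [exact: h2|exact: CkW].
Qed.

End RealValued.

(** * Linear maps, components and rational operations *)

Section LinearBasics.
Variables (R : realType) (F G : normedModType R).

Lemma linear_diff (h : F -> G) x : linear h -> continuous h ->
  differentiable h x /\ 'd h x = h :> (F -> G).
Proof.
move=> lh ch.
pose hM := GRing.isLinear.Build _ _ _ _ _ lh.
pose hL : {linear F -> G} := HB.pack h hM.
have -> : h = hL by [].
by split; [exact: linear_differentiable|exact: diff_lin].
Qed.

Lemma linear_at0 (h : F -> G) : linear h -> h 0 = 0.
Proof. by move=> lh; have := lh (-1) 0 0; rewrite scaler0 addr0 scaleN1r addNr. Qed.

Lemma linear_atZ (h : F -> G) : linear h -> forall c x, h (c *: x) = c *: h x.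
Proof. by move=> lh c x; rewrite -[c *: x]addr0 lh linear_at0// addr0. Qed.

Lemma linear_atD (h : F -> G) : linear h -> forall x y, h (x + y) = h x + h y.
Proof. by move=> lh x y; rewrite -[x in LHS]scale1r lh scale1r. Qed.

End LinearBasics.

Section LinearMaps.
Variables (R : realType) (E F G : normedModType R).

Lemma derive_linear_post (h : F -> G) (f : E -> F) x v :
  linear h -> continuous h -> differentiable f x ->
  differentiable (fun y => h (f y)) x /\
  'D_v (fun y => h (f y)) x = h ('D_v f x).
Proof.
move=> lh ch df.
have [dh dhE] := linear_diff (f x) lh ch.
have dhf : differentiable (h \o f) x by apply: differentiable_comp.
split; first exact: dhf.
rewrite -[LHS]/('D_v (h \o f) x) deriveE // diff_comp //= dhE.
by rewrite deriveE.
Qed.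

Lemma Ck_linear_post r (U : set E) (h : F -> G) (f : E -> F) :
  linear h -> continuous h -> open U -> Ck r U f -> Ck r U (fun x => h (f x)).
Proof.
move=> lh ch oU; elim: r f => [|r IH] f.
  move=> cf x Ux; apply: (@continuous_comp _ _ _ f h); first exact: cf.
  exact: ch.
move=> /= [f1 f2]; split=> [x Ux|v].
  by have [] := derive_linear_post 0 lh ch (f1 x Ux).
apply: Ck_ext (IH _ (f2 v)) => // x Ux.
by have [_ ->] := derive_linear_post v lh ch (f1 x Ux).
Qed.

Lemma smooth_near_post x (h : F -> G) (f : E -> F) :
  linear h -> continuous h -> smooth_near x f ->
  smooth_near x (fun y => h (f y)).
Proof.
by move=> lh ch [V [oV Vx sf]]; exists V; split=> // r; apply: Ck_linear_post.
Qed.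

(** The image under [h] of a line in direction [v] is a line in direction
    [h v]. *)
Lemma derive_linear_pre (h : E -> F) (f : F -> G) x v :
  linear h -> 'D_v (fun y => f (h y)) x = 'D_(h v) f (h x).
Proof.
move=> lh; rewrite -derive_line -[RHS]derive_line.
have -> // : (fun s : R => f (h (s *: v + x))) = fun s => f (s *: h v + h x).
by apply/funext => s; rewrite (linear_atD lh) (linear_atZ lh).
Qed.

Lemma Ck_linear_pre r (V : set F) (h : E -> F) (f : F -> G) :
  linear h -> continuous h -> Ck r V f -> Ck r (h @^-1` V) (fun x => f (h x)).
Proof.
move=> lh ch; elim: r f => [|r IH] f.
  move=> cf x Vx; apply: (@continuous_comp _ _ _ h f); first exact: ch.
  exact: cf.
move=> /= [f1 f2]; split=> [x Vx|v].
  apply: (@differentiable_comp _ _ _ _ h f); last exact: f1.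
  by have [] := linear_diff x lh ch.
have -> : (fun x => 'D_v (fun x => f (h x)) x) = fun x => 'D_(h v) f (h x).
  by apply/funext => x; exact: derive_linear_pre.
exact: (IH _ (f2 (h v))).
Qed.

Lemma smooth_near_pre x (h : E -> F) (f : F -> G) :
  linear h -> continuous h -> smooth_near (h x) f ->
  smooth_near x (fun y => f (h y)).
Proof.
move=> lh ch [V [oV Vx sf]]; exists (h @^-1` V); split=> //.
  by apply: open_comp => // y _; exact: ch.
by move=> r; apply: Ck_linear_pre.
Qed.

End LinearMaps.

Section Linear2.
Variables (R : realType) (E F : normedModType R).

Lemma Ck_linear r (U : set E) (h : E -> F) :
  linear h -> continuous h -> Ck r U h.
Proof.
move=> lh ch; case: r => [|r] /=; first by move=> x _; exact: ch.
split=> [x _|v]; first by have [] := linear_diff x lh ch.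
have -> : (fun x => 'D_v h x) = fun=> h v.
  apply/funext => x; have [dh dhE] := linear_diff x lh ch.
  by rewrite deriveE // dhE.
exact: Ck_cst.
Qed.

Lemma smooth_near_linear x (h : E -> F) :
  linear h -> continuous h -> smooth_near x h.
Proof.
by move=> lh ch; exists setT; split=> //; [exact: openT|move=> r; exact: Ck_linear].
Qed.

End Linear2.

Section Components.
Variables (R : realType) (E : normedModType R).

Lemma coord_linear m n i j : linear (fun M : 'M[R]_(m, n) => M i j : R).
Proof. by move=> k x y; rewrite !mxE. Qed.

Lemma coord_cont m n i j : continuous (fun M : 'M[R]_(m, n) => M i j : R).
Proof. exact: coord_continuous. Qed.

Lemma smooth_near_rV n x (f : E -> 'rV[R]_n) :
  smooth_near x f <-> forall k, smooth_near x (fun y => f y 0 k).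
Proof.
split=> [sf k|H].
  by apply: (@smooth_near_post _ _ _ _ x (fun M : 'rV[R]_n => M 0 k)) sf;
    [exact: coord_linear|exact: coord_cont].
have K k : smooth_near x (fun y => f y 0 k *: (delta_mx 0 k : 'rV[R]_n)).
  apply: (@smooth_near_post _ _ _ _ x (fun c : R => c *: (delta_mx 0 k : 'rV[R]_n))) (H k).
  - by move=> c a b; rewrite scalerDl scalerA.
  - exact: scalel_continuous.
apply: smooth_near_ext (smooth_near_sum (index_enum 'I_n) K).
by near=> y; rewrite -row_sum_delta.
Unshelve. all: by end_near. Qed.

Lemma fst_linear (F G : normedModType R) : linear (fst : F * G -> F).
Proof. by move=> k x y. Qed.
Lemma snd_linear (F G : normedModType R) : linear (snd : F * G -> G).
Proof. by move=> k x y. Qed.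
Lemma fst_cont (F G : normedModType R) : continuous (fst : F * G -> F).
Proof. by move=> x; exact: cvg_fst. Qed.
Lemma snd_cont (F G : normedModType R) : continuous (snd : F * G -> G).
Proof. by move=> x; exact: cvg_snd. Qed.

Lemma smooth_near_pair (F G : normedModType R) x (f : E -> F * G) :
  smooth_near x f <->
  smooth_near x (fun y => (f y).1) /\ smooth_near x (fun y => (f y).2).
Proof.
split=> [sf|[H1 H2]].
  split; first by apply: smooth_near_post sf; [exact: fst_linear|exact: fst_cont].
  by apply: smooth_near_post sf; [exact: snd_linear|exact: snd_cont].
have K1 : smooth_near x (fun y => ((f y).1, 0) : F * G).
  apply: (@smooth_near_post _ _ _ _ x (fun a : F => (a, 0) : F * G)) H1.
  - move=> k a b; rewrite -[RHS]/(k *: a + b, k *: (0 : G) + 0).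
    by rewrite scaler0 addr0.
  - by move=> a; apply: cvg_pair => //; exact: cvg_cst.
have K2 : smooth_near x (fun y => (0, (f y).2) : F * G).
  apply: (@smooth_near_post _ _ _ _ x (fun a : G => (0, a) : F * G)) H2.
  - move=> k a b; rewrite -[RHS]/(k *: (0 : F) + 0, k *: a + b).
    by rewrite scaler0 addr0.
  - by move=> a; apply: cvg_pair => //; exact: cvg_cst.
apply: smooth_near_ext (smooth_nearD K1 K2).
near=> y; case: (f y) => a b /=.
rewrite -[LHS]/(a + 0, 0 + b); by rewrite addr0 add0r.
Unshelve. all: by end_near. Qed.

Lemma derive_rV n (f : E -> 'rV[R]_n) x v k : differentiable f x ->
  'D_v (fun y => f y 0 k) x = 'D_v f x 0 k.
Proof.
move=> df.
by have [_ ->] := derive_linear_post v (@coord_linear 1 n 0 k) (@coord_cont 1 n 0 k) df.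
Qed.

Lemma derive_fst (F G : normedModType R) (f : E -> F * G) x v :
  differentiable f x -> 'D_v (fun y => (f y).1) x = ('D_v f x).1.
Proof.
move=> df.
by have [_ ->] := derive_linear_post v (@fst_linear F G) (@fst_cont F G) df.
Qed.

Lemma derive_snd (F G : normedModType R) (f : E -> F * G) x v :
  differentiable f x -> 'D_v (fun y => (f y).2) x = ('D_v f x).2.
Proof.
move=> df.
by have [_ ->] := derive_linear_post v (@snd_linear F G) (@snd_cont F G) df.
Qed.

End Components.

Section RealFunctions.
Variables (R : realType) (E : normedModType R).
Implicit Types f : E -> R.

Lemma open_preimage (X Y : topologicalType) (V : set X) (f : X -> Y) (W : set Y) :
  open V -> (forall y, V y -> {for y, continuous f}) -> open W ->
  open (V `&` f @^-1` W).
Proof.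
move=> oV cf oW; rewrite openE => y [Vy Wy]; apply: filterI.
  exact: open_nbhs_nbhs.
by apply: (cf y Vy); exact: open_nbhs_nbhs.
Qed.

Lemma smooth_near_comp1 x (h : R -> R) f : smooth_near x f ->
  smooth_near (f x) h -> smooth_near x (fun y => h (f y)).
Proof.
move=> [V [oV Vx sf]] [W [oW Wx sh]].
have oVW : open (V `&` f @^-1` W) by apply: open_preimage => //; exact: (sf 0%N).
exists (V `&` f @^-1` W); split=> // r.
apply: (@Ck_comp1 _ _ _ _ W) => //.
- by move=> y [].
- by apply: Ck_sub (sf r) => y [].
Qed.

Lemma Ck_inv r : Ck r [set x : R | x != 0] (fun x => x^-1).
Proof.
have oN : open [set x : R | x != 0].
  by rewrite (_ : [set _ | _] = ~` [set 0]); [apply: closed_openC; exact: closed_eq|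
    apply/seteqP; split=> x /= /eqP].
elim: r => [|r IH] /=; first by move=> x x0; exact: inv_continuous.
split=> [x x0|v]; first exact: differentiable_Rinv.
apply: (Ck_ext (f := fun x : R => (- v) * (x^-1 * x^-1))) => //.
  move=> x x0; rewrite (@deriveV _ _ id) //.
  by rewrite derive_id /GRing.scale/= -expr2 exprVn mulNr mulrC mulNr.
by apply: CkM => //; [exact: Ck_cst|exact: CkM].
Qed.

Lemma smooth_near_inv (x : R) : x != 0 -> smooth_near x (fun x => x^-1).
Proof.
move=> x0; exists [set x : R | x != 0]; split=> // r; exact: Ck_inv.
Qed.

Lemma smooth_nearV x f : smooth_near x f -> f x != 0 ->
  smooth_near x (fun y => (f y)^-1).
Proof. by move=> sf fx; apply: (smooth_near_comp1 (h := fun z => z^-1)) sf _; exact: smooth_near_inv. Qed.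

Lemma smooth_nearN x f : smooth_near x f -> smooth_near x (fun y => - f y).
Proof.
move=> sf; have -> : (fun y => - f y) = fun y => -1 * f y.
  by apply/funext => y; rewrite mulN1r.
by apply: smooth_nearM => //; exact: smooth_near_cst.
Qed.

Lemma smooth_near_prod I (s : seq I) x (f : I -> E -> R) :
  (forall i, smooth_near x (f i)) ->
  smooth_near x (fun y => \prod_(i <- s) f i y).
Proof.
move=> H; elim: s => [|i s IH].
  by under eq_fun do rewrite big_nil; exact: smooth_near_cst.
by under eq_fun do rewrite big_cons; exact: smooth_nearM.
Qed.

Lemma smooth_near_det n x (A : E -> 'M[R]_n) :
  (forall i j, smooth_near x (fun y => A y i j)) ->
  smooth_near x (fun y => \det (A y)).
Proof.
move=> H; rewrite /determinant; apply: smooth_near_sum => s.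
apply: smooth_nearM; first exact: smooth_near_cst.
exact: smooth_near_prod.
Qed.

Lemma smooth_near_adj n x (A : E -> 'M[R]_n) i j :
  (forall i j, smooth_near x (fun y => A y i j)) ->
  smooth_near x (fun y => \adj (A y) i j).
Proof.
move=> H; under eq_fun do rewrite mxE /cofactor.
apply: smooth_nearM; first exact: smooth_near_cst.
apply: smooth_near_det => k l.
by under eq_fun do rewrite !mxE; exact: H.
Qed.

Lemma smooth_near_continuous (F : normedModType R) x (f : E -> F) : smooth_near x f ->
  {for x, continuous f}.
Proof. by move=> /smooth_near_differentiable /differentiable_continuous. Qed.

End RealFunctions.

(** * Chain rule and symmetry of second derivatives *)

Section Chain.
Variables (R : realType) (E F G : normedModType R).

Lemma derive_chain (g : E -> F) (f : F -> G) x v :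
  differentiable g x -> differentiable f (g x) ->
  differentiable (fun y => f (g y)) x /\
  'D_v (fun y => f (g y)) x = 'D_('D_v g x) f (g x).
Proof.
move=> dg df.
have dfg : differentiable (f \o g) x by apply: differentiable_comp.
split; first exact: dfg.
rewrite -[LHS]/('D_v (f \o g) x) deriveE // diff_comp //=.
by rewrite !deriveE.
Qed.

End Chain.

Section Schwarz.
Variables (R : realType) (E : normedModType R).
Implicit Types f : E -> R.

Lemma derive_along_line f (u y : E) (s : R) : differentiable f (s *: u + y) ->
  is_derive s 1 (fun t : R => f (t *: u + y)) ('D_u f (s *: u + y)).
Proof.
move=> df.
have ll : linear (fun t : R => t *: u) by move=> k a b; rewrite scalerDl scalerA.
have lc : continuous (fun t : R => t *: u) by exact: scalel_continuous.
have [dl dlE] := linear_diff s ll lc.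
have dL : differentiable (fun t : R => t *: u + y) s.
  by apply: differentiableD => //; exact: differentiable_cst.
have DL : 'D_1 (fun t : R => t *: u + y) s = u.
  rewrite deriveD; [|exact: diff_derivable|exact: derivable_cst].
  by rewrite derive_cst addr0 deriveE // dlE scale1r.
have [d1 d2] := derive_chain (1 : R) dL df.
split; first exact: diff_derivable.
by rewrite d2 DL.
Qed.

(** Two applications of the mean value theorem, first along [u] and then
    along [v]. *)
Lemma second_difference f (V : set E) (x u v : E) (h : R) : 0 < h ->
  (forall s t, 0 <= s <= h -> 0 <= t <= h -> V (s *: u + (t *: v + x))) ->
  Ck 2 V f -> exists s t, [/\ 0 <= s <= h, 0 <= t <= h &
    f (h *: u + (h *: v + x)) - f (h *: u + x) - (f (h *: v + x) - f x) =
    h * h * 'D_v (fun y => 'D_u f y) (s *: u + (t *: v + x))].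
Proof.
move=> h0 HV /= [f1 f2].
have hh : 0 <= h <= h by rewrite lexx ltW.
have h00 : 0 <= (0:R) <= h by rewrite lexx ltW.
have V0 s : 0 <= s <= h -> V (s *: u + x).
  by move=> hs; have := HV s 0 hs h00; rewrite scale0r add0r.
pose phi (s : R) := f (s *: u + (h *: v + x)) - f (s *: u + x).
pose dphi (s : R) := 'D_u f (s *: u + (h *: v + x)) - 'D_u f (s *: u + x).
have dp s : 0 <= s <= h -> is_derive s 1 phi (dphi s).
  move=> hs; apply: is_deriveB; apply: derive_along_line; apply: f1.
    exact: HV.
  exact: V0.
have [||s hs Es] := @MVT_segment _ phi dphi 0 h (ltW h0).
- by move=> s; rewrite in_itv/= => /andP[/ltW a /ltW b]; apply: dp; rewrite a b.
- apply: derivable_within_continuous => s; rewrite in_itv/= => hs.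
  by have [] := dp s hs.
rewrite in_itv/= in hs.
have [d1 _] := f2 u.
pose psi (t : R) := 'D_u f (s *: u + (t *: v + x)).
pose dpsi (t : R) := 'D_v (fun y => 'D_u f y) (s *: u + (t *: v + x)).
have dq t : 0 <= t <= h -> is_derive t 1 psi (dpsi t).
  move=> ht; rewrite /psi /dpsi.
  have -> : (fun t => 'D_u f (s *: u + (t *: v + x))) =
            (fun t => 'D_u f (t *: v + (s *: u + x))).
    by apply/funext => t'; rewrite addrCA.
  rewrite addrCA; apply: (@derive_along_line (fun y => 'D_u f y)); apply: d1.
  by rewrite addrCA; exact: HV.
have [||t ht Et] := @MVT_segment _ psi dpsi 0 h (ltW h0).
- by move=> t; rewrite in_itv/= => /andP[/ltW a /ltW b]; apply: dq; rewrite a b.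
- apply: derivable_within_continuous => t; rewrite in_itv/= => ht.
  by have [] := dq t ht.
rewrite in_itv/= in ht.
exists s, t; split=> //.
move: Es Et; rewrite /phi /dphi /psi /dpsi subr0 !scale0r !add0r => -> ->.
by rewrite mulrC mulrA mulrAC.
Qed.

(** The second difference of [f] over a parallelogram is symmetric in its two
    sides; divided by [h * h], it tends to either mixed derivative as the
    parallelogram shrinks to [x]. *)
Lemma derive_comm f x u v : smooth_near x f ->
  'D_u (fun y => 'D_v f y) x = 'D_v (fun y => 'D_u f y) x.
Proof.
move=> [V [oV Vx sf]].
apply/eqP; rewrite -subr_eq0 -normr_le0; apply/ler_addgt0Pr => e e0; rewrite add0r.
have cuv : {for x, continuous (fun y => 'D_u (fun y => 'D_v f y) y)}.
  by have /= [_ H] := sf 2%N; have /= [_ {}H] := H v; exact: H.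
have cvu : {for x, continuous (fun y => 'D_v (fun y => 'D_u f y) y)}.
  by have /= [_ H] := sf 2%N; have /= [_ {}H] := H u; exact: H.
have e2 : 0 < e / 2 by rewrite divr_gt0.
have near3 (g1 g2 : E -> R) : {for x, continuous g1} -> {for x, continuous g2} ->
    \forall y \near x, [/\ V y, `|g1 x - g1 y| < e / 2 & `|g2 x - g2 y| < e / 2].
  move=> /cvgrPdist_lt c1 /cvgrPdist_lt c2.
  have H1 := c1 _ e2; have H2 := c2 _ e2; have H3 := open_near_set oV Vx.
  near=> y; split; near: y; [exact: H3|exact: H1|exact: H2].
have := near3 _ _ cuv cvu.
move=> /nbhs_ballP [r /= r0 Br].
(* the parallelograms with sides h u and h v at x lie in the ball of radius r *)
pose K := `|u| + `|v| + 1.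
have K0 : 0 < K by rewrite /K ltr_wpDl// addr_ge0.
pose h := r / 2 / K.
have h0 : 0 < h by rewrite !divr_gt0.
have inB s t : 0 <= s <= h -> 0 <= t <= h -> ball x r (s *: u + (t *: v + x)).
  move=> /andP[s0 sh] /andP[t0 th].
  rewrite -ball_normE /= distrC addrA addrK.
  apply: (le_lt_trans (ler_normD _ _)).
  rewrite !normrZ (ger0_norm s0) (ger0_norm t0).
  apply: (@le_lt_trans _ _ (h * K)).
    rewrite /K !mulrDr mulr1 -[leLHS]addr0 !lerD// ?ler_wpM2r//.
    exact: ltW.
  by rewrite /h divfK ?gt_eqF// gtr_pMr// invf_lt1// ltr1n.
have [s [t [hs ht E1]]] := second_difference h0
  (fun s t hs ht => let: And3 a _ _ := Br _ (inB s t hs ht) in a) (sf 2%N).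
have inB' s' t' : 0 <= s' <= h -> 0 <= t' <= h -> ball x r (s' *: v + (t' *: u + x)).
  by move=> h1 h2; rewrite addrCA; exact: inB.
have [s' [t' [hs' ht' E2]]] := second_difference h0
  (fun s t hs ht => let: And3 a _ _ := Br _ (inB' s t hs ht) in a) (sf 2%N).
have E3 : 'D_v (fun y => 'D_u f y) (s *: u + (t *: v + x)) =
          'D_u (fun y => 'D_v f y) (s' *: v + (t' *: u + x)).
  have hh : h * h != 0 by rewrite mulf_neq0 ?gt_eqF.
  have E12 : f (h *: u + (h *: v + x)) - f (h *: u + x) - (f (h *: v + x) - f x) =
      f (h *: v + (h *: u + x)) - f (h *: v + x) - (f (h *: u + x) - f x).
    by rewrite addrCA !opprB addrACA [- _ + _]addrC addrACA.
  exact: mulfI hh _ _ (etrans (esym E1) (etrans E12 E2)).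
have [_ _ B1] := Br _ (inB _ _ hs ht).
have [_ B2 _] := Br _ (inB' _ _ hs' ht').
rewrite E3 in B1.
rewrite [leRHS]splitr.
apply: ltW; apply: le_lt_trans (ltrD B2 B1).
rewrite [X in _ <= _ + X]distrC.
apply: le_trans (ler_normD _ _).
by rewrite addrA subrK.
Unshelve. all: by end_near. Qed.

End Schwarz.

(** * Complex-valued functions *)

Section ComplexCalculus.
Variables (R : realType) (E : normedModType R).
Local Notation C := R[i].
Local Notation Re := (@complex.Re R).
Local Notation Im := (@complex.Im R).
Implicit Types (f : E -> R) (F G : E -> C) (x v : E).

Lemma complex_eta (z : C) : z = Re z +i* Im z. Proof. by case: z. Qed.
Lemma ReD (z w : C) : Re (z + w) = Re z + Re w. Proof. by case: z; case: w. Qed.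
Lemma ImD (z w : C) : Im (z + w) = Im z + Im w. Proof. by case: z; case: w. Qed.
Lemma ReM (z w : C) : Re (z * w) = Re z * Re w - Im z * Im w.
Proof. by case: z; case: w. Qed.
Lemma ImM (z w : C) : Im (z * w) = Re z * Im w + Im z * Re w.
Proof. by case: z; case: w. Qed.
Lemma ReN (z : C) : Re (- z) = - Re z. Proof. by case: z. Qed.
Lemma ImN (z : C) : Im (- z) = - Im z. Proof. by case: z. Qed.
Lemma Re_conj (z : C) : Re z^* = Re z. Proof. by case: z. Qed.
Lemma Im_conj (z : C) : Im z^* = - Im z. Proof. by case: z. Qed.
Lemma ReV (z : C) : Re z^-1 = Re z / (Re z * Re z + Im z * Im z).
Proof. by case: z => a b; rewrite -!expr2. Qed.
Lemma ImV (z : C) : Im z^-1 = - (Im z / (Re z * Re z + Im z * Im z)).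
Proof. by case: z => a b; rewrite -!expr2. Qed.

Lemma sqr_norm_neq0 (z : C) : z != 0 -> Re z * Re z + Im z * Im z != 0.
Proof.
case: z => a b /=; rewrite -!expr2 paddr_eq0 ?sqr_ge0// !sqrf_eq0.
by apply: contra => /andP[/eqP -> /eqP ->].
Qed.

Definition csmooth x F := smooth_near x (fun y => Re (F y)) /\
                          smooth_near x (fun y => Im (F y)).

Lemma csmooth_cst x (c : C) : csmooth x (fun=> c).
Proof. by split; exact: smooth_near_cst. Qed.

Lemma csmooth_real x f : smooth_near x f -> csmooth x (fun y => (f y)%:C).
Proof. by move=> sf; split => //=; exact: smooth_near_cst. Qed.

Lemma csmoothD x F G : csmooth x F -> csmooth x G ->
  csmooth x (fun y => F y + G y).
Proof.
move=> [F1 F2] [G1 G2]; split.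
  by under eq_fun do rewrite ReD; exact: smooth_nearD.
by under eq_fun do rewrite ImD; exact: smooth_nearD.
Qed.

Lemma csmoothN x F : csmooth x F -> csmooth x (fun y => - F y).
Proof.
move=> [F1 F2]; split.
  by under eq_fun do rewrite ReN; exact: smooth_nearN.
by under eq_fun do rewrite ImN; exact: smooth_nearN.
Qed.

Lemma csmoothM x F G : csmooth x F -> csmooth x G ->
  csmooth x (fun y => F y * G y).
Proof.
move=> [F1 F2] [G1 G2]; split.
  under eq_fun do rewrite ReM; apply: smooth_nearD; first exact: smooth_nearM.
  by apply: smooth_nearN; exact: smooth_nearM.
under eq_fun do rewrite ImM; apply: smooth_nearD; exact: smooth_nearM.
Qed.

Lemma csmooth_conj x F : csmooth x F -> csmooth x (fun y => (F y)^*).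
Proof.
move=> [F1 F2]; split.
  by under eq_fun do rewrite Re_conj.
by under eq_fun do rewrite Im_conj; exact: smooth_nearN.
Qed.

Lemma csmoothV x F : csmooth x F -> F x != 0 -> csmooth x (fun y => (F y)^-1).
Proof.
move=> [F1 F2] Fx.
have S : smooth_near x
    (fun y => (Re (F y) * Re (F y) + Im (F y) * Im (F y))^-1).
  apply: smooth_nearV; last exact: sqr_norm_neq0.
  by apply: smooth_nearD; exact: smooth_nearM.
split.
  by under eq_fun do rewrite ReV; exact: smooth_nearM.
by under eq_fun do rewrite ImV; apply: smooth_nearN; exact: smooth_nearM.
Qed.

Lemma csmooth_sum I (s : seq I) x (F : I -> E -> C) :
  (forall i, csmooth x (F i)) -> csmooth x (fun y => \sum_(i <- s) F i y).
Proof.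
move=> H; elim: s => [|i s IH].
  by under eq_fun do rewrite big_nil; exact: csmooth_cst.
by under eq_fun do rewrite big_cons; exact: csmoothD.
Qed.

Lemma csmooth_dot n x (z w : E -> 'rV[C]_n) :
  (forall k, csmooth x (fun y => z y 0 k)) ->
  (forall k, csmooth x (fun y => w y 0 k)) ->
  csmooth x (fun y => dot (z y) (w y)).
Proof. by move=> hz hw; apply: csmooth_sum => k; apply: csmoothM. Qed.

Lemma csmooth_neq0 x F : csmooth x F -> F x != 0 -> \forall y \near x, F y != 0.
Proof.
move=> [F1 F2] /sqr_norm_neq0 n0.
have cN : {for x, continuous
    (fun y => Re (F y) * Re (F y) + Im (F y) * Im (F y))}.
  apply: smooth_near_continuous.
  by apply: smooth_nearD; exact: smooth_nearM.
have oN : open [set t : R | t != 0] by [].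
have H : \forall y \near x, Re (F y) * Re (F y) + Im (F y) * Im (F y) != 0.
  exact: cN [set t : R | t != 0] (open_nbhs_nbhs (conj oN n0)).
apply: filterS H => y; apply: contra => /eqP ->.
by rewrite /= !mul0r addr0.
Qed.

(** A relation instead of an operator, so that derivatives of products and
    quotients are found by composing proofs. *)
Definition is_cderive x v F (l : C) := is_derive x v (fun y => Re (F y)) (Re l) /\
                                is_derive x v (fun y => Im (F y)) (Im l).

Definition cderive v F x : C :=
  'D_v (fun y => Re (F y)) x +i* 'D_v (fun y => Im (F y)) x.

Lemma is_cderive_val x v F l : is_cderive x v F l -> cderive v F x = l.
Proof. by move=> [[_ H1] [_ H2]]; rewrite /cderive H1 H2 -complex_eta. Qed.

Lemma csmooth_is_cderive x v F : csmooth x F -> is_cderive x v F (cderive v F x).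
Proof.
move=> [/smooth_near_differentiable/diff_derivable H1
        /smooth_near_differentiable/diff_derivable H2].
by split; apply: DeriveDef.
Qed.

Lemma is_cderive_uniq x v F l l' : is_cderive x v F l -> is_cderive x v F l' -> l = l'.
Proof. by move=> /is_cderive_val <- /is_cderive_val <-. Qed.

Lemma is_cderive_ext x v F G l : (\near x, F x = G x) -> is_cderive x v F l -> is_cderive x v G l.
Proof.
move=> FG [H1 H2]; split; [move: H1|move: H2]; apply: near_eq_is_derive;
  by apply: filterS FG => y ->.
Qed.

Lemma is_cderive_cst x v (c : C) : is_cderive x v (fun=> c) 0.
Proof. by split; exact: is_derive_cst. Qed.

Lemma is_cderive_real x v f df : is_derive x v f df ->
  is_cderive x v (fun y => (f y)%:C) df%:C.
Proof. by move=> H; split => //=; exact: is_derive_cst. Qed.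

Lemma is_cderiveD x v F G l k : is_cderive x v F l -> is_cderive x v G k ->
  is_cderive x v (fun y => F y + G y) (l + k).
Proof.
move=> [F1 F2] [G1 G2]; split.
  by under eq_fun do rewrite ReD; rewrite ReD; exact: is_deriveD.
by under eq_fun do rewrite ImD; rewrite ImD; exact: is_deriveD.
Qed.

Lemma is_cderiveN x v F l : is_cderive x v F l -> is_cderive x v (fun y => - F y) (- l).
Proof.
move=> [F1 F2]; split.
  by under eq_fun do rewrite ReN; rewrite ReN; exact: is_deriveN.
by under eq_fun do rewrite ImN; rewrite ImN; exact: is_deriveN.
Qed.

Lemma is_derive_mul x v f g df dg : is_derive x v f df -> is_derive x v g dg ->
  is_derive x v (fun y => f y * g y : R) (f x * dg + g x * df).
Proof. by move=> H1 H2; exact: is_deriveM. Qed.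

Lemma is_cderiveM x v F G l k : is_cderive x v F l -> is_cderive x v G k ->
  is_cderive x v (fun y => F y * G y) (F x * k + l * G x).
Proof.
move=> [F1 F2] [G1 G2]; split.
  under eq_fun do rewrite ReM.
  have := is_deriveB (is_derive_mul F1 G1) (is_derive_mul F2 G2).
  move=> H; apply: is_derive_eq H _.
  rewrite ReD !ReM; ring.
under eq_fun do rewrite ImM.
have := is_deriveD (is_derive_mul F1 G2) (is_derive_mul F2 G1).
move=> H; apply: is_derive_eq H _.
rewrite ImD !ImM; ring.
Qed.

Lemma is_cderive_conj x v F l : is_cderive x v F l -> is_cderive x v (fun y => (F y)^*) l^*.
Proof.
move=> [F1 F2]; split.
  by under eq_fun do rewrite Re_conj; rewrite Re_conj.
by under eq_fun do rewrite Im_conj; rewrite Im_conj; exact: is_deriveN.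
Qed.

Lemma is_derive_inv x v f df : f x != 0 -> is_derive x v f df ->
  is_derive x v (fun y => (f y)^-1) (- (f x)^-1 ^+ 2 * df).
Proof.
move=> fx [d1 d2]; split; first exact: derivableV.
by rewrite deriveV // d2 exprVn.
Qed.

Lemma is_cderiveV x v F l : F x != 0 -> is_cderive x v F l ->
  is_cderive x v (fun y => (F y)^-1) (- l * (F x)^-1 ^+ 2).
Proof.
move=> Fx [F1 F2].
have n0 := sqr_norm_neq0 Fx.
have S : is_derive x v
    (fun y => (Re (F y) * Re (F y) + Im (F y) * Im (F y))^-1)
    (- (Re (F x) * Re (F x) + Im (F x) * Im (F x))^-1 ^+ 2 *
     (Re (F x) * Re l + Re (F x) * Re l + (Im (F x) * Im l + Im (F x) * Im l))).
  apply: is_derive_inv => //.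
  exact: is_deriveD (is_derive_mul F1 F1) (is_derive_mul F2 F2).
split.
  under eq_fun do rewrite ReV.
  apply: is_derive_eq (is_derive_mul F1 S) _.
  rewrite expr2 !ReM !ImM !ReV !ImV ReN ImN.
  by field.
under eq_fun do rewrite ImV.
apply: is_derive_eq (is_deriveN (is_derive_mul F2 S)) _.
rewrite expr2 !ImM !ReM !ReV !ImV ReN ImN.
by field.
Qed.

Lemma is_cderive_sum I (s : seq I) x v (F : I -> E -> C) (l : I -> C) :
  (forall i, is_cderive x v (F i) (l i)) ->
  is_cderive x v (fun y => \sum_(i <- s) F i y) (\sum_(i <- s) l i).
Proof.
move=> H; elim: s => [|i s IH].
  by under eq_fun do rewrite big_nil; rewrite big_nil; exact: is_cderive_cst.
by under eq_fun do rewrite big_cons; rewrite big_cons; exact: is_cderiveD.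
Qed.

Definition is_vderive n x v (Z : E -> 'rV[C]_n) (L : 'rV[C]_n) :=
  forall k, is_cderive x v (fun y => Z y 0 k) (L 0 k).

Lemma is_vderive_uniq n x v (Z : E -> 'rV[C]_n) L L' :
  is_vderive x v Z L -> is_vderive x v Z L' -> L = L'.
Proof. by move=> H1 H2; apply/rowP => k; exact: is_cderive_uniq (H1 k) (H2 k). Qed.

Lemma is_vderive_ext n x v (Z W : E -> 'rV[C]_n) L : (\near x, Z x = W x) ->
  is_vderive x v Z L -> is_vderive x v W L.
Proof.
by move=> ZW H k; apply: is_cderive_ext (H k); apply: filterS ZW => y ->.
Qed.

Lemma is_vderive_dot n x v (Z W : E -> 'rV[C]_n) L K : is_vderive x v Z L -> is_vderive x v W K ->
  is_cderive x v (fun y => dot (Z y) (W y)) (dot (Z x) K + dot L (W x)).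
Proof.
move=> HZ HW; rewrite /dot -big_split /=.
apply: (@is_cderive_sum _ _ x v (fun k y => Z y 0 k * W y 0 k)
   (fun k => Z x 0 k * K 0 k + L 0 k * W x 0 k)) => k.
exact: is_cderiveM.
Qed.

Lemma is_vderive_conj n x v (Z : E -> 'rV[C]_n) L : is_vderive x v Z L ->
  is_vderive x v (fun y => conjv (Z y)) (conjv L).
Proof.
by move=> H k; under eq_fun do rewrite mxE; rewrite mxE; exact: is_cderive_conj.
Qed.

Lemma is_vderiveD n x v (Z W : E -> 'rV[C]_n) L K : is_vderive x v Z L -> is_vderive x v W K ->
  is_vderive x v (fun y => Z y + W y) (L + K).
Proof.
by move=> HZ HW k; under eq_fun do rewrite mxE; rewrite mxE; exact: is_cderiveD.
Qed.

Lemma is_vderiveZ n x v (a : E -> C) (Z : E -> 'rV[C]_n) l L :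
  is_cderive x v a l -> is_vderive x v Z L ->
  is_vderive x v (fun y => a y *: Z y) (a x *: L + l *: Z x).
Proof.
by move=> Ha HZ k; under eq_fun do rewrite mxE; rewrite !mxE; exact: is_cderiveM.
Qed.

End ComplexCalculus.

(** * The hyperbolic functions of a square root *)

Section Entire.
Variable R : realType.
Implicit Types (c : nat -> R) (x : R).

(** This bound, unlike convergence on the whole line, passes visibly to the
    series differentiated term by term. *)
Definition entire c := exists A B, [/\ 0 <= A, 0 <= B &
  forall k, `|c k| <= A * (B ^+ k / k`!%:R)].

Lemma entire_diffs c : entire c -> entire (pseries_diffs c).
Proof.
move=> [A [B [A0 B0 H]]]; exists (A * B), B; split=> //; first exact: mulr_ge0.
move=> k; rewrite /pseries_diffs normrM ger0_norm//.
apply: (@le_trans _ _ (k.+1%:R * (A * (B ^+ k.+1 / k.+1`!%:R)))).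
  by rewrite ler_wpM2l.
rewrite factS natrM exprS.
have f0 : k`!%:R != 0 :> R by rewrite pnatr_eq0 -lt0n fact_gt0.
have k0 : k.+1%:R != 0 :> R by rewrite pnatr_eq0.
have aux (k1 f Bk : R) : k1 != 0 -> f != 0 ->
    k1 * (A * (B * Bk / (k1 * f))) = A * B * (Bk / f).
  by move=> h1 h2; field; rewrite h1 h2.
by rewrite aux.
Qed.

Lemma entire_cvg c x : entire c -> cvgn (pseries c x).
Proof.
move=> [A [B [A0 B0 H]]]; apply: normed_cvg.
apply: (@series_le_cvg _ _ (A *: (exp_coeff (B * `|x|)))).
- by move=> n; rewrite normr_ge0.
- move=> n; rewrite /= !fctE /GRing.scale/= mulr_ge0// exp_coeff_ge0// mulr_ge0//.
- move=> n; rewrite /= !fctE /GRing.scale/= /exp_coeff/= normrM normrX exprMn.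
  rewrite mulrAC mulrA; apply: ler_wpM2r; first exact: exprn_ge0.
  exact: H.
- by apply: is_cvg_seriesZ; exact: is_cvg_series_exp_coeff.
Qed.

Definition entire_sum c x := limn (pseries c x).

Lemma entire_sum_derive c x : entire c ->
  is_derive x 1 (entire_sum c) (entire_sum (pseries_diffs c) x).
Proof.
move=> ec; apply: (@pseries_snd_diffs _ c (`|x| + 1)).
- exact: entire_cvg.
- by apply: entire_cvg; exact: entire_diffs.
- by apply: entire_cvg; do 2 apply: entire_diffs.
- by rewrite [ltRHS]ger0_norm ?ltrDl// addr_ge0.
Qed.

Lemma entire_sum_differentiable c x : entire c -> differentiable (entire_sum c) x.
Proof. by move=> /(@entire_sum_derive _ x) [H _]; apply/derivable1_diffP. Qed.

Lemma Ck_entire_sum r c (U : set R) : open U -> entire c -> Ck r U (entire_sum c).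
Proof.
move=> oU; elim: r c => [|r IH] c ec.
  by move=> x _; apply: differentiable_continuous; exact: entire_sum_differentiable.
split=> [x _|v]; first exact: entire_sum_differentiable.
apply: (Ck_ext (f := fun x : R => v * entire_sum (pseries_diffs c) x)) => //.
  move=> x _; have [_ E1] := entire_sum_derive x ec.
  rewrite -E1 !deriveE; try exact: entire_sum_differentiable.
  by rewrite -[X in _ = 'd _ _ X]mulr1 -[X in _ = 'd _ _ X]/(v *: (1 : R)) linearZ.
by apply: CkM => //; [exact: Ck_cst|apply: IH; exact: entire_diffs].
Qed.

Lemma smooth_near_entire_sum c x : entire c -> smooth_near x (entire_sum c).
Proof.
by move=> ec; exists setT; split=> //; [exact: openT|move=> r; apply: Ck_entire_sum => //; exact: openT].
Qed.

Definition cosh_coeff (k : nat) : R := ((k.*2)`!%:R)^-1.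

Lemma entire_cosh : entire cosh_coeff.
Proof.
exists 1, 1; split=> // k; rewrite expr1n !mul1r /cosh_coeff ger0_norm//.
rewrite lef_pV2 ?posrE ?ltr0n ?fact_gt0// ler_nat.
by apply: leq_fact; rewrite -addnn leq_addr.
Qed.

(** [coshS (x ^+ 2) = cosh x] and [sinhS (x ^+ 2) = sinhc x]; differentiating
    the first identity explains why [sinhS] is twice the derivative of
    [coshS]. *)
Definition coshS : R -> R := entire_sum cosh_coeff.
Definition sinhS : R -> R := fun t => 2 * entire_sum (pseries_diffs cosh_coeff) t.

Lemma coshS_derive (t : R) : is_derive t 1 coshS (sinhS t / 2).
Proof.
apply: is_derive_eq (entire_sum_derive t entire_cosh) _.
by rewrite /sinhS; field.
Qed.

Lemma coshS_smooth (t : R) : smooth_near t coshS.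
Proof. exact: smooth_near_entire_sum entire_cosh. Qed.

Lemma sinhS_smooth (t : R) : smooth_near t sinhS.
Proof.
apply: smooth_nearM; first exact: smooth_near_cst.
by apply: smooth_near_entire_sum; exact: entire_diffs entire_cosh.
Qed.

(** The odd terms of the exponential series of [x] and of [- x] cancel, so
    half of the sum of their partial sums of even length is a partial sum of
    [coshS] at [x ^+ 2]. *)
Lemma coshS_sqr x : coshS (x ^+ 2) = cosh x.
Proof.
pose u := fun n => (series (exp_coeff x) n + series (exp_coeff (- x)) n) / 2.
have cu : u @ \oo --> cosh x.
  apply: cvgMr_tmp; apply: cvgD; exact: is_cvg_series_exp_coeff.
have uE n : u n.*2 = pseries cosh_coeff (x ^+ 2) n.
  rewrite /u /pseries /series /=; elim: n => [|n IH].
    by rewrite !big_geq// addr0 mul0r.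
  rewrite doubleS !big_nat_recr//= -IH /cosh_coeff /exp_coeff /=.
  rewrite !(exprNn x) -!(signr_odd _ n.*2) -(signr_odd _ n.*2.+1) /= odd_double /=.
  rewrite expr0 expr1 -exprM mul2n mul1r mulN1r mulNr.
  rewrite [X in _ = _ + X]mulrC.
  move: (x ^+ n.*2 / _) (x ^+ n.*2.+1 / _) => a b.
  move: (\sum_(0 <= i < n.*2) _) => s1.
  by move: (\sum_(0 <= i < n.*2) _) => s2; field.
have cd : (fun n => u n.*2) @ \oo --> cosh x.
  apply: (@cvg_comp _ _ _ double u \oo \oo) => //.
  by apply/cvgnyPge => A; exists A => // n /= An; rewrite -addnn (leq_trans An) ?leq_addr.
rewrite /coshS /entire_sum; apply: cvg_lim => //.
by rewrite (_ : pseries _ _ = fun n => u n.*2)//; apply/funext => n; rewrite uE.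
Qed.

Lemma is_derive_cosh x : is_derive x 1 (@cosh R) (sinh x).
Proof.
have H1 : is_derive x 1 (fun y : R => expR (- y)) (- expR (- x)).
  rewrite -mulrN1; apply: is_derive_comp1; exact: is_derive_expR.
have H2 : is_derive x 1 (fun y : R => expR y + expR (- y)) (expR x - expR (- x)).
  by apply: is_deriveD.
have := is_derive_mul H2 (is_derive_cst (2^-1 : R) x 1).
by move=> H; apply: is_derive_eq H _; rewrite mulr0 add0r mulrC.
Qed.

(** Away from 0, differentiate [coshS (y ^+ 2) = cosh y]; at 0, only the
    constant term is left. *)
Lemma sinhS_sqr x : sinhS (x ^+ 2) = sinhc x.
Proof.
rewrite /sinhc; have [->|x0] := eqVneq x 0.
  rewrite expr0n /= /sinhS /entire_sum.
  rewrite (_ : limn _ = (2^-1 : R)) ?mulfV ?pnatr_eq0//; apply: cvg_lim => //.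
  apply: cvg_near_cst; exists 1%N => // -[//|n] _ /=.
  rewrite /pseries /series /= big_nat_recl//= big1 ?addr0.
    by rewrite /pseries_diffs /cosh_coeff expr0 mulr1 mul1r.
  by move=> i _; rewrite exprS mul0r mulr0.
have D1 : is_derive x 1 (fun y : R => coshS (y ^+ 2)) (sinhS (x ^+ 2) / 2 * (x + x)).
  apply: (@is_derive_comp1 _ _ _ (fun y : R => y ^+ 2) _ _ _ _ (coshS_derive _)).
  have H := is_derive_mul (is_derive_id x 1) (is_derive_id x 1).
  by apply: is_derive_eq H _; rewrite !mulr1.
have D2 : is_derive x 1 (fun y : R => coshS (y ^+ 2)) (sinh x).
  rewrite (_ : (fun _ => _) = @cosh R); first exact: is_derive_cosh.
  by apply/funext => y; exact: coshS_sqr.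
have E1 : sinhS (x ^+ 2) / 2 * (x + x) = sinh x.
  by case: D1 => _ <-; case: D2.
by rewrite -E1; field.
Qed.

Lemma sinhc_gt0 (x : R) : 0 < sinhc x.
Proof.
rewrite /sinhc; have [//|x0] := eqVneq x 0; rewrite /sinh.
have [xp|xn|x00] := ltrgtP x 0; last by rewrite x00 eqxx in x0.
  rewrite nmulr_lgt0 ?invr_lt0// pmulr_llt0 ?invr_gt0// subr_lt0 ltr_expR.
  by rewrite (lt_trans xp)// oppr_gt0.
rewrite divr_gt0// divr_gt0// subr_gt0 ltr_expR.
by rewrite (lt_trans _ xn)// oppr_lt0.
Qed.

Lemma cosh_sinhc (x : R) : cosh x ^+ 2 - sinhc x ^+ 2 * x ^+ 2 = 1.
Proof.
have e0 : expR x != 0 by rewrite gt_eqF ?expR_gt0.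
rewrite /cosh /sinhc; have [->|x0] := eqVneq x 0.
  by rewrite oppr0 expR0; field.
rewrite /sinh expRN; field; by rewrite e0 x0.
Qed.

End Entire.

(** * Charts of projective space and of its tangent bundle *)

Section Algebra.
Variables (R : realType) (n : nat).
Local Notation C := R[i].
Local Notation Cn1 := 'rV[C]_n.+1.
Local Notation ECn := ('rV[R]_n * 'rV[R]_n)%type.
Implicit Types (z x y : Cn1) (a b : 'rV[C]_n) (i j : 'I_n.+1).

Lemma realifyK m : cancel (@realify R m) (@complexify R m).
Proof. by move=> a; apply/rowP => k; rewrite !mxE; case: (a 0 k). Qed.

Lemma complexifyK m : cancel (@complexify R m) (@realify R m).
Proof.
by move=> [e1 e2]; rewrite /realify; congr pair; apply/rowP => k; rewrite !mxE.
Qed.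

Lemma insert_id i c a : insert i c a 0 i = c.
Proof. by rewrite mxE unlift_none. Qed.

Lemma insert_lift i c a k : insert i c a 0 (lift i k) = a 0 k.
Proof. by rewrite mxE liftK. Qed.

Lemma rowP_lift i (x y : Cn1) : x 0 i = y 0 i ->
  (forall k, x 0 (lift i k) = y 0 (lift i k)) -> x = y.
Proof. by move=> h1 h2; apply/rowP => k; case: (unliftP i k) => [l ->|->]. Qed.

Lemma affineZ i (l : C) z : l != 0 -> affine i (l *: z) = affine i z.
Proof.
move=> l0; apply/rowP => k; rewrite !mxE.
by rewrite -mulf_div mulfV// mul1r.
Qed.

Lemma affine_insert i a : affine i (insert i 1 a) = a.
Proof. by apply/rowP => k; rewrite mxE insert_lift insert_id divr1. Qed.

Lemma insert_affine i z : z 0 i != 0 -> insert i 1 (affine i z) = (z 0 i)^-1 *: z.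
Proof.
move=> zi; apply: (@rowP_lift i) => [|k]; first by rewrite insert_id mxE mulVf.
by rewrite insert_lift !mxE mulrC.
Qed.

(** The differential of [affine i] at [z], by the quotient rule. *)
Definition daffine i z x : 'rV[C]_n :=
  \row_k ((x 0 (lift i k) * z 0 i - z 0 (lift i k) * x 0 i) / z 0 i ^+ 2).

(** Multiples of [z] are tangent to the fibres of the projection, and scaling
    [z] and [x] together represents the same tangent vector. *)
Lemma daffine_scale i (l m : C) z x : l != 0 ->
  daffine i (l *: z) (l *: x + m *: z) = daffine i z x.
Proof.
move=> l0; apply/rowP => k; rewrite !mxE.
by rewrite exprMn invfM; move: (z 0 i ^- 2) => w; field.
Qed.

Lemma daffine_add i (m : C) z x : daffine i z (x + m *: z) = daffine i z x.
Proof. by have := daffine_scale i m z x (oner_neq0 _); rewrite !scale1r. Qed.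

Lemma daffine_hproj i z y : daffine i z (hproj z y) = daffine i z y.
Proof. by rewrite /hproj -scaleNr daffine_add. Qed.

Lemma daffine_insert i a b : daffine i (insert i 1 a) (insert i 0 b) = b.
Proof.
apply/rowP => k; rewrite !mxE !liftK !unlift_none expr1n divr1 mulr0 subr0.
by rewrite mulr1.
Qed.

(** The derivative of the curve [z / z_i], whose [i]-th coordinate stays equal
    to 1. *)
Lemma insert_daffine i z x : z 0 i != 0 ->
  insert i 0 (daffine i z x) = (z 0 i)^-1 *: x - (x 0 i / z 0 i ^+ 2) *: z.
Proof.
move=> zi; apply: (@rowP_lift i) => [|k].
  by rewrite insert_id !mxE; field.
by rewrite insert_lift !mxE; field.
Qed.

Lemma insert_daffineN i z x : z 0 i != 0 ->
  insert i 0 (daffine i z x) = (z 0 i)^-1 *: x + (- (x 0 i / z 0 i ^+ 2)) *: z.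
Proof. by move=> zi; rewrite insert_daffine// scaleNr. Qed.

(** A horizontal vector is recovered from its translates along the fibre. *)
Lemma hproj_fix z x (l m : C) : z != 0 -> dot x (conjv z) = 0 -> l != 0 ->
  hproj (l *: z) (l *: x + m *: z) = l *: x.
Proof.
move=> z0 xz l0; rewrite /hproj dotDl !dotZl conjvZ !dotZr xz !mulr0 add0r.
have zz : dot z (conjv z) != 0 by rewrite dot_conjv_eq0.
rewrite scalerA -addrA -scalerBl.
have cl : l^* != 0 by rewrite conjc_eq0.
rewrite (_ : m - _ = 0) ?scale0r ?addr0//.
by field; rewrite zz cl l0.
Qed.

Lemma insert_sum_linear i (c c' : C) a b (k : C) :
  insert i (k * c + c') (k *: a + b) = k *: insert i c a + insert i c' b.
Proof.
apply: (@rowP_lift i) => [|l]; first by rewrite !mxE !unlift_none.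
by rewrite !mxE !liftK !mxE.
Qed.

Lemma hcoord_neq0 (p : CP R n) : hcoord p != 0.
Proof. exact: valP (repr p). Qed.

Lemma hcoordK (p : CP R n) : pclass (hcoord_neq0 p) = p.
Proof.
rewrite /pclass -[RHS]reprK; congr (\pi _).
by apply: val_inj.
Qed.

Lemma pclassP z w (hz : z != 0) (hw : w != 0) :
  pclass hz = pclass hw <-> exists2 l : C, l != 0 & w = l *: z.
Proof.
split=> [/eqmodP/asboolP [l l0 E]|[l l0 E]]; first by exists l.
by apply/eqmodP/asboolP; exists l.
Qed.

Lemma hcoord_pclass z (hz : z != 0) :
  exists2 l : C, l != 0 & hcoord (pclass hz) = l *: z.
Proof. by apply/(pclassP hz (hcoord_neq0 _)); rewrite hcoordK. Qed.

Lemma cdom_pclass i z (hz : z != 0) :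
  cdom (CP_chart R i) (pclass hz) <-> z 0 i != 0.
Proof.
by have [l l0 E] := hcoord_pclass hz; rewrite /= E mxE mulf_eq0 negb_or l0.
Qed.

Lemma coord_pclass i z (hz : z != 0) :
  coord (CP_chart R i) (pclass hz) = realify (affine i z).
Proof. by have [l l0 E] := hcoord_pclass hz; rewrite /= E affineZ. Qed.

Lemma CP_coordK i p : cdom (CP_chart R i) p ->
  cinv (CP_chart R i) (coord (CP_chart R i) p) = p.
Proof.
rewrite -[p in _ -> _ = p]hcoordK /= => pi; apply/pclassP.
by exists (hcoord p 0 i) => //; rewrite realifyK insert_affine// scalerA mulfV// scale1r.
Qed.

Lemma CP_cover p : exists i, cdom (CP_chart R i) p.
Proof.
have /eqP H := hcoord_neq0 p; apply/not_existsP => K; apply: H.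
by apply/rowP => k; rewrite mxE; apply/eqP/negPn/negP => /K.
Qed.

Lemma TCP_eqP (p q : Bset R n) : \pi_(TCP R n) p = \pi_(TCP R n) q <->
  exists2 l : C, l != 0 & val q = (l *: (val p).1, l *: (val p).2).
Proof.
split=> [/eqmodP/asboolP [l l0 E]|[l l0 E]]; first by exists l.
by apply/eqmodP/asboolP; exists l.
Qed.

Lemma trep_pi (p : Bset R n) :
  exists2 l : C, l != 0 & trep (\pi_(TCP R n) p) = (l *: (val p).1, l *: (val p).2).
Proof. by apply/TCP_eqP; rewrite reprK. Qed.

Lemma base_pi (p : Bset R n) : base (\pi_(TCP R n) p) = pclass (B_neq0 p).
Proof.
have [l l0 E] := trep_pi p; apply/esym/pclassP; exists l => //.
by rewrite -[LHS]/((trep (\pi_(TCP R n) p)).1) E.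
Qed.

Lemma cdom_pi i (p : Bset R n) :
  cdom (TCP_chart R i) (\pi_(TCP R n) p) <-> (val p).1 0 i != 0.
Proof.
by have [l l0 E] := trep_pi p; rewrite /= E mxE mulf_eq0 negb_or l0.
Qed.

Lemma cdom_base i (v : TCP R n) :
  cdom (CP_chart R i) (base v) <-> cdom (TCP_chart R i) v.
Proof. by rewrite -[v]reprK base_pi cdom_pi cdom_pclass. Qed.

End Algebra.

Section DerivAffine.
Variables (R : realType) (E : normedModType R) (n : nat).
Local Notation C := R[i].

Lemma is_vderive_affine i (x v : E) (Z : E -> 'rV[C]_n.+1) L :
  is_vderive x v Z L -> Z x 0 i != 0 ->
  is_vderive x v (fun y => affine i (Z y)) (daffine i (Z x) L).
Proof.
move=> HZ Zi k; under eq_fun do rewrite mxE.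
have := is_cderiveM (HZ (lift i k)) (is_cderiveV Zi (HZ i)).
by rewrite !mxE; congr (is_cderive _ _ _ _); field.
Qed.

Lemma is_vderive_insert i (c : C) (x v : E) (a : E -> 'rV[C]_n) b :
  is_vderive x v a b -> is_vderive x v (fun y => insert i c (a y)) (insert i 0 b).
Proof.
move=> Ha k; under eq_fun do rewrite mxE; rewrite mxE.
by case: (unlift i k) => [l|]; [exact: Ha|exact: is_cderive_cst].
Qed.

Lemma csmooth_affine i (x : E) (Z : E -> 'rV[C]_n.+1) k :
  (forall k, csmooth x (fun y => Z y 0 k)) -> Z x 0 i != 0 ->
  csmooth x (fun y => affine i (Z y) 0 k).
Proof.
move=> HZ Zi; under eq_fun do rewrite mxE.
by apply: csmoothM => //; exact: csmoothV.
Qed.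

Lemma csmooth_insert i (c : C) (x : E) (a : E -> 'rV[C]_n) k :
  (forall k, csmooth x (fun y => a y 0 k)) ->
  csmooth x (fun y => insert i c (a y) 0 k).
Proof.
move=> Ha; under eq_fun do rewrite mxE.
by case: (unlift i k) => [l|]; [exact: Ha|exact: csmooth_cst].
Qed.

Lemma csmooth_daffine i (x : E) (Z X : E -> 'rV[C]_n.+1) k :
  (forall k, csmooth x (fun y => Z y 0 k)) ->
  (forall k, csmooth x (fun y => X y 0 k)) -> Z x 0 i != 0 ->
  csmooth x (fun y => daffine i (Z y) (X y) 0 k).
Proof.
move=> HZ HX Zi; under eq_fun do rewrite mxE.
apply: csmoothM.
  by apply: csmoothD; [apply: csmoothM|apply: csmoothN; apply: csmoothM].
under eq_fun do rewrite expr2.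
by apply: csmoothV; [exact: csmoothM|rewrite mulf_neq0].
Qed.

Lemma smooth_near_realify (x : E) (a : E -> 'rV[C]_n) :
  smooth_near x (fun y => realify (a y)) <->
  forall k, csmooth x (fun y => a y 0 k).
Proof.
split=> [/smooth_near_pair /= [/smooth_near_rV H1 /smooth_near_rV H2] k|H].
  split; [apply: smooth_near_ext (H1 k)|apply: smooth_near_ext (H2 k)];
    by near=> y; rewrite mxE.
apply/smooth_near_pair; split=> /=; apply/smooth_near_rV => k;
  under eq_fun do rewrite mxE; by case: (H k).
Unshelve. all: by end_near. Qed.

Lemma smooth_near_complexify (x : E) (e : E -> 'rV[R]_n * 'rV[R]_n) k :
  smooth_near x e -> csmooth x (fun y => complexify (e y) 0 k).
Proof.
move=> se; apply: (@smooth_near_realify x (fun y => complexify (e y))).1.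
by under eq_fun do rewrite complexifyK.
Qed.

Lemma is_vderive_complexify (x v : E) (e : E -> 'rV[R]_n * 'rV[R]_n) :
  differentiable e x -> is_vderive x v (fun y => complexify (e y)) (complexify ('D_v e x)).
Proof.
move=> de k.
have d1 : differentiable (fun y => (e y).1) x.
  by have [] := derive_linear_post v (@fst_linear _ _ _) (@fst_cont _ _ _) de.
have d2 : differentiable (fun y => (e y).2) x.
  by have [] := derive_linear_post v (@snd_linear _ _ _) (@snd_cont _ _ _) de.
have d1k : differentiable (fun y => (e y).1 0 k) x.
  by have [] := derive_linear_post v (@coord_linear _ 1 n 0 k) (@coord_cont _ 1 n 0 k) d1.
have d2k : differentiable (fun y => (e y).2 0 k) x.
  by have [] := derive_linear_post v (@coord_linear _ 1 n 0 k) (@coord_cont _ 1 n 0 k) d2.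
split; under eq_fun do rewrite mxE /=; rewrite mxE /=.
  by rewrite -derive_fst// -derive_rV//; apply: DeriveDef => //; exact: diff_derivable.
by rewrite -derive_snd// -derive_rV//; apply: DeriveDef => //; exact: diff_derivable.
Qed.

End DerivAffine.

Section TangentCharts.
Variables (R : realType) (n : nat).
Local Notation C := R[i].
Local Notation Cn1 := 'rV[C]_n.+1.

Lemma cderivE (c : R -> C) l : is_cderive (0 : R) 1 c l -> cderiv c = l.
Proof. by move=> /is_cderive_val <-; rewrite /cderiv !derive1E. Qed.

Lemma is_vderive_line m (z x : 'rV[C]_m) :
  is_vderive (0 : R) 1 (fun s : R => z + s%:C *: x) x.
Proof.
have Hc (w : 'rV[C]_m) : is_vderive (0 : R) (1 : R) (fun=> w) 0.
  by move=> k; rewrite mxE; exact: is_cderive_cst.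
have := is_vderiveD (Hc z) (is_vderiveZ (is_cderive_real (is_derive_id (0 : R) 1)) (Hc x)).
by rewrite scaler0 !add0r scale1r.
Qed.

Lemma taffineE i (z x : Cn1) : z 0 i != 0 -> taffine i z x = daffine i z x.
Proof.
move=> zi; apply/rowP => k; rewrite mxE; apply: cderivE.
have H := is_vderive_line z x.
have := @is_vderive_affine R R n i 0 1 _ _ H.
by rewrite scale0r addr0 => /(_ zi); exact.
Qed.

Lemma coord_pi i (p : Bset R n) : (val p).1 0 i != 0 ->
  coord (TCP_chart R i) (\pi_(TCP R n) p) =
  (realify (affine i (val p).1), realify (daffine i (val p).1 (val p).2)).
Proof.
move=> pi; have [l l0 E] := trep_pi p; rewrite /= E /= affineZ// taffineE.
  by have := daffine_scale i 0 (val p).1 (val p).2 l0; rewrite scale0r addr0 => ->.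
by rewrite mxE mulf_neq0.
Qed.

Lemma coord_base i (v : TCP R n) :
  coord (CP_chart R i) (base v) = (coord (TCP_chart R i) v).1.
Proof.
rewrite -[v]reprK base_pi coord_pclass.
by have [l l0 E] := trep_pi (repr v); rewrite /= E /= affineZ.
Qed.

(** The representative of a tangent vector that the inverse chart chooses: the
    first vector has [i]-th coordinate 1, the second is horizontal. *)
Definition lift_fst i (e : ('rV[R]_n * 'rV[R]_n) * ('rV[R]_n * 'rV[R]_n)) : Cn1 :=
  insert i 1 (complexify e.1).
Definition lift_snd i (e : ('rV[R]_n * 'rV[R]_n) * ('rV[R]_n * 'rV[R]_n)) : Cn1 :=
  hproj (lift_fst i e) (insert i 0 (complexify e.2)).
Definition Blift i e : Bset R n :=
  exist _ (lift_fst i e, lift_snd i e) (hprojP i (complexify e.1) (complexify e.2)).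

Lemma TCP_cinvE (i : 'I_n.+1) e : cinv (TCP_chart R i) e = \pi_(TCP R n) (Blift i e).
Proof. by []. Qed.

Lemma lift_fst_id i e : lift_fst i e 0 i = 1. Proof. exact: insert_id. Qed.

Lemma TCP_cdom_cinv (i : 'I_n.+1) e : cdom (TCP_chart R i) (cinv (TCP_chart R i) e).
Proof. by rewrite TCP_cinvE cdom_pi /= lift_fst_id oner_neq0. Qed.

Lemma TCP_cdom_cinvj (i j : 'I_n.+1) e : cdom (TCP_chart R j) (cinv (TCP_chart R i) e) <->
  lift_fst i e 0 j != 0.
Proof. by rewrite TCP_cinvE cdom_pi. Qed.

(** The horizontal projection in [lift_snd] only adds a multiple of
    [lift_fst], and such a multiple represents the tangent vector 0. *)
Lemma TCP_transition (i j : 'I_n.+1) e : lift_fst i e 0 j != 0 ->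
  coord (TCP_chart R j) (cinv (TCP_chart R i) e) =
  (realify (affine j (lift_fst i e)),
   realify (daffine j (lift_fst i e) (insert i 0 (complexify e.2)))).
Proof. by move=> h; rewrite TCP_cinvE coord_pi //= daffine_hproj. Qed.

Lemma TCP_cinvK (i : 'I_n.+1) e : coord (TCP_chart R i) (cinv (TCP_chart R i) e) = e.
Proof.
rewrite TCP_transition ?lift_fst_id ?oner_neq0// /lift_fst affine_insert.
by rewrite daffine_insert !complexifyK; case: e.
Qed.

Lemma TCP_coordK (i : 'I_n.+1) v : cdom (TCP_chart R i) v ->
  cinv (TCP_chart R i) (coord (TCP_chart R i) v) = v.
Proof.
rewrite -[v]reprK; set p := repr v => /cdom_pi pi.
rewrite coord_pi// TCP_cinvE; apply/TCP_eqP; exists ((val p).1 0 i) => //=.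
rewrite /lift_snd /lift_fst /= !realifyK insert_affine// insert_daffine//.
rewrite -scaleNr -[X in hproj _ (_ + X *: _)]/(- _).
rewrite hproj_fix ?B_neq0 ?B_dot ?invr_eq0//.
by rewrite !scalerA mulfV// !scale1r; case: (val p).
Qed.

Lemma TCP_cover (v : TCP R n) : exists i, cdom (TCP_chart R i) v.
Proof. by have [i /cdom_base] := CP_cover (base v); exists i. Qed.

Lemma lift_dot i e : dot (lift_snd i e) (conjv (lift_fst i e)) = 0.
Proof. exact: (B_dot (Blift i e)). Qed.

Lemma lift_fst_neq0 i e : lift_fst i e != 0.
Proof. exact: insert_neq0. Qed.

Lemma TCP_transition_smooth (E : normedModType R) (i j : 'I_n.+1)
    (F : E -> ('rV[R]_n * 'rV[R]_n) * ('rV[R]_n * 'rV[R]_n)) (x : E) :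
  smooth_near x F -> cdom (TCP_chart R j) (cinv (TCP_chart R i) (F x)) ->
  (\forall y \near x, cdom (TCP_chart R j) (cinv (TCP_chart R i) (F y))) /\
  smooth_near x (fun y => coord (TCP_chart R j) (cinv (TCP_chart R i) (F y))).
Proof.
move=> /smooth_near_pair [F1 F2] /TCP_cdom_cinvj Fx.
have Z k : csmooth x (fun y => lift_fst i (F y) 0 k).
  by apply: csmooth_insert => l; exact: smooth_near_complexify.
have X k : csmooth x (fun y => insert i 0 (complexify (F y).2) 0 k).
  by apply: csmooth_insert => l; exact: smooth_near_complexify.
have N : \forall y \near x, lift_fst i (F y) 0 j != 0 := csmooth_neq0 (Z j) Fx.
split; first by apply: filterS N => y /TCP_cdom_cinvj.
apply: (@smooth_near_ext _ _ _ x (fun y =>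
  (realify (affine j (lift_fst i (F y))),
   realify (daffine j (lift_fst i (F y)) (insert i 0 (complexify (F y).2)))))).
  by apply: filterS N => y Ny; rewrite TCP_transition.
apply/smooth_near_pair; split=> /=; apply/smooth_near_realify => k.
  exact: csmooth_affine.
exact: csmooth_daffine.
Qed.

End TangentCharts.

(** * Algebra of the map Phi *)

Section Hermitian.
Variables (R : realType).
Local Notation C := R[i].
Local Notation herm x y := (dot x (conjv y)).

(** [conjvZ] with the conjugation written [conjc], as in all other lemmas. *)
Lemma conjv_scale n a (z : 'rV[C]_n) : conjv (a *: z) = a^* *: conjv z.
Proof. exact: conjvZ. Qed.

Lemma conjcM (x y : C) : (x * y)^* = x^* * y^*.
Proof. exact: rmorphM. Qed.

Lemma conjcD (x y : C) : (x + y)^* = x^* + y^*.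
Proof. exact: rmorphD. Qed.

Lemma conjcN (x : C) : (- x)^* = - x^*.
Proof. exact: rmorphN. Qed.

Lemma dotDr n (x y w : 'rV[C]_n) : dot w (x + y) = dot w x + dot w y.
Proof. by rewrite dotC dotDl !(dotC w). Qed.

Lemma conjvD n (x y : 'rV[C]_n) : conjv (x + y) = conjv x + conjv y.
Proof. by apply/rowP => k; rewrite !mxE rmorphD. Qed.

Lemma conjvE n (x : 'rV[C]_n) k : conjv x 0 k = (x 0 k)^*.
Proof. by rewrite mxE. Qed.

Lemma hermC n (x y : 'rV[C]_n) : (herm x y)^* = herm y x.
Proof. by rewrite conj_dot conjvK dotC. Qed.

Lemma dot_conjl n (x y : 'rV[C]_n) : dot (conjv x) y = (herm x y)^*.
Proof. by rewrite conj_dot conjvK. Qed.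

Lemma herm_real n (x : 'rV[C]_n) : (herm x x)^* = herm x x.
Proof. exact: hermC. Qed.

Lemma herm_Re n (x : 'rV[C]_n) : herm x x = (complex.Re (herm x x))%:C.
Proof. by rewrite dot_conjvE. Qed.

Lemma herm_ge0 n (x : 'rV[C]_n) : 0 <= complex.Re (herm x x).
Proof. by rewrite dot_conjvE /= sumr_ge0// => k _; rewrite addr_ge0 ?sqr_ge0. Qed.

Lemma normv_sqr n (x : 'rV[C]_n) : normv x ^+ 2 = complex.Re (herm x x).
Proof. by rewrite sqr_sqrtr// herm_ge0. Qed.

Lemma conjc_i : ('i : C)^* = - 'i.
Proof. by rewrite /= /GRing.opp /= /oppc oppr0. Qed.

Lemma sqrc_i : ('i : C) * 'i = -1.
Proof. by rewrite -expr2 sqr_i. Qed.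

Lemma conjc_rc (r : R) : (r%:C)^* = r%:C.
Proof. exact: conjc_real. Qed.

Lemma rC_neq0 (r : R) : (r%:C != 0) = (r != 0).
Proof. by rewrite -[0]/(0%:C) (inj_eq (@complexI R)). Qed.

Lemma Re0_conj (z : C) : complex.Re z = 0 -> z^* = - z.
Proof. by case: z => a b /= ->; rewrite /GRing.opp /= /oppc oppr0. Qed.

End Hermitian.

Section PhiAlgebra.
Variables (R : realType) (n : nat).
Local Notation C := R[i].
Local Notation Cn1 := 'rV[C]_n.+1.
Local Notation herm x y := (dot x (conjv y)).

Lemma conjv_comb (z x : Cn1) (c s : R) :
  conjv (c%:C *: z + ('i * s%:C) *: x) = c%:C *: conjv z - ('i * s%:C) *: conjv x.
Proof.
by rewrite conjvD !conjv_scale conjcM !conjc_rc conjc_i mulNr scaleNr.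
Qed.

Lemma conjv_comb' (z x : Cn1) (c s : R) :
  conjv (c%:C *: conjv z + ('i * s%:C) *: conjv x) = c%:C *: z - ('i * s%:C) *: x.
Proof. by rewrite conjv_comb !conjvK. Qed.

(** The (1,0)-form for which the logarithmic derivative of [calN] is
    [eta + conj eta]. *)
Definition eta (z w dz dw : Cn1) : C :=
  herm dz z / herm z z + herm dw w / herm w w
  - (dot dz w + dot z dw) / dot z w.

(** [calN] is a function on the product of projective spaces: the
    contributions of [l' / l] and [m' / m] to the norms are cancelled by
    those to the bilinear form. *)
Lemma eta_scale (l m l' m' : C) (z w dz dw : Cn1) :
  l != 0 -> m != 0 -> z != 0 -> w != 0 -> dot z w != 0 ->
  eta (l *: z) (m *: w) (l *: dz + l' *: z) (m *: dw + m' *: w) = eta z w dz dw.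
Proof.
move=> l0 m0 z0 w0 zw0; rewrite /eta !conjv_scale !(dotDl, dotDr, dotZl, dotZr).
have zz : herm z z != 0 by rewrite dot_conjv_eq0.
have ww : herm w w != 0 by rewrite dot_conjv_eq0.
have lc : l^* != 0 by rewrite conjc_eq0.
have mc : m^* != 0 by rewrite conjc_eq0.
by field; rewrite zz ww lc mc l0 m0 zw0.
Qed.

Lemma eta_i (z w dz dw : Cn1) : eta z w ('i *: dz) ('i *: dw) = 'i * eta z w dz dw.
Proof. by rewrite /eta !(dotZl, dotZr); ring. Qed.

Definition musq (z x : Cn1) : R := complex.Re (herm x x) / complex.Re (herm z z).

Lemma mu_sqr (p : Bset R n) : mu p ^+ 2 = musq (val p).1 (val p).2.
Proof. by rewrite /mu expr_div_n !normv_sqr. Qed.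

Lemma musq_cosh (p : Bset R n) : coshS (musq (val p).1 (val p).2) = cosh (mu p).
Proof. by rewrite -mu_sqr coshS_sqr. Qed.

Lemma musq_sinhc (p : Bset R n) : sinhS (musq (val p).1 (val p).2) = sinhc (mu p).
Proof. by rewrite -mu_sqr sinhS_sqr. Qed.

(** The identity between the squares of [cosh] and [sinh], multiplied by the
    squared norm of the base vector. *)
Lemma Phi_pyth (p : Bset R n) :
  (cosh (mu p))%:C ^+ 2 * herm (val p).1 (val p).1 -
  (sinhc (mu p))%:C ^+ 2 * herm (val p).2 (val p).2 = herm (val p).1 (val p).1.
Proof.
have := cosh_sinhc (mu p); rewrite mu_sqr /musq.
have z0 : complex.Re (herm (val p).1 (val p).1) != 0.
  by rewrite -rC_neq0 -herm_Re dot_conjv_eq0 B_neq0.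
have EA := herm_Re (val p).1; have EX := herm_Re (val p).2.
move: z0 EA EX; move: (complex.Re _) => A A0; move: (complex.Re _) => X -> -> H.
rewrite -!rmorphXn -!rmorphM -rmorphB /=; congr (_%:C).
by rewrite -[RHS]mul1r -H; field.
Qed.

(** The cross terms vanish by orthogonality and [Phi_pyth] remains.  In
    particular [Phi] takes its values in [calM]. *)
Lemma Phi_dot (p : Bset R n) : dot (Phi_fst p) (Phi_snd p) = herm (val p).1 (val p).1.
Proof.
have B1 := B_dot p; have B2 := congr1 conjc B1; rewrite hermC rmorph0 in B2.
rewrite -[RHS]Phi_pyth /Phi_fst /Phi_snd.
rewrite dotDl !dotDr !dotZl !dotZr B1 B2.
have i2 := sqrc_i R; ring: i2.
Qed.

Lemma Phi_fst_herm (p : Bset R n) : herm (Phi_fst p) (Phi_fst p) =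
  (cosh (mu p))%:C ^+ 2 * herm (val p).1 (val p).1 +
  (sinhc (mu p))%:C ^+ 2 * herm (val p).2 (val p).2.
Proof.
have B1 := B_dot p; have B2 := congr1 conjc B1; rewrite hermC rmorph0 in B2.
rewrite /Phi_fst conjv_comb -scaleNr dotDl !dotDr !dotZl !dotZr B1 B2.
have i2 := sqrc_i R; ring: i2.
Qed.

Lemma Phi_snd_herm (p : Bset R n) : herm (Phi_snd p) (Phi_snd p) =
  (cosh (mu p))%:C ^+ 2 * herm (val p).1 (val p).1 +
  (sinhc (mu p))%:C ^+ 2 * herm (val p).2 (val p).2.
Proof.
have B1 := B_dot p; have B2 := congr1 conjc B1; rewrite hermC rmorph0 in B2.
rewrite /Phi_snd conjv_comb' -scaleNr dotDl !dotDr !dotZl !dotZr !dot_conjl.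
rewrite !hermC B1 B2.
have i2 := sqrc_i R; ring: i2.
Qed.

Lemma Phi_calM (v : TCP R n) : calM (Phi v).
Proof.
rewrite /calM /Phi /Phi_B /=; set p := repr v.
have [l l0 ->] := hcoord_pclass (Phi_fst_neq0 p).
have [k k0 ->] := hcoord_pclass (Phi_snd_neq0 p).
rewrite dotZl dotZr Phi_dot !mulf_neq0//.
by rewrite dot_conjv_eq0 B_neq0.
Qed.

Lemma comb2E (c s : C) (z x : Cn1) k :
  (c *: z + s *: x) 0 k = c * z 0 k + s * x 0 k.
Proof. by rewrite mxE; congr (_ + _); rewrite mxE. Qed.

Lemma comb4E (a b c d : C) (z x y w : Cn1) k :
  (a *: z + b *: x + (c *: y + d *: w)) 0 k =
  a * z 0 k + b * x 0 k + (c * y 0 k + d * w 0 k).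
Proof. by rewrite mxE !comb2E. Qed.

Lemma dot42E (a b c d p q : C) (z x y w u v : Cn1) :
  dot (a *: z + b *: x + (c *: y + d *: w)) (p *: u + q *: v) =
  a * (p * dot z u + q * dot z v) + b * (p * dot x u + q * dot x v) +
  (c * (p * dot y u + q * dot y v) + d * (p * dot w u + q * dot w v)).
Proof.
have D2 (t : Cn1) : dot t (p *: u + q *: v) = p * dot t u + q * dot t v.
  by rewrite dotDr !dotZr.
by rewrite 3!dotDl !dotZl !D2.
Qed.

Section PhiDeriv.
Variables (z x dz dx : Cn1) (c s dc ds : R).
Variables (Z W DZ DW : Cn1).
Hypothesis defZ : Z = c%:C *: z + ('i * s%:C) *: x.
Hypothesis defW : W = c%:C *: conjv z + ('i * s%:C) *: conjv x.
Hypothesis defDZ :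
  DZ = c%:C *: dz + dc%:C *: z + (('i * s%:C) *: dx + ('i * ds%:C) *: x).
Hypothesis defDW : DW = c%:C *: conjv dz + dc%:C *: conjv z +
          (('i * s%:C) *: conjv dx + ('i * ds%:C) *: conjv x).

(** The imaginary part comes from [herm dz x] and [herm dx z] only.
    Differentiating [herm x z = 0] makes their real parts opposite, so it is a
    multiple of [Re (herm dz x)], the canonical 1-form. *)
Lemma Phi_form : herm x z = 0 -> herm x dz + herm dx z = 0 ->
  complex.Re (herm dz x) = 0 ->
  (herm DZ Z + herm DW W)^* = herm DZ Z + herm DW W.
Proof.
move=> xz dxz /Re0_conj h12.
have zx : herm z x = 0 by rewrite -hermC xz conjc0.
have h12' : herm x dz = - herm dz x by rewrite -hermC h12.
have h21 : herm dx z = herm dz x.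
  by apply/eqP; move: dxz; rewrite h12' addrC => /eqP; rewrite subr_eq0.
rewrite defZ defW conjv_comb conjv_comb' -!scaleNr defDZ defDW.
rewrite !dot42E !dot_conjl xz zx h21 conjc0 h12.
have e1 : herm z dz = (herm dz z)^* by rewrite hermC.
rewrite !herm_real.
rewrite !(conjcD, conjcM, conjcN, conjc_rc, conjc_i, conjcK, herm_real, conjc0, h12).
have i2 := sqrc_i R; ring: i2.
Qed.

(** Since [dot Z W] and its derivative are real, so is [a + b]; since [Z] and
    [W] keep the same norm, [a] and [b] have the same real part.  Therefore
    [b^* = a], and the equations for [Z] and for the conjugate of [W] separate
    into [d(c z) = a c z] and [d(s x) = a s x].  At the coordinate [i] the
    first one reads [dc = a c]; hence [dz = 0] and [a] is real.  The derivative
    of the hyperbolic identity then reads [a |z|^2 = 0]. *)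
Lemma Phi_kernel i (a b : C) :
  z 0 i = 1 -> dz 0 i = 0 -> c%:C != 0 -> s%:C != 0 ->
  c%:C ^+ 2 * herm z z - s%:C ^+ 2 * herm x x = herm z z ->
  2 * c%:C * dc%:C * herm z z + c%:C ^+ 2 * (herm z dz + herm dz z)
  - 2 * s%:C * ds%:C * herm x x - s%:C ^+ 2 * (herm x dx + herm dx x)
    = herm z dz + herm dz z ->
  dot Z DW + dot DZ W = herm z dz + herm dz z ->
  dot Z W = herm z z -> herm z z != 0 -> herm Z Z != 0 ->
  herm Z Z = herm W W ->
  herm Z DZ + herm DZ Z = herm W DW + herm DW W ->
  (dc = 0 -> ds = 0) -> DZ = a *: Z -> DW = b *: W -> dz = 0 /\ dx = 0.
Proof.
move=> zi dzi c0 s0 pyth dpyth dZW ZW A0 P0 PE dP dcs EZ EW.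
have zz0 : (herm z dz + herm dz z)^* = herm z dz + herm dz z.
  by rewrite conjcD !hermC addrC.
(* dot Z W and its derivative are real *)
have ab : a + b = a^* + b^*.
  apply: (mulIf A0).
  have E1 : (a + b) * herm z z = herm z dz + herm dz z.
    by rewrite -dZW EZ EW dotZl dotZr ZW; ring.
  by rewrite E1 -zz0 -E1 conjcM conjcD herm_real.
(* |Z| = |W| to first order *)
have aa : a + a^* = b + b^*.
  apply: (mulIf P0).
  move: dP; rewrite EZ EW !conjv_scale !dotZl !dotZr -PE => dP.
  by rewrite !mulrDl addrC dP addrC.
have ab' : b^* = a.
  have : 2 * b^* = 2 * a.
    transitivity (2 * a - (a + b - (a^* + b^*)) - (a + a^* - (b + b^*))); first by ring.
    by rewrite ab aa !subrr !subr0.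
  by apply: mulfI; rewrite pnatr_eq0.
have i2 := sqrc_i R.
have two0 : (2 : C) != 0 by rewrite pnatr_eq0.
have i0 : ('i : C) != 0 by rewrite -sqrf_eq0 expr2 i2 oppr_eq0 oner_eq0.
have K1 k : DZ 0 k = a * Z 0 k by rewrite EZ mxE.
have K2 k : (DW 0 k)^* = a * (W 0 k)^* by rewrite EW mxE conjcM ab'.
have L1 k : c%:C * dz 0 k + dc%:C * z 0 k + ('i * s%:C * dx 0 k + 'i * ds%:C * x 0 k)
    = a * (c%:C * z 0 k + 'i * s%:C * x 0 k).
  by have := K1 k; rewrite defDZ defZ comb4E comb2E.
have L2 k : c%:C * dz 0 k + dc%:C * z 0 k + (- 'i * s%:C * dx 0 k + - 'i * ds%:C * x 0 k)
    = a * (c%:C * z 0 k + - 'i * s%:C * x 0 k).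
  have := K2 k; rewrite defDW defW comb4E comb2E !conjvE.
  rewrite !conjcD !conjcM.
  rewrite !conjc_rc.
  rewrite conjc_i.
  by rewrite !conjcK.
have e1 k : c%:C * dz 0 k + dc%:C * z 0 k = a * c%:C * z 0 k.
  have h1 := L1 k; have h2 := L2 k.
  apply: (mulfI two0).
  transitivity ((c%:C * dz 0 k + dc%:C * z 0 k + ('i * s%:C * dx 0 k + 'i * ds%:C * x 0 k))
   + (c%:C * dz 0 k + dc%:C * z 0 k + (- 'i * s%:C * dx 0 k + - 'i * ds%:C * x 0 k))).
    by ring.
  by rewrite h1 h2; ring.
have e2 k : s%:C * dx 0 k + ds%:C * x 0 k = a * s%:C * x 0 k.
  have h1 := L1 k; have h2 := L2 k.
  apply: (mulfI two0); apply: (mulfI i0).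
  transitivity ((c%:C * dz 0 k + dc%:C * z 0 k + ('i * s%:C * dx 0 k + 'i * ds%:C * x 0 k))
   - (c%:C * dz 0 k + dc%:C * z 0 k + (- 'i * s%:C * dx 0 k + - 'i * ds%:C * x 0 k))).
    by ring.
  by rewrite h1 h2; ring.
(* the i-th coordinate of z is constant and equal to 1 *)
have ac : dc%:C = a * c%:C.
  by have := e1 i; rewrite zi dzi mulr0 add0r !mulr1.
have dz0 : dz = 0.
  apply/rowP => k; rewrite mxE; apply: (mulfI c0); rewrite mulr0.
  by have := e1 k; rewrite ac => /eqP; rewrite -subr_eq0 addrK => /eqP.
have ar : a^* = a.
  apply: (mulIf c0); rewrite -ac -[in RHS](conjc_rc dc) ac conjcM conjc_rc.
  by [].
have sdx : s%:C *: dx = (a * s%:C - ds%:C) *: x.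
  apply/rowP => k; rewrite !mxE mulrBl; apply/eqP.
  by rewrite eq_sym subr_eq eq_sym e2.
have h1 : s%:C * herm dx x = (a * s%:C - ds%:C) * herm x x.
  by rewrite -dotZl sdx dotZl.
have h2 : s%:C * herm x dx = (a * s%:C - ds%:C) * herm x x.
  have := congr1 conjc h1.
  rewrite !(conjcM, conjcD, conjcN, conjc_rc, ar, herm_real).
  by rewrite hermC.
have dz0' : herm dz z = 0 by rewrite dz0 dot0l.
have dz0'' : herm z dz = 0 by rewrite -hermC dz0' conjc0.
(* the derivative of c^2 |z|^2 - s^2 |x|^2 = |z|^2 at dz = 0 *)
have a0 : a = 0.
  apply: (mulIf A0); apply: (mulfI two0); rewrite mul0r mulr0.
  move: dpyth; rewrite dz0' dz0'' addr0 mulr0 addr0 => dpyth.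
  rewrite -pyth -[RHS]dpyth ac.
  transitivity (2 * c%:C * (a * c%:C) * herm z z - 2 * s%:C * ds%:C * herm x x
    - s%:C * ((a * s%:C - ds%:C) * herm x x + (a * s%:C - ds%:C) * herm x x)).
    by ring.
  by rewrite -{1}h2 -h1; ring.
have dc0 : dc = 0.
  by move: ac; rewrite a0 mul0r => -[].
have ds0 := dcs dc0.
split=> //; apply/rowP => k; rewrite mxE; apply: (mulfI s0); rewrite mulr0.
by have := e2 k; rewrite a0 ds0 !mul0r addr0.
Qed.

End PhiDeriv.

End PhiAlgebra.

(** * The map Phi in charts *)

Section PhiChart.
Variables (R : realType) (n : nat) (E : normedModType R).
Local Notation C := R[i].
Local Notation Cn1 := 'rV[C]_n.+1.
Local Notation ECn := ('rV[R]_n * 'rV[R]_n)%type.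
Local Notation herm x y := (dot x (conjv y)).
Variables (i : 'I_n.+1) (e : E -> ECn * ECn) (x0 : E).
Hypothesis se : smooth_near x0 e.

Let z y := lift_fst i (e y).
Let x y := lift_snd i (e y).
Let t y := musq (z y) (x y).
Let Z y := Phi_fst (Blift i (e y)).
Let W y := Phi_snd (Blift i (e y)).

Lemma csmooth_conjv m (w : E -> 'rV[C]_m) k :
  csmooth x0 (fun y => w y 0 k) -> csmooth x0 (fun y => conjv (w y) 0 k).
Proof. by move=> H; under eq_fun do rewrite conjvE; exact: csmooth_conj. Qed.

Lemma csmooth_lift_fst k : csmooth x0 (fun y => z y 0 k).
Proof.
by apply: csmooth_insert => l; apply: smooth_near_complexify; case/smooth_near_pair: se.
Qed.

Lemma csmooth_insert_snd k : csmooth x0 (fun y => insert i 0 (complexify (e y).2) 0 k).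
Proof.
by apply: csmooth_insert => l; apply: smooth_near_complexify; case/smooth_near_pair: se.
Qed.

Lemma lift_fst_herm_neq0 y : herm (z y) (z y) != 0.
Proof. by rewrite dot_conjv_eq0 lift_fst_neq0. Qed.

Lemma csmooth_lift_snd k : csmooth x0 (fun y => x y 0 k).
Proof.
have hprojE (u w : Cn1) : hproj u w 0 k = w 0 k + - (herm w u / herm u u) * u 0 k.
  by rewrite mxE mulNr; congr (_ + _); rewrite mxE; congr (- _); rewrite mxE.
rewrite /x /lift_snd; under eq_fun do rewrite hprojE.
apply: csmoothD; first exact: csmooth_insert_snd.
apply: csmoothM; last exact: csmooth_lift_fst.
apply: csmoothN; apply: csmoothM.
  apply: csmooth_dot => l; first exact: csmooth_insert_snd.
  by apply: csmooth_conjv; exact: csmooth_lift_fst.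
apply: csmoothV; last exact: lift_fst_herm_neq0.
by apply: csmooth_dot => l; [|apply: csmooth_conjv]; exact: csmooth_lift_fst.
Qed.

Lemma smooth_musq : smooth_near x0 t.
Proof.
have hz : csmooth x0 (fun y => herm (z y) (z y)).
  by apply: csmooth_dot => l; [|apply: csmooth_conjv]; exact: csmooth_lift_fst.
have hx : csmooth x0 (fun y => herm (x y) (x y)).
  by apply: csmooth_dot => l; [|apply: csmooth_conjv]; exact: csmooth_lift_snd.
apply: smooth_nearM; first by case: hx.
apply: smooth_nearV; first by case: hz.
by rewrite -rC_neq0 -herm_Re lift_fst_herm_neq0.
Qed.

Lemma smooth_coshS_musq : smooth_near x0 (fun y => coshS (t y)).
Proof. by apply: smooth_near_comp1; [exact: smooth_musq|exact: coshS_smooth]. Qed.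

Lemma smooth_sinhS_musq : smooth_near x0 (fun y => sinhS (t y)).
Proof. by apply: smooth_near_comp1; [exact: smooth_musq|exact: sinhS_smooth]. Qed.

Lemma Phi_fst_liftE y : Z y = (coshS (t y))%:C *: z y + ('i * (sinhS (t y))%:C) *: x y.
Proof. by rewrite /Z /Phi_fst -musq_cosh -musq_sinhc. Qed.

Lemma Phi_snd_liftE y : W y = (coshS (t y))%:C *: conjv (z y) + ('i * (sinhS (t y))%:C) *: conjv (x y).
Proof. by rewrite /W /Phi_snd -musq_cosh -musq_sinhc. Qed.

Lemma csmooth_Phi_lift k : csmooth x0 (fun y => Z y 0 k) /\ csmooth x0 (fun y => W y 0 k).
Proof.
have c1 := csmooth_real smooth_coshS_musq; have s1 := csmooth_real smooth_sinhS_musq.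
have s2 : csmooth x0 (fun y => 'i * (sinhS (t y))%:C).
  by apply: csmoothM => //; exact: csmooth_cst.
split.
  under eq_fun do rewrite Phi_fst_liftE comb2E.
  by apply: csmoothD; apply: csmoothM => //; [exact: csmooth_lift_fst|exact: csmooth_lift_snd].
under eq_fun do rewrite Phi_snd_liftE comb2E.
by apply: csmoothD; apply: csmoothM => //; apply: csmooth_conjv;
  [exact: csmooth_lift_fst|exact: csmooth_lift_snd].
Qed.

Lemma Phi_coord (jk : 'I_n.+1 * 'I_n.+1) y :
  coord (calM_chart R jk) (Phi (cinv (TCP_chart R i) (e y))) =
  (realify (affine jk.1 (Z y)), realify (affine jk.2 (W y))).
Proof.
rewrite TCP_cinvE Phi_pi -(coord_pclass _ (Phi_fst_neq0 (Blift i (e y)))).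
by rewrite -(coord_pclass _ (Phi_snd_neq0 (Blift i (e y)))).
Qed.

Lemma Phi_cdom (jk : 'I_n.+1 * 'I_n.+1) y :
  cdom (calM_chart R jk) (Phi (cinv (TCP_chart R i) (e y))) <->
  Z y 0 jk.1 != 0 /\ W y 0 jk.2 != 0.
Proof.
split=> [[_]|[h1 h2]].
  by rewrite TCP_cinvE Phi_pi => -[/cdom_pclass h1 /cdom_pclass h2].
split; first exact: Phi_calM.
by rewrite TCP_cinvE Phi_pi; split; apply/cdom_pclass.
Qed.

(** In these coordinates [Phi] is rational in the lifts and in [coshS] and
    [sinhS] of [musq], which is itself rational. *)
Lemma Phi_smooth (jk : 'I_n.+1 * 'I_n.+1) :
  cdom (calM_chart R jk) (Phi (cinv (TCP_chart R i) (e x0))) ->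
  (\forall y \near x0, cdom (calM_chart R jk) (Phi (cinv (TCP_chart R i) (e y)))) /\
  smooth_near x0 (fun y => coord (calM_chart R jk) (Phi (cinv (TCP_chart R i) (e y)))).
Proof.
move=> /Phi_cdom [h1 h2]; split.
  have N1 : \forall y \near x0, Z y 0 jk.1 != 0 := csmooth_neq0 (csmooth_Phi_lift _).1 h1.
  have N2 : \forall y \near x0, W y 0 jk.2 != 0 := csmooth_neq0 (csmooth_Phi_lift _).2 h2.
  by near=> y; apply/Phi_cdom; split; near: y.
under eq_fun do rewrite Phi_coord.
apply/smooth_near_pair; split=> /=; apply/smooth_near_realify => k;
  apply: csmooth_affine => // l; by case: (csmooth_Phi_lift l).
Unshelve. all: by end_near. Qed.

Variable v : E.
Let dz := insert i 0 (complexify ('D_v e x0).1).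
Let dx := \row_k cderive v (fun y => x y 0 k) x0.
Let dt := 'D_v t x0.
Let dc := sinhS (t x0) / 2 * dt.
Let ds := 'D_1 (@sinhS R) (t x0) * dt.
Let DZ := (coshS (t x0))%:C *: dz + dc%:C *: z x0 +
  (('i * (sinhS (t x0))%:C) *: dx + ('i * ds%:C) *: x x0).
Let DW := (coshS (t x0))%:C *: conjv dz + dc%:C *: conjv (z x0) +
  (('i * (sinhS (t x0))%:C) *: conjv dx + ('i * ds%:C) *: conjv (x x0)).

Lemma is_vderive_lift_fst : is_vderive x0 v z dz.
Proof.
apply: is_vderive_insert.
have de := smooth_near_differentiable se.
rewrite -derive_fst//; apply: is_vderive_complexify.
by have [] := derive_linear_post v (@fst_linear _ _ _) (@fst_cont _ _ _) de.
Qed.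

Lemma is_vderive_lift_snd : is_vderive x0 v x dx.
Proof. by move=> k; rewrite mxE; apply: csmooth_is_cderive; exact: csmooth_lift_snd. Qed.

Lemma is_derive_musq : is_derive x0 v t dt.
Proof. by apply/DeriveDef => //; exact/diff_derivable/smooth_near_differentiable/smooth_musq. Qed.

Lemma is_derive_coshS_musq : is_derive x0 v (fun y => coshS (t y)) dc.
Proof. apply: is_derive_comp1; [exact: coshS_derive|exact: is_derive_musq]. Qed.

Lemma is_derive_sinhS_musq : is_derive x0 v (fun y => sinhS (t y)) ds.
Proof.
apply: is_derive_comp1; last exact: is_derive_musq.
by apply/DeriveDef => //; exact/diff_derivable/smooth_near_differentiable/sinhS_smooth.
Qed.

Lemma is_cderive_i_sinhS : is_cderive x0 v (fun y => 'i * (sinhS (t y))%:C) ('i * ds%:C).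
Proof.
have := is_cderiveM (is_cderive_cst x0 v 'i) (is_cderive_real is_derive_sinhS_musq).
by rewrite mul0r addr0.
Qed.

Lemma is_vderive_Phi_fst : is_vderive x0 v Z DZ.
Proof.
have -> : Z = fun y => (coshS (t y))%:C *: z y + ('i * (sinhS (t y))%:C) *: x y.
  by apply/funext => y; exact: Phi_fst_liftE.
apply: is_vderiveD; first exact: is_vderiveZ (is_cderive_real is_derive_coshS_musq) is_vderive_lift_fst.
exact: is_vderiveZ is_cderive_i_sinhS is_vderive_lift_snd.
Qed.

Lemma is_vderive_Phi_snd : is_vderive x0 v W DW.
Proof.
have -> : W = fun y => (coshS (t y))%:C *: conjv (z y) +
    ('i * (sinhS (t y))%:C) *: conjv (x y).
  by apply/funext => y; exact: Phi_snd_liftE.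
apply: is_vderiveD; first exact: is_vderiveZ (is_cderive_real is_derive_coshS_musq) (is_vderive_conj is_vderive_lift_fst).
exact: is_vderiveZ is_cderive_i_sinhS (is_vderive_conj is_vderive_lift_snd).
Qed.

Lemma lift_herm y : herm (x y) (z y) = 0.
Proof. exact: lift_dot. Qed.

Lemma lift_dherm : herm (x x0) dz + herm dx (z x0) = 0.
Proof.
apply: is_cderive_uniq (is_vderive_dot is_vderive_lift_snd (is_vderive_conj is_vderive_lift_fst)) _.
have -> : (fun y => herm (x y) (z y)) = fun=> 0.
  by apply/funext => y; exact: lift_herm.
exact: is_cderive_cst.
Qed.

(** The first two terms of [eta] have the common denominator
    [|Z|^2 = |W|^2] and are real by [Phi_form]; the last one is the
    logarithmic derivative of the squared norm of [lift_fst]. *)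
Lemma Phi_dlog_real : complex.Re (herm dz (x x0)) = 0 ->
  exists DZ DW, [/\ is_vderive x0 v Z DZ, is_vderive x0 v W DW &
    (eta (Z x0) (W x0) DZ DW)^* = eta (Z x0) (W x0) DZ DW].
Proof.
move=> H0; exists DZ, DW; split; [exact: is_vderive_Phi_fst|exact: is_vderive_Phi_snd|rewrite /eta].
have F := Phi_form (Phi_fst_liftE x0) (Phi_snd_liftE x0) (erefl DZ) (erefl DW) (lift_herm x0) lift_dherm H0.
have PE : herm (Z x0) (Z x0) = herm (W x0) (W x0) by rewrite Phi_fst_herm Phi_snd_herm.
have D1 : dot DZ (W x0) + dot (Z x0) DW = herm dz (z x0) + herm (z x0) dz.
  rewrite addrC [RHS]addrC; apply: is_cderive_uniq (is_vderive_dot is_vderive_Phi_fst is_vderive_Phi_snd) _.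
  have -> : (fun y => dot (Z y) (W y)) = fun y => herm (z y) (z y).
    by apply/funext => y; exact: Phi_dot.
  exact: is_vderive_dot is_vderive_lift_fst (is_vderive_conj is_vderive_lift_fst).
have D2 : dot (Z x0) (W x0) = herm (z x0) (z x0) := Phi_dot _.
rewrite D1 D2 -PE -mulrDl.
rewrite conjcD conjcN !conjcM F !conjc_inv !herm_real conjcD !hermC.
by rewrite [herm (z x0) dz + _]addrC.
Qed.

(** In affine coordinates a vanishing derivative only says that the
    derivatives of [Phi_fst] and [Phi_snd] are proportional to these vectors,
    which is what [Phi_kernel] assumes.  Then both lifts are stationary, and
    they determine [e]. *)
Lemma Phi_immersive (jk : 'I_n.+1 * 'I_n.+1) :
  cdom (calM_chart R jk) (Phi (cinv (TCP_chart R i) (e x0))) ->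
  'D_v (fun y => coord (calM_chart R jk) (Phi (cinv (TCP_chart R i) (e y)))) x0 = 0 ->
  'D_v e x0 = 0.
Proof.
move=> hd D0; have [_ sP] := Phi_smooth hd; move/Phi_cdom: hd => [h1 h2].
have dP := smooth_near_differentiable sP.
have [d1 _] := derive_linear_post v (@fst_linear _ _ _) (@fst_cont _ _ _) dP.
have [d2 _] := derive_linear_post v (@snd_linear _ _ _) (@snd_cont _ _ _) dP.
have key (j : 'I_n.+1) (Y : E -> Cn1) DY (F : E -> ECn) : is_vderive x0 v Y DY -> Y x0 0 j != 0 ->
    (forall y, F y = realify (affine j (Y y))) -> differentiable F x0 ->
    'D_v F x0 = 0 -> DY = (DY 0 j / Y x0 0 j) *: Y x0.
  move=> hY Yj FE dF F0.
  have K1 := is_vderive_complexify v dF; rewrite F0 in K1.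
  have K2 := is_vderive_affine hY Yj.
  have K3 : daffine j (Y x0) DY = complexify 0.
    apply: is_vderive_uniq K2 _; have -> // : (fun y => affine j (Y y)) = fun y => complexify (F y).
    by apply/funext => y; rewrite FE realifyK.
  apply: (@rowP_lift _ _ j) => [|k]; rewrite mxE; first by rewrite divfK.
  have := congr1 (fun M : 'rV[C]_n => M 0 k) K3; rewrite !mxE /=.
  move/eqP; rewrite mulf_eq0 invr_eq0 sqrf_eq0 (negPf Yj) orbF subr_eq0 => /eqP h.
  by apply: (mulIf Yj); rewrite h mulrAC divfK// mulrC.
have EZ : DZ = (DZ 0 jk.1 / Z x0 0 jk.1) *: Z x0.
  apply: (key _ _ _ (fun y => (coord (calM_chart R jk) (Phi (cinv (TCP_chart R i) (e y)))).1)) => //.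
  - exact: is_vderive_Phi_fst.
  - by move=> y; rewrite Phi_coord.
  - by rewrite derive_fst// D0.
have EW : DW = (DW 0 jk.2 / W x0 0 jk.2) *: W x0.
  apply: (key _ _ _ (fun y => (coord (calM_chart R jk) (Phi (cinv (TCP_chart R i) (e y)))).2)) => //.
  - exact: is_vderive_Phi_snd.
  - by move=> y; rewrite Phi_coord.
  - by rewrite derive_snd// D0.
have pyth y : (coshS (t y))%:C ^+ 2 * herm (z y) (z y) -
    (sinhS (t y))%:C ^+ 2 * herm (x y) (x y) = herm (z y) (z y).
  by have := Phi_pyth (Blift i (e y)); rewrite -musq_cosh -musq_sinhc.
have hzz := is_vderive_dot is_vderive_lift_fst (is_vderive_conj is_vderive_lift_fst).
have hxx := is_vderive_dot is_vderive_lift_snd (is_vderive_conj is_vderive_lift_snd).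
have [dz0 dx0] : dz = 0 /\ dx = 0.
  apply: (Phi_kernel (Phi_fst_liftE x0) (Phi_snd_liftE x0) (erefl DZ) (erefl DW) (i := i) _ _ _ _ _ _ _ _ _ _ _ _ _ EZ EW).
  - exact: lift_fst_id.
  - exact: insert_id.
  - by rewrite (musq_cosh (Blift i (e x0))) cosh_neq0.
  - by rewrite (musq_sinhc (Blift i (e x0))) rC_neq0 gt_eqF ?sinhc_gt0.
  - exact: pyth.
  - apply: (is_cderive_uniq _ hzz).
    have -> : (fun y => herm (z y) (z y)) = fun y => (coshS (t y))%:C ^+ 2 * herm (z y) (z y) -
      (sinhS (t y))%:C ^+ 2 * herm (x y) (x y) by apply/funext => y; rewrite pyth.
    have c1 := is_cderive_real is_derive_coshS_musq; have s1 := is_cderive_real is_derive_sinhS_musq.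
    have := is_cderiveD (is_cderiveM (is_cderiveM c1 c1) hzz) (is_cderiveN (is_cderiveM (is_cderiveM s1 s1) hxx)).
    by congr (is_cderive _ _ _ _); ring.
  - apply: is_cderive_uniq (is_vderive_dot is_vderive_Phi_fst is_vderive_Phi_snd) _.
    have -> : (fun y => dot (Z y) (W y)) = fun y => herm (z y) (z y).
      by apply/funext => y; exact: Phi_dot.
    exact: hzz.
  - exact: Phi_dot.
  - exact: lift_fst_herm_neq0.
  - by rewrite dot_conjv_eq0 Phi_fst_neq0.
  - by rewrite Phi_fst_herm Phi_snd_herm.
  - apply: is_cderive_uniq (is_vderive_dot is_vderive_Phi_fst (is_vderive_conj is_vderive_Phi_fst)) _.
    have -> : (fun y => herm (Z y) (Z y)) = fun y => herm (W y) (W y).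
      by apply/funext => y; rewrite Phi_fst_herm Phi_snd_herm.
    exact: is_vderive_dot is_vderive_Phi_snd (is_vderive_conj is_vderive_Phi_snd).
  - rewrite /dc => /eqP; rewrite mulf_eq0 (musq_sinhc (Blift i (e x0))).
    rewrite mulf_eq0 invr_eq0 pnatr_eq0 orbF gt_eqF ?sinhc_gt0//= => /eqP dt0.
    by rewrite /ds dt0 mulr0.
have de := smooth_near_differentiable se.
have insert0 (w : ECn) : insert i 0 (complexify w) = 0 -> w = 0.
  move=> H; rewrite -[LHS]complexifyK (_ : complexify w = 0).
    by rewrite /realify; congr pair; apply/rowP => k; rewrite !mxE.
  apply/rowP => k; have := congr1 (fun M : Cn1 => M 0 (lift i k)) H.
  by rewrite insert_lift !mxE.
have E1 : ('D_v e x0).1 = 0 := insert0 _ dz0.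
have E2 : ('D_v e x0).2 = 0.
  apply: insert0; rewrite -derive_snd//.
  have [de2 _] := derive_linear_post v (@snd_linear _ _ _) (@snd_cont _ _ _) de.
  have K1 := is_vderive_insert i 0 (is_vderive_complexify v de2).
  apply: is_vderive_uniq K1 _.
  have -> : (fun y => insert i 0 (complexify (e y).2)) = fun y => x y + (- x y 0 i) *: z y.
    apply/funext => y.
    have z1 : z y 0 i = 1 := lift_fst_id i (e y).
    have b2 : daffine i (z y) (x y) = complexify (e y).2.
      by rewrite /x /lift_snd daffine_hproj daffine_insert.
    have zy0 : z y 0 i != 0 by rewrite z1 oner_neq0.
    rewrite -b2 insert_daffine// z1.
    by rewrite invr1 scale1r expr1n divr1 scaleNr.
  have := is_vderiveD is_vderive_lift_snd (is_vderiveZ (is_cderiveN (is_vderive_lift_snd i)) is_vderive_lift_fst).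
  by rewrite dx0 dz0 scaler0 !add0r mxE oppr0 scale0r.
by case: ('D_v e x0) E1 E2 => a b /= -> ->.
Qed.

End PhiChart.

(** * The form i ddbar F in real coordinates *)

Section OmegaAlgebra.
Variables (R : realType) (N : nat).
Local Notation C := R[i].
Variables (h00 h01 h10 h11 : 'I_N -> 'I_N -> R).
Hypothesis s00 : forall p q, h00 p q = h00 q p.
Hypothesis s11 : forall p q, h11 p q = h11 q p.
Hypothesis s01 : forall p q, h01 p q = h10 q p.

(** Let [X = dG(w)] and [Y = dG(v)].  This is the Hessian part of the
    derivative along [v] of [dF(i dG(w))], where [h00], [h01], [h10] and [h11]
    are the blocks of the Hessian of [F] in the real basis formed by the
    vectors [e_p] and [i e_p]. *)
Definition dtheta (X Y : 'I_N -> C) : R := \sum_q \sum_p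
  (complex.Re (X q) * (complex.Re (Y p) * h01 p q + complex.Im (Y p) * h11 p q)
 - complex.Im (X q) * (complex.Re (Y p) * h00 p q + complex.Im (Y p) * h10 p q)).

Lemma dthetaE (X Y : 'I_N -> C) : dtheta X Y = \sum_q
  (complex.Re (X q) * (\sum_p (complex.Re (Y p) * h01 p q + complex.Im (Y p) * h11 p q))
 - complex.Im (X q) * (\sum_p (complex.Re (Y p) * h00 p q + complex.Im (Y p) * h10 p q))).
Proof. by apply: eq_bigr => q _; rewrite sumrB -!mulr_sumr. Qed.

(** By symmetry of the Hessian the sum is a multiple of
    [dtheta Y X - dtheta X Y]. *)
Lemma ddbar_dtheta (X Y : 'I_N -> C) : dtheta X Y = dtheta Y X ->
  \sum_p \sum_q
   (((h00 p q)%:C + 'i * (h01 p q)%:C) / 2 - 'i * (((h10 p q)%:C + 'i * (h11 p q)%:C) / 2)) / 2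
   * (X p * (Y q)^* - Y p * (X q)^*) = 0.
Proof.
move=> H.
pose M p q : C := (((h00 p q)%:C + 'i * (h01 p q)%:C) / 2 - 'i * (((h10 p q)%:C + 'i * (h11 p q)%:C) / 2)) / 2.
pose T p q : R := (h00 p q + h11 p q) *
    (complex.Im (X p) * complex.Re (Y q) - complex.Re (X p) * complex.Im (Y q)) +
  (h01 p q - h10 p q) *
    (complex.Re (X p) * complex.Re (Y q) + complex.Im (X p) * complex.Im (Y q)).
have E1 : \sum_p \sum_q M p q * (X p * (Y q)^* - Y p * (X q)^*) =
    \sum_p \sum_q (M p q * (X p * (Y q)^*) - M q p * (Y q * (X p)^*)).
  transitivity (\sum_p \sum_q M p q * (X p * (Y q)^*) -
                \sum_p \sum_q M p q * (Y p * (X q)^*)).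
    rewrite -sumrB; apply: eq_bigr => p _; rewrite -sumrB; apply: eq_bigr => q _.
    by rewrite mulrBr.
  rewrite [X in _ - X]exchange_big /=.
  by rewrite -sumrB; apply: eq_bigr => p _; rewrite -sumrB.
have E2 p q : M p q * (X p * (Y q)^*) - M q p * (Y q * (X p)^*) = 'i / 2 * (T p q)%:C.
  rewrite /M /T (s00 q p) (s11 q p) (s01 q p) -(s01 p q).
  have cE (w : C) : w = (complex.Re w)%:C + 'i * (complex.Im w)%:C.
    by rewrite [LHS]complexE complexiE.
  have cJ (w : C) : w^* = (complex.Re w)%:C - 'i * (complex.Im w)%:C.
    by rewrite {1}[w]cE conjcD conjcM !conjc_rc conjc_i mulNr.
  rewrite (cJ (X p)) (cJ (Y q)) [X p in LHS]cE [Y q in LHS]cE.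
  move: (complex.Re (X p)) (complex.Im (X p)) (complex.Re (Y q)) (complex.Im (Y q)) => a b c d.
  rewrite !(rmorphD, rmorphB, rmorphM) /=.
  have i2 := sqrc_i R.
  by field: i2.
have E3 : \sum_p \sum_q T p q = 0.
  transitivity (dtheta Y X - dtheta X Y); last by rewrite H subrr.
  rewrite {2}/dtheta /dtheta.
  rewrite (exchange_big _ _ _ _ _ (fun q p => complex.Re (Y q) * (complex.Re (X p) * h01 p q + complex.Im (X p) * h11 p q)
 - complex.Im (Y q) * (complex.Re (X p) * h00 p q + complex.Im (X p) * h10 p q))) /=.
  rewrite -sumrB; apply: eq_bigr => p _; rewrite -sumrB; apply: eq_bigr => q _.
  rewrite /T (s00 q p) (s11 q p) (s01 q p) -(s01 p q).
  ring.
rewrite -/(M _ _) E1.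
under eq_bigr do under eq_bigr do rewrite E2.
under eq_bigr do rewrite -mulr_sumr.
rewrite -mulr_sumr; under eq_bigr do rewrite -rmorph_sum.
by rewrite -rmorph_sum E3 rmorph0 mulr0.
Qed.

End OmegaAlgebra.

Section Potential.
Variables (R : realType) (n : nat).
Local Notation C := R[i].
Local Notation ECn := ('rV[R]_n * 'rV[R]_n)%type.
Local Notation E2 := (ECn * ECn)%type.

Definition realify2 (u : 'rV[C]_(n + n)) : E2 :=
  (realify (lsubmx u), realify (rsubmx u)).

Lemma realify2K : cancel realify2 (@complexify2 R n).
Proof. by move=> u; rewrite /complexify2 !realifyK hsubmxK. Qed.

Lemma complexify2K : cancel (@complexify2 R n) realify2.
Proof. by move=> [a b]; rewrite /realify2 row_mxKl row_mxKr !complexifyK. Qed.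

Lemma complexify_linear m (s : R) (a b : 'rV[R]_m * 'rV[R]_m) :
  complexify (s *: a + b) = s%:C *: complexify a + complexify b.
Proof.
apply/rowP => k; rewrite !mxE /=; apply/eqP.
by rewrite eq_complex /= !mul0r subr0 addr0 !eqxx.
Qed.

Lemma complexify2_linear (s : R) (a b : E2) :
  complexify2 (s *: a + b) = s%:C *: complexify2 a + complexify2 b.
Proof. by rewrite /complexify2 /= !complexify_linear scale_row_mx add_row_mx. Qed.

Lemma realify2_linear (s : R) (u v : 'rV[C]_(n + n)) :
  realify2 (s%:C *: u + v) = s *: realify2 u + realify2 v.
Proof.
by apply: (can_inj complexify2K); rewrite complexify2_linear !realify2K.
Qed.

Lemma realify2_0 : realify2 0 = 0.
Proof.
by have := realify2_linear (-1) 0 0; rewrite scaler0 addr0 scaleN1r addNr.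
Qed.

Lemma realify2_sum I (r : seq I) (c : I -> R) (u : I -> 'rV[C]_(n + n)) :
  realify2 (\sum_(i <- r) (c i)%:C *: u i) = \sum_(i <- r) c i *: realify2 (u i).
Proof.
elim: r => [|i r IH]; first by rewrite !big_nil realify2_0.
by rewrite !big_cons realify2_linear IH.
Qed.

Definition basis_re (q : 'I_(n + n)) : E2 := realify2 (delta_mx 0 q).
Definition basis_im (q : 'I_(n + n)) : E2 := realify2 ('i *: delta_mx 0 q).

Lemma basis_expansion (u : 'rV[C]_(n + n)) : realify2 u =
  \sum_q (complex.Re (u 0 q) *: basis_re q + complex.Im (u 0 q) *: basis_im q).
Proof.
rewrite big_split /= -!realify2_sum -[X in X + _]scale1r -realify2_linear.
congr realify2; rewrite scale1r -big_split /= [LHS]row_sum_delta.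
apply: eq_bigr => q _.
by rewrite scalerA -scalerDl mulrC -complexE.
Qed.

Lemma derive_basis (F : E2 -> R) (e : E2) (u : 'rV[C]_(n + n)) : differentiable F e ->
  'D_(realify2 u) F e = \sum_q (complex.Re (u 0 q) * 'D_(basis_re q) F e +
                                complex.Im (u 0 q) * 'D_(basis_im q) F e).
Proof.
move=> dF; rewrite deriveE // basis_expansion linear_sum.
by apply: eq_bigr => q _; rewrite linearD !linearZ !deriveE.
Qed.

(** Turns the complex directional derivatives in the Wirtinger operators into
    real ones. *)
Lemma dirderivE (F : 'rV[C]_(n + n) -> C) (Fr : E2 -> C) (w : 'rV[C]_(n + n)) e :
  (forall e, F (complexify2 e) = Fr e) ->
  dirderiv w F (complexify2 e) = cderive (realify2 w) Fr e.
Proof.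
move=> FE; rewrite /dirderiv.
have -> : (fun s : R => F (complexify2 e + s%:C *: w)) =
   fun s => Fr (s *: realify2 w + e).
  by apply/funext => s; rewrite -FE complexify2_linear realify2K addrC.
rewrite /cderiv /cderive !derive1E.
by rewrite (derive_line (fun y => complex.Re (Fr y))) (derive_line (fun y => complex.Im (Fr y))).
Qed.

Lemma cderive_real (Fr : E2 -> R) w e : cderive w (fun e => (Fr e)%:C) e = ('D_w Fr e)%:C.
Proof. by rewrite /cderive /= derive_cst. Qed.

Lemma dzbarE (F : 'rV[C]_(n + n) -> C) (Fr : E2 -> R) q e :
  (forall e, F (complexify2 e) = (Fr e)%:C) ->
  dzbar q F (complexify2 e) = (('D_(basis_re q) Fr e)%:C + 'i * ('D_(basis_im q) Fr e)%:C) / 2.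
Proof. by move=> FE; rewrite /dzbar !(dirderivE _ _ FE) !cderive_real. Qed.

Lemma dz_dzbarE (F : 'rV[C]_(n + n) -> C) (Fr : E2 -> R) p q e :
  (forall e, F (complexify2 e) = (Fr e)%:C) -> smooth_near e Fr ->
  let h v w := ('D_v (fun e => 'D_w Fr e) e)%:C in
  dz p (dzbar q F) (complexify2 e) =
  ((h (basis_re p) (basis_re q) + 'i * h (basis_re p) (basis_im q)) / 2 -
   'i * ((h (basis_im p) (basis_re q) + 'i * h (basis_im p) (basis_im q)) / 2)) / 2.
Proof.
move=> FE sF h.
have isDr v w : is_cderive e v (fun e => ('D_w Fr e)%:C) (h v w).
  apply: is_cderive_real; apply/DeriveDef => //.
  exact/diff_derivable/smooth_near_differentiable/smooth_near_derive.
have D v : cderive v (fun e => (('D_(basis_re q) Fr e)%:C + 'i * ('D_(basis_im q) Fr e)%:C) / 2) e =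
    (h v (basis_re q) + 'i * h v (basis_im q)) / 2.
  apply: is_cderive_val.
  have := is_cderiveM (is_cderiveD (isDr v (basis_re q)) (is_cderiveM (is_cderive_cst e v 'i) (isDr v (basis_im q))))
    (is_cderive_cst e v 2^-1).
  by rewrite mulr0 add0r mul0r addr0.
by rewrite /dz !(dirderivE _ _ (fun e => dzbarE q e FE)) !D.
Qed.

Lemma is_vderive_complexify2 (E : normedModType R) (x v : E) (G : E -> E2) :
  differentiable G x -> is_vderive x v (fun y => complexify2 (G y)) (complexify2 ('D_v G x)).
Proof.
move=> dG.
have [d1 _] := derive_linear_post v (@fst_linear _ _ _) (@fst_cont _ _ _) dG.
have [d2 _] := derive_linear_post v (@snd_linear _ _ _) (@snd_cont _ _ _) dG.
move=> k; case: (split_ordP k) => l ->.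
  under eq_fun do rewrite row_mxEl; rewrite row_mxEl -derive_fst//.
  exact: is_vderive_complexify.
under eq_fun do rewrite row_mxEr; rewrite row_mxEr -derive_snd//.
exact: is_vderive_complexify.
Qed.

Lemma csmooth_complexify2 (E : normedModType R) (x : E) (G : E -> E2) k :
  smooth_near x G -> csmooth x (fun y => complexify2 (G y) 0 k).
Proof.
move=> /smooth_near_pair [s1 s2]; case: (split_ordP k) => l ->.
  by under eq_fun do rewrite row_mxEl; exact: smooth_near_complexify.
by under eq_fun do rewrite row_mxEr; exact: smooth_near_complexify.
Qed.

Section Closed.
Variables (E : normedModType R) (G : E -> E2) (Fr : E2 -> R) (u0 : E).
Hypothesis sG : smooth_near u0 G.
Hypothesis sF : smooth_near (G u0) Fr.

Let h v w := 'D_v (fun e => 'D_w Fr e) (G u0).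
Let X (v u : E) q := complexify2 ('D_v G u) 0 q.

Lemma chart_cderive_near v : \forall u \near u0, forall q,
  X v u q = cderive v (fun y => complexify2 (G y) 0 q) u.
Proof.
have := smooth_near_near sG; apply: filterS => u su q.
by apply/esym/is_cderive_val/is_vderive_complexify2/smooth_near_differentiable.
Qed.

Lemma csmooth_chart_derive v q : csmooth u0 (fun u => X v u q).
Proof. by apply: csmooth_complexify2; exact: smooth_near_derive. Qed.

Lemma chart_derive_symm v w q : cderive v (fun u => X w u q) u0 = cderive w (fun u => X v u q) u0.
Proof.
have XE a b : cderive a (fun u => X b u q) u0 =
    cderive a (fun u => cderive b (fun y => complexify2 (G y) 0 q) u) u0.
  have N := chart_cderive_near b.
  by rewrite /cderive; congr (_ +i* _); apply: near_eq_derive;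
    apply: filterS N => u ->.
have [s1 s2] := csmooth_complexify2 q sG.
rewrite !XE; exact: (congr2 (@Complex R) (derive_comm v w s1) (derive_comm v w s2)).
Qed.

Lemma differentiable_F_near : \forall u \near u0, differentiable Fr (G u).
Proof.
have cG := smooth_near_continuous sG.
have N : \forall u \near u0, smooth_near (G u) Fr := cG _ (smooth_near_near sF).
by apply: filterS N => u /smooth_near_differentiable.
Qed.

(** The second derivatives of [G] appear paired with [dF], those of [F] form
    [dtheta]. *)
Lemma dc_derivative v w :
  (\forall u \near u0, 'D_(realify2 ('i *: complexify2 ('D_w G u))) Fr (G u) = 0) ->
  \sum_q (complex.Re (cderive v (fun u => X w u q) u0) * 'D_(basis_im q) Fr (G u0) -
          complex.Im (cderive v (fun u => X w u q) u0) * 'D_(basis_re q) Fr (G u0)) +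
  dtheta (fun p q => h (basis_re p) (basis_re q)) (fun p q => h (basis_re p) (basis_im q))
         (fun p q => h (basis_im p) (basis_re q)) (fun p q => h (basis_im p) (basis_im q))
     (X w u0) (X v u0) = 0.
Proof.
move=> T0.
have T1 : \forall u \near u0, 0 = \sum_q (complex.Re (X w u q) * 'D_(basis_im q) Fr (G u) -
    complex.Im (X w u q) * 'D_(basis_re q) Fr (G u)).
  have ND := differentiable_F_near.
  near=> u; have du : differentiable Fr (G u) by near: u.
  transitivity ('D_(realify2 ('i *: complexify2 ('D_w G u))) Fr (G u)).
    by apply/esym; near: u.
  rewrite [LHS](derive_basis _ du).
  have Phi_fst_liftE q : ('i *: complexify2 ('D_w G u)) 0 q = 'i * X w u q by rewrite mxE.
  apply: eq_bigr => q _; rewrite Phi_fst_liftE ReM ImM.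
  have [-> ->] : complex.Re ('i : C) = 0 /\ complex.Im ('i : C) = 1 by [].
  by rewrite !mul0r sub0r !mul1r add0r mulNr addrC.
have dG := smooth_near_differentiable sG.
pose k b := \sum_p (complex.Re (X v u0 p) * h (basis_re p) b + complex.Im (X v u0 p) * h (basis_im p) b).
have HE b : 'D_('D_v G u0) (fun e => 'D_b Fr e) (G u0) = k b.
  have dD := smooth_near_differentiable (smooth_near_derive b sF).
  have := derive_basis (complexify2 ('D_v G u0)) dD.
  by rewrite complexify2K.
have DF b : is_derive u0 v (fun u => 'D_b Fr (G u)) (k b).
  have dD := smooth_near_differentiable (smooth_near_derive b sF).
  have [a1 a2] := derive_chain (f := fun e => 'D_b Fr e) v dG dD.
  by apply: DeriveDef; [exact: diff_derivable|rewrite a2 HE].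
have DX q : is_cderive u0 v (fun u => X w u q) (cderive v (fun u => X w u q) u0).
  by apply: csmooth_is_cderive; exact: csmooth_chart_derive.
have DT : is_derive u0 v (fun u => \sum_q (complex.Re (X w u q) * 'D_(basis_im q) Fr (G u) -
    complex.Im (X w u q) * 'D_(basis_re q) Fr (G u)))
  (\sum_q ((complex.Re (X w u0 q) * k (basis_im q) +
    'D_(basis_im q) Fr (G u0) * complex.Re (cderive v (fun u => X w u q) u0)) -
   (complex.Im (X w u0 q) * k (basis_re q) +
    'D_(basis_re q) Fr (G u0) * complex.Im (cderive v (fun u => X w u q) u0)))).
  rewrite (_ : (fun u => _) = \sum_q (fun u => complex.Re (X w u q) * 'D_(basis_im q) Fr (G u) -
    complex.Im (X w u q) * 'D_(basis_re q) Fr (G u))); last first.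
    by apply/funext => u; rewrite fct_sumE.
  apply: is_derive_sum => q; have [r1 r2] := DX q.
  apply: is_deriveB; apply: is_derive_mul => //; exact: DF.
have D0 := near_eq_is_derive T1 (is_derive_cst 0 u0 v).
have E0 : forall a b, is_derive u0 v (fun u => \sum_q (complex.Re (X w u q) * 'D_(basis_im q) Fr (G u) -
    complex.Im (X w u q) * 'D_(basis_re q) Fr (G u))) a ->
  is_derive u0 v (fun u => \sum_q (complex.Re (X w u q) * 'D_(basis_im q) Fr (G u) -
    complex.Im (X w u q) * 'D_(basis_re q) Fr (G u))) b -> a = b.
  by move=> a b [_ <-] [_ <-].
rewrite [RHS](E0 _ _ D0 DT) dthetaE -big_split /=; apply: eq_bigr => q _.
have aux (a b c d m l r s : R) :
    a * b - c * d + (m * l - r * s) = m * l + b * a - (r * s + d * c) by ring.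
exact: aux.
Unshelve. all: by end_near. Qed.

(** The terms with second derivatives of [G] are the same after exchanging
    [v] and [w]. *)
Lemma dc_closed v w :
  (forall s, \forall u \near u0, 'D_(realify2 ('i *: complexify2 ('D_s G u))) Fr (G u) = 0) ->
  dtheta (fun p q => h (basis_re p) (basis_re q)) (fun p q => h (basis_re p) (basis_im q))
         (fun p q => h (basis_im p) (basis_re q)) (fun p q => h (basis_im p) (basis_im q))
     (X w u0) (X v u0) =
  dtheta (fun p q => h (basis_re p) (basis_re q)) (fun p q => h (basis_re p) (basis_im q))
         (fun p q => h (basis_im p) (basis_re q)) (fun p q => h (basis_im p) (basis_im q))
     (X v u0) (X w u0).
Proof.
move=> H; have A := dc_derivative v (H w); have B := dc_derivative w (H v).
have SE : \sum_q (complex.Re (cderive v (fun u => X w u q) u0) * 'D_(basis_im q) Fr (G u0) -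
          complex.Im (cderive v (fun u => X w u q) u0) * 'D_(basis_re q) Fr (G u0)) =
  \sum_q (complex.Re (cderive w (fun u => X v u q) u0) * 'D_(basis_im q) Fr (G u0) -
          complex.Im (cderive w (fun u => X v u q) u0) * 'D_(basis_re q) Fr (G u0)).
  by apply: eq_bigr => q _; rewrite (chart_derive_symm v w q).
apply: (addrI (\sum_q (complex.Re (cderive v (fun u => X w u q) u0) * 'D_(basis_im q) Fr (G u0) -
          complex.Im (cderive v (fun u => X w u q) u0) * 'D_(basis_re q) Fr (G u0)))).
by rewrite [LHS]A SE [RHS]B.
Qed.

(** The differential of a 1-form with vanishing pullback has vanishing
    pullback; here the 1-form is [X |-> dF(i X)]. *)
Lemma ddbar_closed (F : 'rV[C]_(n + n) -> C) v w :
  (forall e, F (complexify2 e) = (Fr e)%:C) ->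
  (forall s, \forall u \near u0, 'D_(realify2 ('i *: complexify2 ('D_s G u))) Fr (G u) = 0) ->
  i_ddbar F (complexify2 (G u0)) (complexify2 ('D_v G u0)) (complexify2 ('D_w G u0)) = 0.
Proof.
move=> FE H; rewrite /i_ddbar.
rewrite (_ : \sum_p _ = 0) ?mulr0//.
under eq_bigr do under eq_bigr do rewrite (dz_dzbarE _ _ FE sF) /=.
apply: (@ddbar_dtheta R (n + n) _ _ _ _ _ _ _ (X v u0) (X w u0)).
- by move=> p q; exact: derive_comm.
- by move=> p q; exact: derive_comm.
- by move=> p q; exact: derive_comm.
- exact: dc_closed.
Qed.

End Closed.

End Potential.

(** * The Stenzel potential *)

Section StenzelPotential.
Variables (R : realType) (n : nat).
Local Notation C := R[i].
Local Notation Cn1 := 'rV[C]_n.+1.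
Local Notation ECn := ('rV[R]_n * 'rV[R]_n)%type.
Local Notation E2 := (ECn * ECn)%type.
Local Notation herm x y := (dot x (conjv y)).

Lemma normc_sqr (a : C) : (Normc.normc a ^+ 2)%:C = a * a^*.
Proof.
case: a => x y /=; rewrite sqr_sqrtr ?addr_ge0 ?sqr_ge0//.
by apply/eqP; rewrite eq_complex /=; apply/andP; split; apply/eqP; ring.
Qed.

Lemma calNE (z w : Cn1) :
  (calN z w)%:C = herm z z * herm w w / (dot z w * (dot z w)^*).
Proof.
rewrite /calN rmorphM fmorphV /= normc_sqr; congr (_ / _).
rewrite rmorph_sum mulr_suml; apply: eq_bigr => j _.
rewrite rmorph_sum mulr_sumr; apply: eq_bigr => k _.
rewrite [LHS]normc_sqr conjcM !conjvE; ring.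
Qed.

Lemma calN_gt0 (z w : Cn1) : z != 0 -> w != 0 -> dot z w != 0 -> 0 < calN z w.
Proof.
move=> z0 w0 zw0.
have pos (x : Cn1) : x != 0 -> 0 < herm x x.
  move=> x0; rewrite lt_def dot_conjv_eq0 x0 /= [leRHS]herm_Re.
  by rewrite ler0c herm_ge0.
rewrite -ltcR calNE rmorph0; apply: divr_gt0.
  by rewrite mulr_gt0// pos.
rewrite -normc_sqr -[0]/(0%:C) ltcR exprn_gt0// lt_def.
rewrite (_ : 0 <= _); last by case: (dot z w) => a b; exact: sqrtr_ge0.
by rewrite andbT; apply: contra zw0 => /eqP /Normc.eq0_normc ->.
Qed.

Variables (ij : 'I_n.+1 * 'I_n.+1).
Let z (e : E2) : Cn1 := insert ij.1 1 (complexify e.1).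
Let w (e : E2) : Cn1 := insert ij.2 1 (complexify e.2).
Let dz (X : E2) : Cn1 := insert ij.1 0 (complexify X.1).
Let dw (X : E2) : Cn1 := insert ij.2 0 (complexify X.2).

Definition stenzelR (f : R -> R) (e : E2) : R := f (calN (z e) (w e)).

Lemma stenzelRE f e : stenzel_potential f ij (complexify2 e) = (stenzelR f e)%:C.
Proof. by rewrite /stenzel_potential /complexify2 row_mxKl row_mxKr. Qed.

Lemma is_vderive_fst_insert e X : is_vderive e X z (dz X).
Proof.
apply: is_vderive_insert.
have [d1 dE] := linear_diff e (@fst_linear R ECn ECn) (@fst_cont R ECn ECn).
by have := is_vderive_complexify X d1; rewrite deriveE// dE.
Qed.

Lemma is_vderive_snd_insert e X : is_vderive e X w (dw X).
Proof.
apply: is_vderive_insert.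
have [d1 dE] := linear_diff e (@snd_linear R ECn ECn) (@snd_cont R ECn ECn).
by have := is_vderive_complexify X d1; rewrite deriveE// dE.
Qed.

Lemma calN_is_cderive e X : dot (z e) (w e) != 0 ->
  let q := eta (z e) (w e) (dz X) (dw X) in
  is_cderive e X (fun e => (calN (z e) (w e))%:C) ((calN (z e) (w e))%:C * (q + q^*)).
Proof.
move=> zw0 q.
have zz : herm (z e) (z e) != 0 by rewrite dot_conjv_eq0 insert_neq0.
have ww : herm (w e) (w e) != 0 by rewrite dot_conjv_eq0 insert_neq0.
have hz := is_vderive_fst_insert e X; have hw := is_vderive_snd_insert e X.
have hzz := is_vderive_dot hz (is_vderive_conj hz).
have hww := is_vderive_dot hw (is_vderive_conj hw).
have hzw := is_vderive_dot hz hw.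
have zwc : (dot (z e) (w e))^* != 0 by rewrite conjc_eq0.
have den0 : dot (z e) (w e) * (dot (z e) (w e))^* != 0 by rewrite mulf_neq0.
have H := is_cderiveM (is_cderiveM hzz hww) (is_cderiveV den0 (is_cderiveM hzw (is_cderive_conj hzw))).
rewrite (_ : (fun e => (calN (z e) (w e))%:C) = fun e =>
   herm (z e) (z e) * herm (w e) (w e) / (dot (z e) (w e) * (dot (z e) (w e))^*)); last first.
  by apply/funext => e'; rewrite calNE.
move: H; congr (is_cderive _ _ _ _).
rewrite calNE /q /eta !(conjcD, conjcN, conjcM, conjc_inv, herm_real).
rewrite -(hermC (dz X)) -(hermC (dw X)).
move: zz ww zw0 zwc.
move: (herm (z e) (z e)) (herm (w e) (w e)) (herm (dz X) (z e)) (herm (dw X) (w e)) => P Q a b.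
move: (dot (z e) (w e)) (dot (dz X) (w e)) (dot (z e) (dw X)) => D c d P0 Q0 D0 Dc0.
by field; rewrite P0 Q0 D0 Dc0.
Qed.

Lemma calN_smooth e : dot (z e) (w e) != 0 ->
  smooth_near e (fun e => calN (z e) (w e)).
Proof.
move=> zw0.
have sz k : csmooth e (fun e => z e 0 k).
  apply: csmooth_insert => l; apply: smooth_near_complexify.
  by apply: smooth_near_linear; [exact: fst_linear|exact: fst_cont].
have sw k : csmooth e (fun e => w e 0 k).
  apply: csmooth_insert => l; apply: smooth_near_complexify.
  by apply: smooth_near_linear; [exact: snd_linear|exact: snd_cont].
suff [] : csmooth e (fun e => (calN (z e) (w e))%:C) by [].
have -> : (fun e => (calN (z e) (w e))%:C) = fun e =>
   herm (z e) (z e) * herm (w e) (w e) / (dot (z e) (w e) * (dot (z e) (w e))^*).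
  by apply/funext => e'; rewrite calNE.
have szw := csmooth_dot sz sw.
apply: csmoothM.
  by apply: csmoothM; apply: csmooth_dot => // k; apply: csmooth_conjv.
apply: csmoothV; first by apply: csmoothM => //; exact: csmooth_conj.
by rewrite mulf_neq0// conjc_eq0.
Qed.

Section WithPotential.
Variable f : R -> R.
Hypothesis hf : forall x : R, 0 < x -> is_derive x 1 f (Num.sqrt x)^-1.

Lemma open_gt0_set : open [set x : R | 0 < x].
Proof. by rewrite -set_itvoy; exact: interval_open. Qed.

Lemma derive_scalar_dir (g : R -> R) (x v dg : R) : is_derive x 1 g dg ->
  differentiable g x /\ 'D_v g x = v * dg.
Proof.
move=> [g1 g2].
have dgx : differentiable g x by apply/derivable1_diffP.
split=> //; rewrite -g2 !deriveE//.
by rewrite -[X in 'd _ _ X = _]mulr1 -[X in 'd _ _ X = _]/(v *: (1 : R)) linearZ.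
Qed.

Lemma Ck_invsqrt r : Ck r [set x : R | 0 < x] (fun x => (Num.sqrt x)^-1).
Proof.
have D (x : R) : 0 < x -> is_derive x 1 (fun x => (Num.sqrt x)^-1)
    (- (1 / 2) * ((Num.sqrt x)^-1 * x^-1)).
  move=> x0; have s0 : Num.sqrt x != 0 by rewrite gt_eqF ?sqrtr_gt0.
  apply: is_derive_eq (is_derive_inv s0 (is_derive1_sqrt x0)) _.
  have -> : x^-1 = (Num.sqrt x ^+ 2)^-1 by rewrite sqr_sqrtr// ltW.
  by field.
elim: r => [|r IH] /=.
  move=> x x0; apply: differentiable_continuous.
  by have [] := derive_scalar_dir 0 (D x x0).
split=> [x x0|v]; first by have [] := derive_scalar_dir 0 (D x x0).
apply: (Ck_ext (f := fun x : R => v * (- (1 / 2) * ((Num.sqrt x)^-1 * x^-1)))).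
- exact: open_gt0_set.
- by move=> x x0; have [_ ->] := derive_scalar_dir v (D x x0).
- apply: CkM; [exact: open_gt0_set|exact: Ck_cst|].
  apply: CkM; [exact: open_gt0_set|exact: Ck_cst|].
  apply: CkM; [exact: open_gt0_set|exact: IH|].
  by apply: Ck_sub (@Ck_inv R r) => x x0 /=; rewrite gt_eqF.
Qed.

(** The derivative of [f] is prescribed on the positive half line only, and
    there it is a smooth function. *)
Lemma smooth_f (x : R) : 0 < x -> smooth_near x f.
Proof.
move=> x0; exists [set x : R | 0 < x]; split=> //.
case=> [|r] /=.
  move=> y y0; apply: differentiable_continuous.
  by have [] := derive_scalar_dir 0 (hf y0).
split=> [y y0|v]; first by have [] := derive_scalar_dir 0 (hf y0).
apply: (Ck_ext (f := fun x : R => v * (Num.sqrt x)^-1)).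
- exact: open_gt0_set.
- by move=> y y0; have [_ ->] := derive_scalar_dir v (hf y0).
- by apply: CkM; [exact: open_gt0_set|exact: Ck_cst|exact: Ck_invsqrt].
Qed.

Lemma stenzelR_smooth e : dot (z e) (w e) != 0 -> smooth_near e (stenzelR f).
Proof.
move=> zw0; apply: smooth_near_comp1; first exact: calN_smooth.
by apply: smooth_f; apply: calN_gt0 => //; exact: insert_neq0.
Qed.

(** [q + q^*] is the logarithmic derivative of [calN]. *)
Lemma stenzelR_derive0 e X : dot (z e) (w e) != 0 ->
  let q := eta (z e) (w e) (dz X) (dw X) in q + q^* = 0 ->
  'D_X (stenzelR f) e = 0.
Proof.
move=> zw0 q q0; have [+ _] := calN_is_cderive X zw0.
rewrite -/q q0 mulr0 /= => H.
have N0 : 0 < calN (z e) (w e) by apply: calN_gt0 => //; exact: insert_neq0.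
have [_ ->] := @is_derive_comp1 _ _ f (fun y => calN (z y) (w y)) e X _ _ (hf N0) H.
by rewrite mulr0.
Qed.

End WithPotential.

End StenzelPotential.

(** * A primitive of the Stenzel form along Phi *)

Section PhiLagrangian.
Variables (R : realType) (n : nat) (E : normedModType R).
Local Notation C := R[i].
Local Notation Cn1 := 'rV[C]_n.+1.
Local Notation ECn := ('rV[R]_n * 'rV[R]_n)%type.
Local Notation E2 := (ECn * ECn)%type.
Local Notation herm x y := (dot x (conjv y)).
Variables (f : R -> R) (i : 'I_n.+1) (e : E -> E2) (jk : 'I_n.+1 * 'I_n.+1).
Hypothesis hf : forall x : R, 0 < x -> is_derive x 1 f (Num.sqrt x)^-1.

Let G y := coord (calM_chart R jk) (Phi (cinv (TCP_chart R i) (e y))).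
Let Z y := Phi_fst (Blift i (e y)).
Let W y := Phi_snd (Blift i (e y)).

Lemma Phi_chart_dot y : cdom (calM_chart R jk) (Phi (cinv (TCP_chart R i) (e y))) ->
  dot (insert jk.1 1 (complexify (G y).1)) (insert jk.2 1 (complexify (G y).2)) != 0.
Proof.
move=> /Phi_cdom [h1 h2]; rewrite /G Phi_coord /= !realifyK !insert_affine//.
by rewrite dotZl dotZr Phi_dot !mulf_neq0 ?invr_eq0// lift_fst_herm_neq0.
Qed.

Lemma insert0Z (j : 'I_n.+1) (c : C) (a : 'rV[C]_n) : insert j 0 (c *: a) = c *: insert j 0 a.
Proof.
by have := insert_sum_linear j 0 0 a 0 c; rewrite mulr0 !addr0 => ->;
  rewrite (_ : insert j 0 0 = 0) ?addr0//; apply/rowP => k; rewrite !mxE; case: unlift => // l; rewrite mxE.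
Qed.

(** Multiplying the direction by [i] multiplies [eta] by [i].  As [eta] is
    real by [Phi_dlog_real], [eta + conj eta] becomes 0. *)
Lemma Phi_dc_zero y v : smooth_near y e ->
  cdom (calM_chart R jk) (Phi (cinv (TCP_chart R i) (e y))) ->
  complex.Re (herm (insert i 0 (complexify ('D_v e y).1)) (lift_snd i (e y))) = 0 ->
  'D_(realify2 ('i *: complexify2 ('D_v G y))) (stenzelR jk f) (G y) = 0.
Proof.
move=> se hd N; have [_ sG] := Phi_smooth se hd.
have zw0 := Phi_chart_dot hd.
have /Phi_cdom [h1 h2] := hd.
have dG := smooth_near_differentiable sG.
have [DZ [DW [hZ hW th]]] := Phi_dlog_real se N.
have q1 : complexify ('D_v G y).1 = daffine jk.1 (Z y) DZ.
  have [d1 _] := derive_linear_post v (@fst_linear _ _ _) (@fst_cont _ _ _) dG.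
  rewrite -derive_fst//.
  apply: is_vderive_uniq (is_vderive_complexify v d1) _.
  rewrite (_ : (fun y => _) = fun y => affine jk.1 (Z y)).
    exact: is_vderive_affine.
  by apply/funext => y'; rewrite Phi_coord realifyK.
have q2 : complexify ('D_v G y).2 = daffine jk.2 (W y) DW.
  have [d2 _] := derive_linear_post v (@snd_linear _ _ _) (@snd_cont _ _ _) dG.
  rewrite -derive_snd//.
  apply: is_vderive_uniq (is_vderive_complexify v d2) _.
  rewrite (_ : (fun y => _) = fun y => affine jk.2 (W y)).
    exact: is_vderive_affine.
  by apply/funext => y'; rewrite Phi_coord realifyK.
have GE := Phi_coord i e jk y.
have z1 : insert jk.1 1 (complexify (G y).1) = (Z y 0 jk.1)^-1 *: Z y.
  rewrite /G GE; exact: etrans (congr1 (insert jk.1 1) (realifyK _)) (insert_affine h1).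
have w1 : insert jk.2 1 (complexify (G y).2) = (W y 0 jk.2)^-1 *: W y.
  rewrite /G GE; exact: etrans (congr1 (insert jk.2 1) (realifyK _)) (insert_affine h2).
pose U := realify2 ('i *: complexify2 ('D_v G y)).
pose l' := - (DZ 0 jk.1 / Z y 0 jk.1 ^+ 2).
pose m' := - (DW 0 jk.2 / W y 0 jk.2 ^+ 2).
have z2 : insert jk.1 0 (complexify U.1) =
    'i *: ((Z y 0 jk.1)^-1 *: DZ + l' *: Z y).
  rewrite /U realifyK /complexify2 scale_row_mx row_mxKl q1 insert0Z.
  congr (_ *: _); exact: insert_daffineN.
have w2 : insert jk.2 0 (complexify U.2) =
    'i *: ((W y 0 jk.2)^-1 *: DW + m' *: W y).
  rewrite /U realifyK /complexify2 scale_row_mx row_mxKr q2 insert0Z.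
  congr (_ *: _); exact: insert_daffineN.
have ZW0 : dot (Z y) (W y) != 0 by rewrite [dot _ _]Phi_dot lift_fst_herm_neq0.
have l0 : (Z y 0 jk.1)^-1 != 0 by rewrite invr_eq0.
have m0 : (W y 0 jk.2)^-1 != 0 by rewrite invr_eq0.
have Q := eta_scale l' m' DZ DW l0 m0
  (Phi_fst_neq0 (Blift i (e y))) (Phi_snd_neq0 (Blift i (e y))) ZW0.
have qE : eta (insert jk.1 1 (complexify (G y).1)) (insert jk.2 1 (complexify (G y).2))
    (insert jk.1 0 (complexify U.1)) (insert jk.2 0 (complexify U.2)) =
    'i * eta (Z y) (W y) DZ DW.
  by rewrite z1 w1 z2 w2 eta_i; congr ('i * _); exact: Q.
have Q0 : 'i * eta (Z y) (W y) DZ DW + ('i * eta (Z y) (W y) DZ DW)^* = 0.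
  by rewrite conjcM th conjc_i mulNr subrr.
rewrite -qE in Q0.
exact: (stenzelR_derive0 hf zw0 (X := U) Q0).
Qed.

Lemma Phi_Omega_zero x0 v w : smooth_near x0 e ->
  cdom (calM_chart R jk) (Phi (cinv (TCP_chart R i) (e x0))) ->
  (forall v, \forall y \near x0,
    complex.Re (herm (insert i 0 (complexify ('D_v e y).1)) (lift_snd i (e y))) = 0) ->
  Omega f jk (G x0) ('D_v G x0) ('D_w G x0) = 0.
Proof.
move=> se hd N; have [hd' sG] := Phi_smooth se hd.
apply: (@ddbar_closed R n E G (stenzelR jk f)) => //.
- by apply: stenzelR_smooth => //; exact: Phi_chart_dot.
- exact: stenzelRE.
- move=> s; have Ns := N s; have se' := smooth_near_near se.
  by near=> y; apply: Phi_dc_zero; near: y.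
Unshelve. all: by end_near. Qed.

End PhiLagrangian.

(** * The normal bundle in charts *)

Section ManifoldCharts.
Variables (R : realType) (m : nat) (M : smooth_manifold R m).
Local Notation chM := (chart M 'rV[R]_m).
Implicit Types (a b : chM) (x : M).

Lemma chart_nbhs a x (W : set M) : atlas a -> cdom a x -> nbhs x W ->
  nbhs (coord a x) (coord a @` (cdom a `&` W)).
Proof.
move=> ha hx hW.
have [oa oc] := atlas_open ha; have [_ cc] := atlas_homeo ha.
have imx : (coord a @` cdom a) (coord a x) by exists x.
have N1 : nbhs (coord a x) (coord a @` cdom a) by exact: open_nbhs_nbhs.
have N2 : nbhs (coord a x) (cinv a @^-1` W).
  by apply: (cc _ imx); rewrite (atlas_cancel ha).
apply: filterS2 N1 N2 => u [x' ax' <-] /=; rewrite (atlas_cancel ha)// => Wx'.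
by exists x'.
Qed.

Lemma chart_overlap_open a b : atlas a -> atlas b ->
  open (coord a @` (cdom a `&` cdom b)).
Proof.
move=> ha hb; rewrite openE => _ [x [ax bx] <-]; apply: chart_nbhs => //.
by have [ob _] := atlas_open hb; exact: open_nbhs_nbhs.
Qed.

Lemma chart_transition a b x : atlas a -> atlas b -> cdom a x -> cdom b x ->
  smooth_near (coord a x) (coord b \o cinv a).
Proof.
move=> ha hb ax bx; apply: smooth_on_near (atlas_compatible ha hb).
  exact: chart_overlap_open.
by exists x.
Qed.

Lemma chart_overlap_near a b x : atlas a -> atlas b -> cdom a x -> cdom b x ->
  \forall u \near coord a x, [/\ cdom a (cinv a u), cdom b (cinv a u) &
    coord a (cinv a u) = u].
Proof.
move=> ha hb ax bx.
have := @chart_nbhs a x (cdom b) ha ax.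
have [ob _] := atlas_open hb.
move=> /(_ (open_nbhs_nbhs (conj ob bx))); apply: filterS => u [x' [ax' bx'] <-].
by rewrite (atlas_cancel ha).
Qed.

Variables (n : nat) (iota : M -> CP R n).
Hypothesis himm : immersion (@atlas R m M) (@CP_atlas R n) iota.
Local Notation C := R[i].
Local Notation Cn1 := 'rV[C]_n.+1.
Local Notation ECn := ('rV[R]_n * 'rV[R]_n)%type.
Local Notation herm x y := (dot x (conjv y)).
Implicit Types (i j : 'I_n.+1).

Definition local_rep a i : 'rV[R]_m -> ECn := coord (CP_chart R i) \o iota \o cinv a.

Lemma CP_chart_atlas i : CP_atlas (CP_chart R i).
Proof. by exists i. Qed.

Lemma local_rep_smooth a i x : atlas a -> cdom a x -> cdom (CP_chart R i) (iota x) ->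
  exists V : set 'rV[R]_m, [/\ open V, V (coord a x), V `<=` coord a @` cdom a,
    (forall u, V u -> cdom (CP_chart R i) (iota (cinv a u))) &
    forall u, V u -> smooth_near u (local_rep a i)].
Proof.
move=> ha ax ix; have [_ H] := himm.1 a x ha ax.
have [V [oV Vx Va Vi sV]] := H _ (CP_chart_atlas i) ix.
by exists V; split=> // u Vu; exact: smooth_on_near sV.
Qed.

Lemma local_rep_near a i x : atlas a -> cdom a x -> cdom (CP_chart R i) (iota x) ->
  smooth_near (coord a x) (local_rep a i).
Proof.
by move=> ha ax ix; have [V [_ Vx _ _]] := local_rep_smooth ha ax ix; apply.
Qed.

Lemma local_rep_immersive a i x t : atlas a -> cdom a x ->
  cdom (CP_chart R i) (iota x) -> 'D_t (local_rep a i) (coord a x) = 0 -> t = 0.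
Proof.
move=> ha ax ix; have := himm.2 a _ x ha (CP_chart_atlas i) ax ix.
have d := smooth_near_differentiable (local_rep_near ha ax ix).
by rewrite deriveE // => inj D0; apply: inj; rewrite linear0.
Qed.

Lemma local_repE a i x : atlas a -> cdom a x ->
  local_rep a i (coord a x) = coord (CP_chart R i) (iota x).
Proof. by move=> ha ax; rewrite /local_rep /comp (atlas_cancel ha). Qed.

(** The two local representatives differ by a transition map of projective
    space, whose differential is [daffine]. *)
Lemma local_rep_change a i j x t : atlas a -> cdom a x ->
  cdom (CP_chart R i) (iota x) -> cdom (CP_chart R j) (iota x) ->
  'D_t (local_rep a j) (coord a x) =
  realify (daffine j (insert i 1 (complexify (local_rep a i (coord a x))))
     (insert i 0 (complexify ('D_t (local_rep a i) (coord a x))))).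
Proof.
move=> ha ax ix jx.
have di := smooth_near_differentiable (local_rep_near ha ax ix).
have dj := smooth_near_differentiable (local_rep_near ha ax jx).
have [V [oV Vx _ Vi _]] := local_rep_smooth ha ax ix.
have K (u : 'rV[R]_m) : cdom (CP_chart R i) (iota (cinv a u)) ->
    iota (cinv a u) = pclass (insert_neq0 i (complexify (local_rep a i u))).
  by move=> iu; rewrite -[LHS](CP_coordK iu).
apply: (can_inj (@complexifyK _ _)); rewrite realifyK.
apply: is_vderive_uniq (is_vderive_complexify t dj) _.
apply: (@is_vderive_ext _ _ _ _ _ (fun u => affine j (insert i 1 (complexify (local_rep a i u))))).
  apply: filterS (open_near_set oV Vx) => u /Vi /K E1.
  by rewrite -[local_rep a j u]/(coord (CP_chart R j) (iota (cinv a u))) E1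
    coord_pclass realifyK.
apply: is_vderive_affine; first by apply: is_vderive_insert; exact: is_vderive_complexify.
have := jx; rewrite -{1}(atlas_cancel ha ax) K ?cdom_pclass//.
by rewrite (atlas_cancel ha ax).
Qed.

Lemma local_rep_reparam a b i x t : atlas a -> atlas b -> cdom a x -> cdom b x ->
  cdom (CP_chart R i) (iota x) ->
  exists t', 'D_t (local_rep b i) (coord b x) = 'D_t' (local_rep a i) (coord a x).
Proof.
move=> ha hb ax bx ix.
have dT := smooth_near_differentiable (chart_transition hb ha bx ax).
have di := smooth_near_differentiable (local_rep_near ha ax ix).
exists ('D_t (coord a \o cinv b) (coord b x)).
have E1 : (coord a \o cinv b) (coord b x) = coord a x by rewrite /comp (atlas_cancel hb).
rewrite -E1 in di *.
have [_ <-] := derive_chain t dT di.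
apply: near_eq_derive.
apply: filterS (chart_overlap_near hb ha bx ax) => u [_ au _].
by rewrite /local_rep /comp (atlas_cancel ha).
Qed.

(** [tangent_image] prescribes the coordinates in all charts of the target at
    once; [local_rep_change] reduces them to those in a single chart. *)
Lemma tangent_image_exists a i x t : atlas a -> cdom a x ->
  cdom (CP_chart R i) (iota x) ->
  tangent_image iota x (cinv (TCP_chart R i)
    (local_rep a i (coord a x), 'D_t (local_rep a i) (coord a x))).
Proof.
move=> ha ax ix; split.
  have E1 : (coord (TCP_chart R i) (cinv (TCP_chart R i)
      (local_rep a i (coord a x), 'D_t (local_rep a i) (coord a x)))).1
      = coord (CP_chart R i) (iota x).
    by rewrite TCP_cinvK; exact: local_repE.
  rewrite -[LHS](@CP_coordK _ _ i); last by apply/cdom_base; exact: TCP_cdom_cinv.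
  by rewrite coord_base E1 CP_coordK.
exists a, t; split=> // j jx.
have dj := smooth_near_differentiable (local_rep_near ha ax jx).
rewrite -/(local_rep a j) -deriveE // (local_rep_change t ha ax ix jx).
have l0 : insert i 1 (complexify (local_rep a i (coord a x))) 0 j != 0.
  apply/(cdom_pclass j (insert_neq0 i _)).
  rewrite -[pclass _]/(cinv (CP_chart R i) (local_rep a i (coord a x))).
  by rewrite local_repE// CP_coordK.
by rewrite TCP_transition.
Qed.

Lemma tangent_image_local a i x w : atlas a -> cdom a x ->
  cdom (CP_chart R i) (iota x) -> tangent_image iota x w ->
  exists t, (coord (TCP_chart R i) w).2 = 'D_t (local_rep a i) (coord a x).
Proof.
move=> ha ax ix [_ [b [t [hb bx H]]]].
have db := smooth_near_differentiable (local_rep_near hb bx ix).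
have [t' E1] := local_rep_reparam t ha hb ax bx ix.
by exists t'; rewrite (H _ ix) -E1 deriveE.
Qed.

Lemma hproj_herm (x z y : Cn1) : herm x z = 0 -> herm x (hproj z y) = herm x y.
Proof.
move=> xz; rewrite /hproj -scaleNr conjvD conjv_scale dotDr dotZr xz mulr0.
by rewrite addr0.
Qed.

Lemma Re_hermC (x y : Cn1) : complex.Re (herm x y) = complex.Re (herm y x).
Proof. by rewrite -hermC Re_conj. Qed.

(** A single chart of the submanifold and a single representative suffice to
    test normality.  Projecting the tangent vector does not change the
    product, because [lift_snd] is already orthogonal to [lift_fst]. *)
Lemma normal_bundle_local a i x (v : TCP R n) : atlas a -> cdom a x ->
  base v = iota x -> cdom (CP_chart R i) (iota x) ->
  (normal_bundle iota (x, v) <-> forall t,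
    complex.Re (herm (insert i 0 (complexify ('D_t (local_rep a i) (coord a x))))
                     (lift_snd i (coord (TCP_chart R i) v))) = 0).
Proof.
move=> ha ax bv ix.
have iv : cdom (TCP_chart R i) v by apply/cdom_base; rewrite bv.
have v1 : (coord (TCP_chart R i) v).1 = local_rep a i (coord a x).
  by rewrite -coord_base bv local_repE.
have vE : v = \pi_(TCP R n) (Blift i (coord (TCP_chart R i) v)).
  by rewrite -TCP_cinvE TCP_coordK.
have lvz : herm (lift_snd i (coord (TCP_chart R i) v))
                (lift_fst i (coord (TCP_chart R i) v)) = 0 by exact: lift_dot.
split=> [[_ H] t|H].
  have T := tangent_image_exists t ha ax ix.
  set e := (local_rep a i (coord a x), 'D_t (local_rep a i) (coord a x)) in T.
  have fst_eq : lift_fst i e = lift_fst i (coord (TCP_chart R i) v).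
    by rewrite /lift_fst v1.
  have := H _ (Blift i (coord (TCP_chart R i) v)) (Blift i e) T vE (TCP_cinvE i e) (esym fst_eq).
  rewrite /fubini_study /= => /eqP; rewrite mulf_eq0 invr_eq0 normv_sqr.
  have -> : (complex.Re (herm (lift_fst i (coord (TCP_chart R i) v))
      (lift_fst i (coord (TCP_chart R i) v))) == 0) = false.
    by apply/negbTE; rewrite -rC_neq0 -herm_Re dot_conjv_eq0 lift_fst_neq0.
  rewrite orbF {2}/lift_snd fst_eq hproj_herm// => /eqP E1.
  by rewrite Re_hermC.
split=> // w p q T vp wq pq; rewrite /fubini_study.
have [t tE] := tangent_image_local ha ax ix T.
have [bw _] := T.
have iw : cdom (TCP_chart R i) w by apply/cdom_base; rewrite bw.
have wE : w = \pi_(TCP R n) (Blift i (coord (TCP_chart R i) w)).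
  by rewrite -TCP_cinvE TCP_coordK.
have w1 : (coord (TCP_chart R i) w).1 = local_rep a i (coord a x).
  by rewrite -coord_base bw local_repE.
have [l l0 El] : exists2 l : C, l != 0 & val p =
    (l *: (val (Blift i (coord (TCP_chart R i) v))).1,
     l *: (val (Blift i (coord (TCP_chart R i) v))).2).
  by apply/TCP_eqP; exact: etrans (esym vE) vp.
have [k k0 Ek] : exists2 l : C, l != 0 & val q =
    (l *: (val (Blift i (coord (TCP_chart R i) w))).1,
     l *: (val (Blift i (coord (TCP_chart R i) w))).2).
  by apply/TCP_eqP; exact: etrans (esym wE) wq.
have fst_eq : lift_fst i (coord (TCP_chart R i) w) = lift_fst i (coord (TCP_chart R i) v).
  exact: (congr1 (fun e => insert i 1 (complexify e)) (etrans w1 (esym v1))).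
have p1 : (val p).1 = l *: lift_fst i (coord (TCP_chart R i) v) := congr1 fst El.
have p2 : (val p).2 = l *: lift_snd i (coord (TCP_chart R i) v) := congr1 snd El.
have q1 : (val q).1 = k *: lift_fst i (coord (TCP_chart R i) w) := congr1 fst Ek.
have q2 : (val q).2 = k *: lift_snd i (coord (TCP_chart R i) w) := congr1 snd Ek.
have lk : l = k.
  have scE (c : C) (z : Cn1) : z 0 i = 1 -> (c *: z) 0 i = c.
    by move=> zi; rewrite mxE zi mulr1.
  have E1 := congr1 (fun u : Cn1 => u 0 i) (etrans (etrans (esym p1) pq) q1).
  exact: etrans (esym (scE l _ (lift_fst_id i _))) (etrans E1 (scE k _ (lift_fst_id i _))).
have sw : herm (lift_snd i (coord (TCP_chart R i) v)) (lift_snd i (coord (TCP_chart R i) w))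
  = herm (lift_snd i (coord (TCP_chart R i) v))
         (insert i 0 (complexify ('D_t (local_rep a i) (coord a x)))).
  by rewrite -tE {2}/lift_snd fst_eq hproj_herm.
rewrite p2 q2 -lk conjv_scale dotZl dotZr sw mulrA -normc_sqr ReM.
by rewrite Re_hermC H mulr0 mul0r subr0 mul0r.
Qed.

End ManifoldCharts.

(** * The normal spaces *)

Section LinearAlgebra.

(** Gaussian elimination: the last rows of the extended row basis complete the
    rows of the transpose. *)
Lemma complete_columns (F : fieldType) m k (K : 'M[F]_(m + k, m)) :
  (forall c : 'cV_m, K *m c = 0 -> c = 0) ->
  exists L : 'M[F]_(m + k, k), row_mx K L \in unitmx.
Proof.
move=> inj.
have fA : row_free K^T.
  apply: inj_row_free => v vK; apply: (can_inj (@trmxK _ _ _)); rewrite trmx0.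
  by apply: inj; rewrite -[K]trmxK -trmx_mul vK trmx0.
have rA : \rank K^T = m by apply/eqP.
exists (dsubmx (row_ebase K^T))^T.
rewrite -unitmx_tr tr_row_mx trmxK.
have E1 : K^T = col_ebase K^T *m usubmx (row_ebase K^T).
  rewrite -{1}[K^T]mulmx_ebase rA -mulmxA; congr (_ *m _).
  rewrite -[X in _ *m X]vsubmxK pid_mx_row mul_row_col mul1mx mul0mx addr0.
  by [].
have -> : col_mx K^T (dsubmx (row_ebase K^T)) =
    block_mx (col_ebase K^T) 0 0 1%:M *m row_ebase K^T.
  by rewrite -[X in _ *m X]vsubmxK mul_block_col !mul0mx mul1mx addr0 add0r -E1.
rewrite unitmx_mul row_ebase_unit andbT unitmxE det_ublock det1 mulr1.
by rewrite -unitmxE col_ebase_unit.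
Qed.

Lemma linear_rowE (R : realType) d (h : 'rV[R]_d -> R) (r : 'rV[R]_d) :
  linear h -> h r = \sum_l r 0 l * h (delta_mx 0 l).
Proof.
move=> lh; rewrite [r in LHS]row_sum_delta.
elim/big_rec2 : _ => [|l x y _ <-]; first exact: (linear_at0 lh).
by rewrite -lh.
Qed.

Variables (R : realType) (n : nat).
Local Notation ECn := ('rV[R]_n * 'rV[R]_n)%type.

Lemma ECn_coordinates d : d = (n + n)%N ->
  exists (vec : ECn -> 'rV[R]_d) (unvec : 'rV[R]_d -> ECn),
    [/\ cancel vec unvec, cancel unvec vec, linear vec & linear unvec] /\
    (continuous vec /\ continuous unvec).
Proof.
move=> ->.
exists (fun e => row_mx e.1 e.2), (fun r => (lsubmx r, rsubmx r)).
split; first split.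
- by case=> a b; rewrite row_mxKl row_mxKr.
- by move=> r /=; rewrite hsubmxK.
- by move=> c a b; rewrite scale_row_mx add_row_mx.
- by move=> c a b; rewrite !linearP.
split=> x.
  apply: (@smooth_near_continuous R ECn); apply/smooth_near_rV => k.
  case: (split_ordP k) => l ->.
    under eq_fun do rewrite row_mxEl.
    move: l; apply/smooth_near_rV.
    by apply: smooth_near_linear; [exact: fst_linear|exact: fst_cont].
  under eq_fun do rewrite row_mxEr.
  move: l; apply/smooth_near_rV.
  by apply: smooth_near_linear; [exact: snd_linear|exact: snd_cont].
apply: (@smooth_near_continuous R 'rV[R]_(n + n)).
apply/smooth_near_pair; split=> /=; apply/smooth_near_rV => k;
  under eq_fun do rewrite mxE; apply: smooth_near_linear;
  by [exact: coord_linear|exact: coord_cont].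
Qed.

End LinearAlgebra.

Section FubiniStudyForm.
Variables (R : realType) (n : nat) (i : 'I_n.+1).
Local Notation C := R[i].
Local Notation Cn1 := 'rV[C]_n.+1.
Local Notation ECn := ('rV[R]_n * 'rV[R]_n)%type.
Local Notation herm x y := (dot x (conjv y)).

(** The Fubini-Study product at [a] of the tangent vectors with coordinates
    [b] and [b'], up to a positive factor.  Only [b] is projected, which gives
    the same value. *)
Definition fs_pairing (a b b' : ECn) : R :=
  complex.Re (herm (insert i 0 (complexify b')) (lift_snd i (a, b))).

Lemma insert_complexify_linear (s : R) (b b' : ECn) :
  insert i 0 (complexify (s *: b + b')) =
  s%:C *: insert i 0 (complexify b) + insert i 0 (complexify b').
Proof.
by rewrite complexify_linear -insert_sum_linear mulr0 addr0.
Qed.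

Lemma hproj_linear (z x y : Cn1) (c : C) :
  hproj z (c *: x + y) = c *: hproj z x + hproj z y.
Proof.
rewrite /hproj dotDl dotZl mulrDl scalerDl scalerBr !scalerA opprD.
by rewrite mulrA addrACA.
Qed.

Lemma fs_pairing_linear_l a b' : linear (fun b => fs_pairing a b b').
Proof.
move=> s b c; rewrite /fs_pairing /lift_snd /= insert_complexify_linear hproj_linear.
rewrite conjvD conjv_scale dotDr dotZr conjc_rc ReD ReM /= mul0r subr0.
by [].
Qed.

Lemma fs_pairing_linear_r a b : linear (fun b' => fs_pairing a b b').
Proof.
move=> s b' c; rewrite /fs_pairing insert_complexify_linear dotDl dotZl ReD ReM /= mul0r subr0.
by [].
Qed.

(** If the horizontal projection of [insert i 0 b] vanishes, then this vector
    is a multiple of [lift_fst], and its [i]-th coordinate shows that the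
    multiple is 0. *)
Lemma fs_pairing_definite a b : fs_pairing a b b = 0 -> b = 0.
Proof.
rewrite /fs_pairing; set y := insert i 0 _; set z := lift_fst i (a, b).
have xz : herm (lift_snd i (a, b)) z = 0 by exact: lift_dot.
rewrite Re_hermC -(hproj_herm y xz) -/(lift_snd i (a, b)) => H.
have : lift_snd i (a, b) = 0.
  by apply/eqP; rewrite -dot_conjv_eq0 herm_Re H.
rewrite /lift_snd /hproj -/y -/z => /eqP; rewrite subr_eq0 => /eqP yz.
have l0 : herm y z / herm z z = 0.
  have := congr1 (fun u : Cn1 => u 0 i) yz.
  have scE (c : C) (x : Cn1) : x 0 i = 1 -> (c *: x) 0 i = c.
    by move=> xi; rewrite mxE xi mulr1.
  by rewrite (scE _ z (lift_fst_id i _)) insert_id.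
rewrite -[b]complexifyK (_ : complexify b = 0).
  by rewrite /realify; congr pair; apply/rowP => k; rewrite !mxE.
apply/rowP => k; have := congr1 (fun u : Cn1 => u 0 (lift i k)) yz.
by rewrite l0 scale0r insert_lift !mxE.
Qed.

Lemma fs_pairing_smooth (E : normedModType R) (x : E) (F G : E -> ECn) b :
  smooth_near x F -> smooth_near x G -> smooth_near x (fun y => fs_pairing (F y) b (G y)).
Proof.
move=> sF sG.
have se : smooth_near x (fun y => (F y, b)).
  by apply/smooth_near_pair; split=> //=; exact: smooth_near_cst.
suff [] : csmooth x (fun y => herm (insert i 0 (complexify (G y))) (lift_snd i (F y, b))) by [].
apply: csmooth_dot => k.
  by apply: csmooth_insert => l; exact: smooth_near_complexify.
by apply: csmooth_conjv; exact: (csmooth_lift_snd i se).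
Qed.

End FubiniStudyForm.

(** * Parametrization of the normal bundle *)

Section Cramer.
Variables (F : fieldType) (m k : nat).
Variables (K : 'M[F]_(m + k, m)) (L : 'M[F]_(m + k, k)).
Hypothesis T0 : \det (row_mx K L) != 0.

(** The solution [r] of [r *m K = 0] and [r *m L = c], written with the
    adjugate so that it is rational in the entries of [K]. *)
Definition cramer (c : 'rV[F]_k) : 'rV[F]_(m + k) :=
  (\det (row_mx K L))^-1 *: (row_mx 0 c *m \adj (row_mx K L)).

Lemma cramerP c : cramer c *m K = 0 /\ cramer c *m L = c.
Proof.
apply: eq_row_mx; rewrite -mul_mx_row /cramer -scalemxAl -mulmxA mul_adj_mx.
by rewrite mul_mx_scalar scalerA mulVf// scale1r.
Qed.

Lemma cramer_uniq r : r *m K = 0 -> r = cramer (r *m L).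
Proof.
move=> rK; rewrite /cramer -{1}rK -mul_mx_row -mulmxA mul_mx_adj.
by rewrite mul_mx_scalar scalerA mulVf// scale1r.
Qed.

End Cramer.

Section SmoothMapHelpers.
Variables (R : realType).

Lemma smooth_map_witness (E F : normedModType R) (U : set E) (P : E -> Prop)
    (h : E -> F) x : open U -> U x -> (\forall y \near x, P y) -> smooth_near x h ->
  exists V : set E, [/\ open V, V x, V `<=` U, (forall y, V y -> P y) & smooth_on V h].
Proof.
move=> oU Ux NP [V [oV Vx sV]].
exists (U `&` interior [set y | P y] `&` V); split.
- by apply: openI => //; apply: openI => //; exact: open_interior.
- by split=> //; split.
- by move=> y [[]].
- by move=> y [[_ /interior_subset]].
- by move=> r; apply: Ck_sub (sV r) => y [].
Qed.

Lemma injective_diff (E F : normedModType R) (h : E -> F) x : differentiable h x ->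
  (forall v, 'D_v h x = 0 -> v = 0) -> injective ('d h x).
Proof.
move=> dh H u v uv; apply/eqP; rewrite -subr_eq0; apply/eqP; apply: H.
by rewrite deriveE// linearB uv subrr.
Qed.

Lemma left_inverse_immersive (E F : normedModType R) (h : E -> F) (l : F -> E) x v :
  differentiable h x -> differentiable l (h x) ->
  (\forall y \near x, l (h y) = y) -> 'D_v h x = 0 -> v = 0.
Proof.
move=> dh dl lh D0.
have [_ E1] := derive_chain v dh dl.
have E2 : 'D_v (fun y => l (h y)) x = 'D_v id x by apply: near_eq_derive.
by rewrite derive_id E1 D0 deriveE// linear0 in E2.
Qed.

Lemma lsubmx_cont m k : continuous (@lsubmx R 1 m k).
Proof. by move=> u; apply: differentiable_continuous; exact: differentiable_lsubmx. Qed.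

Lemma rsubmx_cont m k : continuous (@rsubmx R 1 m k).
Proof. by move=> u; apply: differentiable_continuous; exact: differentiable_rsubmx. Qed.

Lemma lsubmx_lin m k : linear (@lsubmx R 1 m k).
Proof. by move=> c a b; rewrite linearP. Qed.

Lemma rsubmx_lin m k : linear (@rsubmx R 1 m k).
Proof. by move=> c a b; rewrite linearP. Qed.

Lemma smooth_near_row_mx (E : normedModType R) m k x
    (F : E -> 'rV[R]_m) (G : E -> 'rV[R]_k) :
  smooth_near x F -> smooth_near x G -> smooth_near x (fun y => row_mx (F y) (G y)).
Proof.
move=> /smooth_near_rV sF /smooth_near_rV sG; apply/smooth_near_rV => l.
by case: (split_ordP l) => p ->; [under eq_fun do rewrite row_mxEl|under eq_fun do rewrite row_mxEr].
Qed.

Lemma smooth_near_mulmx (E : normedModType R) m k x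
    (F : E -> 'rV[R]_m) (A : E -> 'M[R]_(m, k)) :
  smooth_near x F -> (forall p q, smooth_near x (fun y => A y p q)) ->
  smooth_near x (fun y => F y *m A y).
Proof.
move=> /smooth_near_rV sF sA; apply/smooth_near_rV => l.
under eq_fun do rewrite mxE.
by apply: smooth_near_sum => p; apply: smooth_nearM.
Qed.

End SmoothMapHelpers.

Section NormalParametrization.
Variables (R : realType) (m n k : nat) (M : smooth_manifold R m) (iota : M -> CP R n).
Local Notation ECn := ('rV[R]_n * 'rV[R]_n)%type.
Hypothesis himm : immersion (@atlas R m M) (@CP_atlas R n) iota.
Variables (vec : ECn -> 'rV[R]_(m + k)) (unvec : 'rV[R]_(m + k) -> ECn).
Hypotheses (vecK : cancel vec unvec) (unvecK : cancel unvec vec).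
Hypotheses (lvec : linear vec) (lunvec : linear unvec).
Hypotheses (cvec : continuous vec) (cunvec : continuous unvec).
Variables (a : chart M 'rV[R]_m) (i : 'I_n.+1) (x0 : M).
Hypotheses (ha : atlas a) (ax0 : cdom a x0) (ix0 : cdom (CP_chart R i) (iota x0)).

Let phi := local_rep iota a i.
Let K y : 'M[R]_(m + k, m) := \matrix_(l, c)
  fs_pairing i (phi y) (unvec (delta_mx 0 l)) ('D_(delta_mx 0 c) phi y).

Lemma normal_mxE y r c :
  (r *m K y) 0 c = fs_pairing i (phi y) (unvec r) ('D_(delta_mx 0 c) phi y).
Proof.
rewrite mxE (@linear_rowE _ _ (fun r => fs_pairing i (phi y) (unvec r) ('D_(delta_mx 0 c) phi y)) r).
  by apply: eq_bigr => l _; rewrite mxE.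
by move=> s u v; rewrite lunvec fs_pairing_linear_l.
Qed.

Lemma normal_mx_tangent y r t : differentiable phi y ->
  fs_pairing i (phi y) (unvec r) ('D_t phi y) = \sum_c t 0 c * (r *m K y) 0 c.
Proof.
move=> d; rewrite (@linear_rowE _ _ (fun t => fs_pairing i (phi y) (unvec r) ('D_t phi y)) t).
  by apply: eq_bigr => c _; rewrite normal_mxE.
by move=> s u v; rewrite !deriveE// linearP fs_pairing_linear_r.
Qed.

Lemma normal_mxP y r : differentiable phi y ->
  (r *m K y = 0 <-> forall t, fs_pairing i (phi y) (unvec r) ('D_t phi y) = 0).
Proof.
move=> d; split=> [rK t|H].
  by rewrite normal_mx_tangent// rK big1// => c _; rewrite mxE mulr0.
by apply/rowP => c; rewrite normal_mxE H mxE.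
Qed.

(** A tangent vector that is orthogonal to all vectors is orthogonal to
    itself. *)
Lemma normal_mx_inj (c : 'cV_m) : K (coord a x0) *m c = 0 -> c = 0.
Proof.
move=> Kc.
have d := smooth_near_differentiable (local_rep_near himm ha ax0 ix0).
pose b := 'D_(c^T) phi (coord a x0).
have : fs_pairing i (phi (coord a x0)) b b = 0.
  rewrite -[X in fs_pairing _ _ X _](vecK b) normal_mx_tangent//.
  transitivity ((vec b *m K (coord a x0) *m c) 0 0).
    by rewrite [RHS]mxE; apply: eq_bigr => l _; rewrite mxE mulrC.
  by rewrite -mulmxA Kc mulmx0 mxE.
move=> /fs_pairing_definite /(local_rep_immersive himm ha ax0 ix0) cT0.
by rewrite -[c]trmxK cT0 trmx0.
Qed.

Lemma normal_mx_smooth y l c : smooth_near y phi -> smooth_near y (fun y => K y l c).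
Proof.
move=> s; under eq_fun do rewrite mxE.
by apply: fs_pairing_smooth => //; exact: smooth_near_derive.
Qed.

Variable L : 'M[R]_(m + k, k).
Hypothesis TL : \det (row_mx (K (coord a x0)) L) != 0.
Variable V : set 'rV[R]_m.
Hypotheses (oV : open V) (Vx : V (coord a x0)) (Va : V `<=` coord a @` cdom a).
Hypothesis Vi : forall y, V y -> cdom (CP_chart R i) (iota (cinv a y)).
Hypothesis Vs : forall y, V y -> smooth_near y phi.
Hypothesis VT : forall y, V y -> \det (row_mx (K y) L) != 0.

Let fib y c : ECn := unvec (cramer (K y) L c).
Let U : set 'rV[R]_(m + k) := [set u | V (lsubmx u)].
Let F (u : 'rV[R]_(m + k)) : ECn * ECn := (phi (lsubmx u), fib (lsubmx u) (rsubmx u)).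
Let g (u : 'rV[R]_(m + k)) : M * TCP R n :=
  (cinv a (lsubmx u), cinv (TCP_chart R i) (F u)).
Let inv (xv : M * TCP R n) : 'rV[R]_(m + k) :=
  row_mx (coord a xv.1) (vec (coord (TCP_chart R i) xv.2).2 *m L).

Lemma slice_cdom y : V y -> cdom a (cinv a y) /\ coord a (cinv a y) = y.
Proof. by move=> /Va [x ax <-]; rewrite (atlas_cancel ha). Qed.

Lemma open_param_domain : open U.
Proof. by apply: open_comp => // u _; exact: lsubmx_cont. Qed.

Lemma param_coord_smooth u : U u -> smooth_near u F.
Proof.
move=> Uu; have s := Vs Uu.
have pre (h : 'rV[R]_m -> R) : smooth_near (lsubmx u) h -> smooth_near u (fun u => h (lsubmx u)).
  by apply: smooth_near_pre; [exact: lsubmx_lin|exact: lsubmx_cont].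
have sT p q : smooth_near u (fun u => row_mx (K (lsubmx u)) L p q).
  apply: (pre (fun y => row_mx (K y) L p q)).
  case: (split_ordP q) => l ->.
    by under eq_fun do rewrite row_mxEl; exact: normal_mx_smooth.
  by under eq_fun do rewrite row_mxEr; exact: smooth_near_cst.
apply/smooth_near_pair; split=> /=.
  by apply: smooth_near_pre => //; [exact: lsubmx_lin|exact: lsubmx_cont].
apply: smooth_near_post => //; rewrite /cramer.
have sN : smooth_near u (fun u => row_mx 0 (rsubmx u) *m \adj (row_mx (K (lsubmx u)) L)).
  apply: smooth_near_mulmx.
    apply: smooth_near_row_mx; first exact: smooth_near_cst.
    by apply: smooth_near_linear; [exact: rsubmx_lin|exact: rsubmx_cont].
  by move=> p q; exact: smooth_near_adj.
have sD : smooth_near u (fun u => (\det (row_mx (K (lsubmx u)) L))^-1).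
  by apply: smooth_nearV; [exact: smooth_near_det|exact: VT].
move/smooth_near_rV: sN => sN; apply/smooth_near_rV => l.
by under eq_fun do rewrite mxE; exact: smooth_nearM.
Qed.

Lemma param_invK u : U u -> inv (g u) = u.
Proof.
move=> Uu; have [_ c1] := slice_cdom Uu; rewrite /inv /g.
rewrite [X in row_mx X _]c1 TCP_cinvK /F /fib unvecK.
by have [_ ->] := cramerP (VT Uu) (rsubmx u); rewrite hsubmxK.
Qed.

Lemma base_param u : U u -> base (g u).2 = iota (g u).1.
Proof.
move=> Uu; rewrite -[LHS](@CP_coordK _ _ i); last first.
  by apply/cdom_base; exact: TCP_cdom_cinv.
by rewrite coord_base TCP_cinvK -[RHS](CP_coordK (Vi Uu)).
Qed.

Lemma param_normal u : U u -> normal_bundle iota (g u).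
Proof.
move=> Uu; have [au cu] := slice_cdom Uu.
apply/(normal_bundle_local himm ha au (base_param Uu) (Vi Uu)) => t.
rewrite cu TCP_cinvK.
have d := smooth_near_differentiable (Vs Uu).
have [K0 _] := cramerP (VT Uu) (rsubmx u).
exact: (normal_mxP _ d).1 K0 t.
Qed.

(** A normal vector is determined by its base point and by the product of its
    coordinates with [L], by uniqueness in Cramer's rule. *)
Lemma paramK xv : normal_bundle iota xv -> cdom a xv.1 ->
  cdom (TCP_chart R i) xv.2 -> U (inv xv) -> g (inv xv) = xv.
Proof.
case: xv => x v S ax iv Ui; have [bv _] := S.
have ix : cdom (CP_chart R i) (iota x) by rewrite -bv; apply/cdom_base.
have Vx' : V (coord a x) by move: Ui; rewrite /U /inv /= row_mxKl.
have d := smooth_near_differentiable (Vs Vx').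
have N := (normal_bundle_local himm ha ax bv ix).1 S.
have v1 : (coord (TCP_chart R i) v).1 = phi (coord a x).
  by rewrite -coord_base; rewrite bv /phi local_repE.
have vK : vec (coord (TCP_chart R i) v).2 *m K (coord a x) = 0.
  apply: (normal_mxP _ d).2 => t; rewrite vecK.
  have := N t; rewrite /fs_pairing.
  by case: (coord (TCP_chart R i) v) v1 => c1 c2 /= ->.
rewrite /g /inv row_mxKl; congr pair; first exact: atlas_cancel.
rewrite /F /fib row_mxKl row_mxKr -(cramer_uniq (VT Vx') vK) vecK -v1.
rewrite -[RHS](TCP_coordK iv); congr (cinv _ _).
Qed.

Lemma param_inv_smooth (a' : chart M 'rV[R]_m) (i' : 'I_n.+1) xv : atlas a' ->
  cdom a xv.1 -> cdom a' xv.1 -> cdom (TCP_chart R i) xv.2 -> cdom (TCP_chart R i') xv.2 ->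
  smooth_near (coord a' xv.1, coord (TCP_chart R i') xv.2)
    (fun p : 'rV[R]_m * (ECn * ECn) => inv (cinv a' p.1, cinv (TCP_chart R i') p.2)).
Proof.
move=> ha' ax ax' iv iv'; rewrite /inv.
apply: smooth_near_row_mx.
  apply: (@smooth_near_pre _ _ _ _ _ fst (coord a \o cinv a')).
  - exact: fst_linear.
  - exact: fst_cont.
  - exact: chart_transition.
apply: smooth_near_mulmx; last by move=> p q; exact: smooth_near_cst.
apply: smooth_near_post => //.
apply: (@smooth_near_pre _ _ _ _ _ snd
  (fun e => (coord (TCP_chart R i) (cinv (TCP_chart R i') e)).2)).
- exact: snd_linear.
- exact: snd_cont.
have [||_ s] := @TCP_transition_smooth _ _ (ECn * ECn)%type i' i id (coord (TCP_chart R i') xv.2).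
- by apply: smooth_near_linear => // x.
- by rewrite TCP_coordK.
by have [] := (smooth_near_pair _ _).1 s.
Qed.

Lemma param_chart_smooth (a' : chart M 'rV[R]_m) (i' : 'I_n.+1) u : atlas a' -> U u ->
  cdom a' (g u).1 -> cdom (TCP_chart R i') (g u).2 ->
  (\forall u \near u, [/\ U u, cdom a' (g u).1 & cdom (TCP_chart R i') (g u).2]) /\
  smooth_near u (fun u => (coord a' (g u).1, coord (TCP_chart R i') (g u).2)).
Proof.
move=> ha' Uu au iu; have [aa cu] := slice_cdom Uu.
have [N2 s2] := TCP_transition_smooth (param_coord_smooth Uu) iu.
have N1 : \forall u \near u, cdom a' (g u).1.
  have := chart_overlap_near ha ha' aa au; rewrite cu => N.
  have N' : \forall u \near u, [/\ cdom a (cinv a (lsubmx u)), cdom a' (cinv a (lsubmx u)) &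
    coord a (cinv a (lsubmx u)) = lsubmx u] := @lsubmx_cont R m k u _ N.
  by apply: filterS N' => y [].
split.
  have NU := open_near_set open_param_domain Uu.
  by near=> y; split; near: y.
apply/smooth_near_pair; split=> //=.
apply: (@smooth_near_pre _ _ _ _ _ lsubmx (coord a' \o cinv a)).
- exact: lsubmx_lin.
- exact: lsubmx_cont.
- by rewrite -cu; exact: chart_transition.
Unshelve. all: by end_near. Qed.

(** The left inverse [inv] is smooth in all charts.  This gives the
    injectivity of [g] and of its differential, and, as [inv] is defined on a
    whole neighbourhood, that [g] is open onto its image. *)
Lemma normal_parametrization : local_parametrization
  (prod_atlas (@atlas R m M) (@TCP_atlas R n)) (normal_bundle iota) U g.
Proof.
have smg a' i' u : atlas a' -> U u -> cdom a' (g u).1 -> cdom (TCP_chart R i') (g u).2 ->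
    smooth_near u (fun u => (coord a' (g u).1, coord (TCP_chart R i') (g u).2)).
  by move=> h1 h2 h3 h4; have [] := param_chart_smooth h1 h2 h3 h4.
split.
- exact: open_param_domain.
- split.
    move=> _ u -> /= Uu; split.
      exists (Chart (cdom a `*` cdom (TCP_chart R i))
        (fun p => (coord a p.1, coord (TCP_chart R i) p.2))
        (fun e => (cinv a e.1, cinv (TCP_chart R i) e.2))).
        by exists a, (TCP_chart R i); split=> //; exists i.
      by split; [have [] := slice_cdom Uu|exact: TCP_cdom_cinv].
    move=> _ [a' [_ [ha' [i' _ <-] ->]]] [au iu].
    have [N s] := param_chart_smooth ha' Uu au iu.
    have [W [oW Wu WU WP sW]] := smooth_map_witness open_param_domain Uu N s.
    exists W; split.
    - exact: oW.
    - exact: Wu.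
    - by move=> y /WU Uy; exists y.
    - by move=> y /WP [_ ay iy]; split.
    - exact: sW.
  move=> _ _ u -> [a' [_ [ha' [i' _ <-] ->]]] Uu [au iu].
  have [N s] := param_chart_smooth ha' Uu au iu.
  have dg := smooth_near_differentiable s.
  apply: injective_diff; first exact: dg.
  move=> v; apply: (left_inverse_immersive (l := fun p : 'rV[R]_m * (ECn * ECn) =>
     inv (cinv a' p.1, cinv (TCP_chart R i') p.2))) => //.
    apply: smooth_near_differentiable; apply: param_inv_smooth => //.
      by have [] := slice_cdom Uu.
    exact: TCP_cdom_cinv.
  apply: filterS N => y [Uy ay iy].
  have Eg : (cinv a' (coord a' (g y).1),
      cinv (TCP_chart R i') (coord (TCP_chart R i') (g y).2)) = g y.
    by rewrite (atlas_cancel ha' ay) (TCP_coordK iy) -surjective_pairing.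
  exact: etrans (congr1 inv Eg) (param_invK Uy).
- move=> u u'; rewrite !inE => Uu Uu' gg.
  by rewrite -(param_invK Uu) gg param_invK.
- exact: param_normal.
move=> u V0 Uu V0u.
have [aa cu] := slice_cdom Uu.
exists [set xv | [/\ cdom a xv.1, cdom (TCP_chart R i) xv.2 & (V0 `&` U) (inv xv)]].
  exists (Chart (cdom a `*` cdom (TCP_chart R i))
        (fun p => (coord a p.1, coord (TCP_chart R i) p.2))
        (fun e => (cinv a e.1, cinv (TCP_chart R i) e.2))); split.
  - by exists a, (TCP_chart R i); split=> //; exists i.
  - by split=> //; exact: TCP_cdom_cinv.
  - rewrite [coord _ _]/=.
    have iu : cdom (TCP_chart R i) (g u).2 by exact: TCP_cdom_cinv.
    have ci := smooth_near_continuous (param_inv_smooth (xv := g u) ha aa aa iu iu).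
    have N1 : nbhs u (V0 `&` U) by apply: filterI => //; exact: open_near_set open_param_domain Uu.
    have N2 : \forall p \near (coord a (g u).1, coord (TCP_chart R i) (g u).2),
        (V0 `&` U) (inv (cinv a p.1, cinv (TCP_chart R i) p.2)).
      have Eg : (cinv a (coord a (g u).1),
          cinv (TCP_chart R i) (coord (TCP_chart R i) (g u).2)) = g u.
        by rewrite (atlas_cancel ha aa) (TCP_coordK iu).
      have N1' : nbhs (inv (cinv a (coord a (g u).1),
          cinv (TCP_chart R i) (coord (TCP_chart R i) (g u).2))) (V0 `&` U).
        by rewrite Eg param_invK.
      exact: ci _ N1'.
    have N3 : \forall p \near (coord a (g u).1, coord (TCP_chart R i) (g u).2), (coord a @` cdom a) p.1.
      apply: (@fst_cont R 'rV[R]_m (ECn * ECn)%type).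
      have [_ oc] := atlas_open ha.
      by apply: open_nbhs_nbhs; split=> //; exists (g u).1.
    apply: filterS2 N2 N3 => -[p1 p2] H [x ax px].
    have px' : coord a (cinv a p1) = p1 by rewrite -[p1]px (atlas_cancel ha).
    have ap : cdom a (cinv a p1) by rewrite -[p1]px (atlas_cancel ha).
    exists (cinv a p1, cinv (TCP_chart R i) p2).
      split; first by split=> //; exact: TCP_cdom_cinv.
      by split=> //; exact: TCP_cdom_cinv.
    rewrite -[LHS]/(coord a (cinv a p1), coord (TCP_chart R i) (cinv (TCP_chart R i) p2)).
    by rewrite px' TCP_cinvK.
move=> xv [[axv ixv [V0i Ui]] Sxv].
by exists (inv xv) => //; exact: paramK.
Qed.

End NormalParametrization.

(** * The image of the normal bundle *)

Section Assembly.
Variables (R : realType) (n m : nat) (M : smooth_manifold R m) (iota : M -> CP R n).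
Local Notation ECn := ('rV[R]_n * 'rV[R]_n)%type.
Local Notation herm x y := (dot x (conjv y)).
Hypothesis himm : immersion (@atlas R m M) (@CP_atlas R n) iota.
Local Notation NM := (normal_bundle iota).
Local Notation atlasMT := (prod_atlas (@atlas R m M) (@TCP_atlas R n)).

Lemma immersion_dim (a : chart M 'rV[R]_m) i x : atlas a -> cdom a x ->
  cdom (CP_chart R i) (iota x) -> (m <= n + n)%N.
Proof.
move=> ha ax ix.
have d := smooth_near_differentiable (local_rep_near himm ha ax ix).
have [vec [unvec [[vecK _ lvec _] _]]] := @ECn_coordinates R n _ erefl.
pose D t := 'D_t (local_rep iota a i) (coord a x).
pose A := \matrix_(c < m, l < n + n) vec (D (delta_mx 0 c)) 0 l.
have AE (t : 'rV[R]_m) : t *m A = vec (D t).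
  apply/rowP => l; rewrite mxE (@linear_rowE _ _ (fun t => vec (D t) 0 l) t).
    by apply: eq_bigr => c _; rewrite mxE.
  move=> s u w; rewrite /D !deriveE// linearP lvec.
  by rewrite mxE mxE.
have fA : row_free A.
  apply: inj_row_free => t; rewrite AE => vD.
  apply: (local_rep_immersive himm ha ax ix); rewrite -/(D t).
  by rewrite -[LHS]vecK vD -[0 in LHS](linear_at0 lvec) vecK.
by rewrite -(eqP fA); exact: rank_leq_col.
Qed.

Lemma normal_bundle_embedded : embedded_submanifold atlasMT NM (2 * n).
Proof.
move=> [x0 v0] Sp; have [bv _] := Sp.
have [i ix] := CP_cover (iota x0).
have [a ha ax] := atlas_cover x0.
have mn := immersion_dim ha ax ix.
have [k Ek] : exists k, (2 * n = m + k)%N.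
  by exists (n + n - m)%N; rewrite subnKC// mul2n addnn.
rewrite Ek.
have Ed : (m + k = n + n)%N by rewrite -Ek mul2n addnn.
have [vec [unvec [[vecK unvecK lvec lunvec] [cvec cunvec]]]] := @ECn_coordinates R n _ Ed.
have [L TL] := complete_columns (normal_mx_inj himm vecK lunvec ha ax ix).
rewrite unitmxE unitfE in TL.
have [V [oV Vx Va Vi Vs]] := local_rep_smooth himm ha ax ix.
pose T y := row_mx (\matrix_(l < m + k, c < m)
  fs_pairing i (local_rep iota a i y) (unvec (delta_mx 0 l))
    ('D_(delta_mx 0 c) (local_rep iota a i) y)) L.
have sT y : V y -> smooth_near y (fun y => \det (T y)).
  move=> /Vs s; apply: smooth_near_det => p q; rewrite /T.
  case: (split_ordP q) => l ->.
    by under eq_fun do rewrite row_mxEl; exact: normal_mx_smooth.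
  by under eq_fun do rewrite row_mxEr; exact: smooth_near_cst.
(* a neighbourhood on which the completed matrix stays invertible *)
pose V' := V `&` (fun y => \det (T y)) @^-1` [set t | t != 0].
have oV' : open V'.
  apply: open_preimage => // y Vy; apply: smooth_near_continuous; exact: sT.
have P := normal_parametrization himm vecK unvecK lvec lunvec cvec cunvec ha
  (V := V') (L := L) oV' (fun y Vy => Va y Vy.1) (fun y Vy => Vi y Vy.1)
  (fun y Vy => Vs y Vy.1) (fun y Vy => Vy.2).
do 2 eexists; split; first exact: P.
have iv : cdom (TCP_chart R i) v0 by apply/cdom_base; rewrite bv.
pose u := row_mx (coord a x0) (vec (coord (TCP_chart R i) v0).2 *m L).
have Vu : V' (lsubmx u) by rewrite row_mxKl.
exists u; first exact: Vu.
exact: (paramK himm vecK lunvec ha (V := V') (L := L)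
  (fun y Vy => Vs y Vy.1) (fun y Vy => Vy.2) Sp ax iv Vu).
Qed.

Section Lagrangian.
Variable f : R -> R.
Hypothesis hf : forall x : R, 0 < x -> is_derive x 1 f (Num.sqrt x)^-1.
Variables (U : set 'rV[R]_(2 * n)) (g : 'rV[R]_(2 * n) -> M * TCP R n).
Hypothesis hg : local_parametrization atlasMT NM U g.
Let h u := Phi (g u).2.

(** The velocity of the base point of [g] is the image of the velocity of the
    point of the submanifold, to which [(g y).2] is normal.  Conversely that
    velocity is determined by the one of the base point, as [iota] is an
    immersion. *)
Lemma parametrization_local u : U u ->
  exists (i : 'I_n.+1) (H : 'rV[R]_(2 * n) -> 'rV[R]_m * (ECn * ECn)),
  [/\ smooth_near u H,
      (\forall y \near u, (g y).2 = cinv (TCP_chart R i) (H y).2),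
      (forall v, \forall y \near u, complex.Re (herm
         (insert i 0 (complexify ('D_v (fun y => (H y).2) y).1))
         (lift_snd i (H y).2)) = 0) &
      (forall v, 'D_v (fun y => (H y).2) u = 0 -> v = 0)].
Proof.
move=> Uu; have [oU [sg ig] _ SU _] := hg.
have [i iu] := TCP_cover (g u).2.
have [a ha au] := atlas_cover (g u).1.
pose b := Chart (cdom a `*` cdom (TCP_chart R i))
  (fun p => (coord a p.1, coord (TCP_chart R i) p.2))
  (fun e => (cinv a e.1, cinv (TCP_chart R i) e.2)).
have hb : atlasMT b by exists a, (TCP_chart R i); split=> //; exists i.
have bu : cdom b (g u) by split.
have [_ sgu] := sg (Chart U id id) u erefl Uu.
have [V [oV Vu VU Vb sV]] := sgu b hb bu.
exists i, (fun y => coord b (g y)).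
have sH y : V y -> smooth_near y (fun y => coord b (g y)).
  by move=> Vy; exact: smooth_on_near sV.
have VS y : V y -> NM (g y) by move=> /VU [y' Uy' <-]; exact: SU.
have Va y : V y -> cdom a (g y).1 by move=> /Vb [].
have Vi y : V y -> cdom (TCP_chart R i) (g y).2 by move=> /Vb [].
have Vx y : V y -> cdom (CP_chart R i) (iota (g y).1).
  by move=> Vy; have [<- _] := VS y Vy; apply/cdom_base; exact: Vi.
have E1 y : V y -> (coord (TCP_chart R i) (g y).2).1 = local_rep iota a i (coord a (g y).1).
  move=> Vy; have [bS _] := VS y Vy.
  by rewrite -coord_base bS (local_repE _ _ ha (Va y Vy)).
(* the base point of g is the composite of iota with the point of M *)
have D1 y v : V y -> ('D_v (fun y => (coord b (g y)).2) y).1 =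
    'D_('D_v (fun y => (coord b (g y)).1) y) (local_rep iota a i) (coord a (g y).1).
  move=> Vy; have [s1 s2] := (smooth_near_pair _ _).1 (sH y Vy).
  have d1 := smooth_near_differentiable s1.
  have d2 := smooth_near_differentiable s2.
  have dphi := smooth_near_differentiable (local_rep_near himm ha (Va y Vy) (Vx y Vy)).
  have [_ <-] := derive_chain v d1 dphi.
  rewrite -(derive_fst v d2); apply: near_eq_derive.
  by apply: filterS (open_near_set oV Vy) => y' /E1.
split.
- exact: sH.
- by apply: filterS (open_near_set oV Vu) => y Vy; rewrite [RHS]TCP_coordK//; exact: Vi.
- move=> v; apply: filterS (open_near_set oV Vu) => y Vy.
  have [bS _] := VS y Vy.
  have S := VS y Vy; rewrite [g y]surjective_pairing in S.
  have N := (normal_bundle_local himm ha (Va y Vy) bS (Vx y Vy)).1 S.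
  by rewrite (D1 y v Vy); exact: N.
move=> v D0.
have [s1 s2] := (smooth_near_pair _ _).1 (sH u Vu).
have dH := smooth_near_differentiable (sH u Vu).
have Dy0 : 'D_v (fun y => (coord b (g y)).1) u = 0.
  apply: (local_rep_immersive himm ha (Va u Vu) (Vx u Vu)).
  by rewrite -(D1 u v Vu) D0.
have DH0 : 'D_v (fun y => coord b (g y)) u = 0.
  rewrite [LHS]surjective_pairing -derive_fst// -derive_snd// D0 Dy0.
  by [].
have := ig (Chart U id id) b u erefl hb Uu bu => inj.
apply: inj; rewrite linear0.
by have := deriveE v dH; rewrite DH0 => <-.
Qed.

Lemma Phi_lagrangian : lagrangian_immersion f U h.
Proof.
have [oU _ _ _ _] := hg.
have chartP u jk : U u -> cdom (calM_chart R jk) (h u) ->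
    [/\ (\forall y \near u, cdom (calM_chart R jk) (h y)),
        smooth_near u (fun y => coord (calM_chart R jk) (h y)),
        (forall v, 'D_v (fun y => coord (calM_chart R jk) (h y)) u = 0 -> v = 0) &
        forall v w, Omega f jk (coord (calM_chart R jk) (h u))
          ('D_v (fun y => coord (calM_chart R jk) (h y)) u)
          ('D_w (fun y => coord (calM_chart R jk) (h y)) u) = 0].
  move=> Uu hu.
  have [i [H [sH gH NH inj]]] := parametrization_local Uu.
  have [_ se] := (smooth_near_pair _ _).1 sH.
  have hH : \forall y \near u, h y = Phi (cinv (TCP_chart R i) (H y).2).
    by apply: filterS gH => y gy; rewrite /h gy.
  have hu' := nbhs_singleton hH.
  have cu : cdom (calM_chart R jk) (Phi (cinv (TCP_chart R i) (H u).2)) by rewrite -hu'.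
  have [N s] := Phi_smooth se cu.
  have eqc : \forall y \near u, coord (calM_chart R jk) (h y) =
      coord (calM_chart R jk) (Phi (cinv (TCP_chart R i) (H y).2)).
    by apply: filterS hH => y ->.
  have eqD v : 'D_v (fun y => coord (calM_chart R jk) (h y)) u =
      'D_v (fun y => coord (calM_chart R jk) (Phi (cinv (TCP_chart R i) (H y).2))) u.
    exact: near_eq_derive.
  split.
  - by apply: filterS2 hH N => y ->.
  - by apply: smooth_near_ext s; apply: filterS eqc => y ->.
  - by move=> v; rewrite eqD => /(Phi_immersive se cu) /inj.
  - move=> v w; rewrite !eqD hu'.
    exact: (Phi_Omega_zero (i := i) (e := fun y => (H y).2) (jk := jk) hf v w se cu NH).
split; last first.
  move=> u jk Uu hu s t; have [_ sm _ O] := chartP u jk Uu hu.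
  have d := smooth_near_differentiable sm.
  have := O s t; rewrite !(deriveE _ d).
  exact.
split.
  move=> _ u -> Uu; split.
    have [j hj] := CP_cover (h u).1; have [k hk] := CP_cover (h u).2.
    exists (calM_chart R (j, k)); first by exists (j, k).
    by split; [exact: Phi_calM|split].
  move=> _ [jk _ <-] hu; have [N sm _ _] := chartP u jk Uu hu.
  have [W [oW Wu WU WP sW]] := smooth_map_witness oU Uu N sm.
  exists W; split.
  - exact: oW.
  - exact: Wu.
  - by move=> y /WU Uy; exists y.
  - exact: WP.
  - exact: sW.
move=> _ _ u -> [jk _ <-] Uu hu; have [_ sm inj _] := chartP u jk Uu hu.
by apply: injective_diff => //; exact: smooth_near_differentiable.
Qed.

End Lagrangian.
End Assembly.

Theorem proposition1 (R : realType) (n m : nat) (M : smooth_manifold R m)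
  (iota : M -> CP R n) (f : R -> R)
  (himm : immersion (@atlas R m M) (@CP_atlas R n) iota)
  (hf : forall x : R, 0 < x -> is_derive x 1 f (Num.sqrt x)^-1) :
  embedded_submanifold (prod_atlas (@atlas R m M) (@TCP_atlas R n))
    (normal_bundle iota) (2 * n) /\
  forall (U : set 'rV[R]_(2 * n)) (g : 'rV[R]_(2 * n) -> M * TCP R n),
    local_parametrization (prod_atlas (@atlas R m M) (@TCP_atlas R n))
      (normal_bundle iota) U g ->
    lagrangian_immersion f U (fun u => Phi (g u).2).
Proof.
split; first exact: normal_bundle_embedded.
by move=> U g hg; exact: Phi_lagrangian hg.
Qed.
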